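(* Let $K=\mathbb C$, $V$ a finite-dimensional $K$-vector space, $G\leqslant\mathrm{GL}(V)$ a finite group generated by pseudo-reflections. Let $(\varphi,\psi)$ be the matrix factorization of $J$ over $S$ given by $\varphi:S\otimes_RS\to\mathrm{Maps}(G,S)$, $\varphi(\sum_i a_i\otimes b_i)(g)=\sum_i a_i\,g(b_i)$, and the left $S$-linear map $\psi:\mathrm{Maps}(G,S)\to S\otimes_RS$ with $\varphi\psi=J\,\mathrm{id}$ and $\psi\varphi=J\,\mathrm{id}$, so that $\mathrm{coker}\,\varphi=\overline A=A/AeA$. Then: (a) The morphism $\psi$ is the ($S$-)transpose of $\varphi$ up to base change. (b) $\mathrm{Hom}_S(\overline A,S/(J))\cong\mathrm{syz}^1_{S/(J)}\overline A$, the first syzygy of $\overline A$ over $S/(J)$. (c) $\det(\varphi)=J^{|G|/2}$ (up to a nonzero scalar in $K$). (d) Let $\Delta_j$ be an irreducible component of $\Delta$ in $R$ and let $r_j$ be the ramification index of $S$ over $R$ along $\Delta_j$. The rank of $\overline A$ along $\Delta_j$ is $$\mathrm{rank}_{\Delta_j}\overline A=\frac{(r_j-1)|G|^2}{2r_j}=\binom{r_j}{2}\frac{|G|^2}{r_j^2}.$$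
   Context: $S=\mathrm{Sym}_K(V)=K[x_1,\dots,x_n]$ with induced $G$-action; a pseudo-reflection is an element conjugate to $\mathrm{diag}(\zeta,1,\dots,1)$, $\zeta\ne1$ a root of unity, with mirror its fixed hyperplane. $R=S^G=K[f_1,\dots,f_n]$, $f_i$ homogeneous basic invariants; $J=\det(\partial f_i/\partial x_j)$, which up to scalar is $\prod_HL_H^{\rho_H-1}$ over the mirrors $H$, where $\rho_H$ is the order of the cyclic subgroup of $G$ fixing $H$ pointwise and $L_H\in V=S_1$ spans $\mathrm{Im}(s-1)$ for a pseudo-reflection $s\in G$ with mirror $H$. $\Delta=\prod_HL_H^{\rho_H}\in R$ is the discriminant; it is reduced in $R$, with irreducible factors $\Delta_j=\prod_{H\in O_j}L_H^{\rho_H}$ for the $G$-orbits $O_j$ of mirrors, and $r_j=\rho_H$ for $H\in O_j$. $A=S*G$ is the free left $S$-module on $\{\delta_g\}$ with $(s'\delta_{g'})(s\delta_g)=s'g'(s)\delta_{g'g}$; $e=\frac1{|G|}\sum_g\delta_g$; $\overline A$ is a left $S$-module and an $R/(\Delta)$-module. $\mathrm{Maps}(G,S)\cong S^{|G|}$ and $S\otimes_RS$ (via the first factor) are free left $S$-modules of rank $|G|$. $\det(\varphi)$ is taken with respect to homogeneous $S$-bases. ''Transpose up to base change'' means the matrix of $\psi$ is $P\Phi^{T}Q$ with $P,Q$ invertible over $S$, $\Phi$ the matrix of $\varphi$. $\mathrm{rank}_{\Delta_j}\overline A$ is the dimension of the localization of $\overline A$ at the prime $(\Delta_j)$ over the fraction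 field of $R/(\Delta_j)$. *)

(* Defs.v *)
From HB Require Import structures.
From mathcomp Require Import all_boot all_order all_fingroup all_algebra.
From mathcomp Require Import generic_quotient ring_quotient.
From mathcomp Require Import mxrepresentation.
From mathcomp Require Import boolp functions reals complex.
From mathcomp.multinomials Require Import freeg mpoly.

Set Implicit Arguments.
Unset Strict Implicit.
Unset Printing Implicit Defensive.

Import GRing.Theory Quotient.
Local Open Scope ring_scope.
Local Open Scope quotient_scope.

(* The closure structures of the library do not derive stability under
   opposite from stability under scaling. *)
Section SubMod.
Variables (A : nzRingType) (V : lmodType A) (U : submodClosed V).

Definition submod_pred : {pred V} := (U : {pred V}).

Lemma submod_predP : submod_closed submod_pred.
Proof. by split=> [|a u v hu hv]; [exact: (@rpred0 V U) | by apply: (@rpredD V U); [apply: (@rpredZ A V U)|]]. Qed.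
HB.instance Definition _ :=
  GRing.isSubmodClosed.Build A V submod_pred submod_predP.

Record sub_mod := SubMod { sub_mod_val : V; _ : sub_mod_val \in submod_pred }.

HB.instance Definition _ := [isSub for sub_mod_val].
HB.instance Definition _ := [Choice of sub_mod by <:].
HB.instance Definition _ := [SubChoice_isSubLmodule of sub_mod by <:].

End SubMod.

Section QuotMod.
Variables (A : nzRingType) (V : lmodType A) (U : submodClosed V).

Definition quot_mod : Type := {quot (submod_pred U)}.
HB.instance Definition _ := GRing.Zmodule.on quot_mod.

Definition quot_pi (v : V) : quot_mod := \pi_{quot (submod_pred U)} v.
Definition quot_scale (a : A) (x : quot_mod) : quot_mod :=
  quot_pi (a *: repr (x : {quot (submod_pred U)})).

Lemma quot_piP v w : (quot_pi v = quot_pi w) <-> (v - w \in submod_pred U).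
Proof.
rewrite -equivE; split=> [/eqmodP //|h]; exact/eqmodP.
Qed.

Lemma quot_piB : zmod_morphism quot_pi.
Proof. by move=> v w; rewrite /quot_pi raddfB. Qed.

Lemma quot_scale_pi a v : quot_scale a (quot_pi v) = quot_pi (a *: v).
Proof.
apply/quot_piP; rewrite -scalerBr rpredZ //.
by apply/quot_piP; rewrite /quot_pi reprK.
Qed.

Lemma quot_piW (P : quot_mod -> Prop) : (forall v, P (quot_pi v)) -> forall x, P x.
Proof. by move=> h; elim/quotW. Qed.

Lemma quot_scaleA a b x : quot_scale a (quot_scale b x) = quot_scale (a * b) x.
Proof. by elim/quot_piW: x => v; rewrite !quot_scale_pi scalerA. Qed.
Lemma quot_scale1 : left_id 1 quot_scale.
Proof. by elim/quot_piW=> v; rewrite quot_scale_pi scale1r. Qed.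

HB.instance Definition _ := GRing.isZmodMorphism.Build V quot_mod quot_pi quot_piB.

Lemma quot_scaleDr : right_distributive quot_scale +%R.
Proof.
move=> a; elim/quot_piW=> v; elim/quot_piW=> w.
by rewrite -raddfD !quot_scale_pi -raddfD scalerDr.
Qed.
Lemma quot_scaleDl x : {morph quot_scale^~ x : a b / a + b}.
Proof.
move=> a b; elim/quot_piW: x => v.
by rewrite !quot_scale_pi -raddfD scalerDl.
Qed.

HB.instance Definition _ := GRing.Zmodule_isLmodule.Build A quot_mod
  quot_scaleA quot_scale1 quot_scaleDr quot_scaleDl.

Lemma quot_piZ : scalable quot_pi.
Proof. by move=> a v; rewrite -quot_scale_pi. Qed.
HB.instance Definition _ :=
  GRing.isScalable.Build A V quot_mod *:%R quot_pi quot_piZ.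

End QuotMod.
Arguments quot_pi {A V} U v.

Section Submodules.
Variables (A : comNzRingType) (V W : lmodType A).

Definition ker_pred (q : {linear V -> W}) : {pred V} := fun v => q v == 0.

Lemma ker_submod q : submod_closed (ker_pred q).
Proof.
split=> [|a u v]; rewrite !unfold_in ?raddf0 //.
by move=> /eqP hu /eqP hv; rewrite linearP hu hv scaler0 addr0.
Qed.
HB.instance Definition _ q :=
  GRing.isSubmodClosed.Build A V (ker_pred q) (ker_submod q).

Definition span_pred (X : V -> Prop) : {pred V} := fun v =>
  `[< exists2 s : seq (A * V), (forall p, p \in s -> X p.2) &
      v = \sum_(p <- s) p.1 *: p.2 >].

Lemma span_submod X : submod_closed (span_pred X).
Proof.
split=> [|a u v]; rewrite !unfold_in; first by apply/asboolP; exists [::]; rewrite ?big_nil.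
move=> /asboolP[s hs ->] /asboolP[t ht ->]; apply/asboolP.
exists ([seq (a * p.1, p.2) | p <- s] ++ t).
  by move=> p; rewrite mem_cat => /orP[/mapP[q /hs h -> //]|/ht].
rewrite big_cat big_map scaler_sumr; congr (_ + _).
by apply: eq_bigr => p _; rewrite scalerA.
Qed.
HB.instance Definition _ X :=
  GRing.isSubmodClosed.Build A V (span_pred X) (span_submod X).

Definition lin_pred : {pred V -> W} := fun f => `[< linear f >].

Lemma lin_submod : submod_closed lin_pred.
Proof.
split=> [|a f g]; rewrite !unfold_in.
  by apply/asboolP => a u v; rewrite /= scaler0 addr0.
move=> /asboolP hf /asboolP hg; apply/asboolP => b u v.
rewrite -[LHS]/(a *: f (b *: u + v) + g (b *: u + v)).
rewrite -[RHS]/(b *: (a *: f u + g u) + (a *: f v + g v)) hf hg.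
by rewrite !scalerDr !scalerA mulrC addrACA.
Qed.
HB.instance Definition _ :=
  GRing.isSubmodClosed.Build A (V -> W) lin_pred lin_submod.

Definition lmod_iso : Prop := exists f : {linear V -> W}, bijective f.

End Submodules.
Arguments lmod_iso {A} V W.

Notation kernel q := (sub_mod (ker_pred q)).
Notation hom_mod V W := (sub_mod (@lin_pred _ V W)).

Section Principal.
Variables (S : comNzRingType) (J : S).

Definition principal_pred : {pred S^o} := fun x => `[< exists q : S, x = q * J >].

Lemma principal_submod : submod_closed principal_pred.
Proof.
split=> [|a u v]; rewrite !unfold_in; first by apply/asboolP; exists 0; rewrite mul0r.
move=> /asboolP[q ->] /asboolP[q' ->]; apply/asboolP; exists (a * q + q').
by rewrite mulrDl -mulrA.
Qed.
HB.instance Definition _ :=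
  GRing.isSubmodClosed.Build S S^o principal_pred principal_submod.

(* S/(J) as an S-module; it is zero when J is a unit, so it is not given a
   (nontrivial) ring structure. *)
Definition quot_principal := quot_mod principal_pred.
HB.instance Definition _ := GRing.Lmodule.on quot_principal.

End Principal.

Section Bases.
Variables (S : comNzRingType) (M N : lmodType S) (m : nat).

Definition is_basis (b : 'I_m -> M) : Prop :=
  forall x, exists! c : 'rV[S]_m, x = \sum_i c 0 i *: b i.

Definition is_matrix (b : 'I_m -> M) (c : 'I_m -> N) (h : M -> N)
    (P : 'M[S]_m) : Prop :=
  forall j, h (b j) = \sum_i P i j *: c i.

End Bases.

(* Extension of scalars of the R-module S along R -> S: the free left S-module
   on the symbols <<b>>, b in S, modulo R-linearity of b |-> <<b>>;
   a (x) b is the class of a <<b>>. *)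
Section Tensor.
Variables (S : comNzRingType) (R : {pred S}).

Definition tens_rel (v : {freeg S / S}) : Prop :=
  (exists b b' : S, v = << b + b' >> - << b >> - << b' >>) \/
  (exists r b : S, r \in R /\ v = << r * b >> - r *: << b >>).

Definition tensor := quot_mod (span_pred tens_rel).
HB.instance Definition _ := GRing.Lmodule.on tensor.

Definition tens (a b : S) : tensor := quot_pi (span_pred tens_rel) << a *g b >>.

Lemma tensDl a a' b : tens (a + a') b = tens a b + tens a' b.
Proof. by rewrite /tens -freegUD raddfD. Qed.

Lemma freegUZ a b : << a *g b >> = a *: << b >> :> {freeg S / S}.
Proof. by apply/eqP/freeg_eqP => x; rewrite coeffZ !coeffU mul1r. Qed.

Lemma span_in (V : lmodType S) (X : V -> Prop) (a : S) (v : V) :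
  X v -> a *: v \in span_pred X.
Proof.
move=> hv; apply/asboolP; exists [:: (a, v)]; last by rewrite big_seq1.
by move=> p; rewrite inE => /eqP->.
Qed.

Lemma tensDr a b b' : tens a (b + b') = tens a b + tens a b'.
Proof.
rewrite /tens -raddfD; apply/quot_piP.
rewrite (freegUZ a (b + b')) (freegUZ a b) (freegUZ a b') -scalerDr -scalerBr; apply: span_in.
by left; exists b, b'; rewrite opprD addrA.
Qed.

Lemma tens_balanced r a b : r \in R -> tens (a * r) b = tens a (r * b).
Proof.
move=> rR; apply/esym/quot_piP.
rewrite (freegUZ a (r * b)) (freegUZ (a * r) b) -scalerA -scalerBr; apply: span_in.
by right; exists r, b.
Qed.

Lemma scale_tens s a b : s *: tens a b = tens (s * a) b.
Proof. by rewrite /tens -linearZ (freegUZ a b) (freegUZ (s * a) b) scalerA. Qed.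

Section Lift.
Variables (M : lmodType S) (beta : S -> M).
Hypothesis betaD : {morph beta : b b' / b + b'}.
Hypothesis betaR : forall r b, r \in R -> beta (r * b) = r *: beta b.

Lemma fglift_linear : linear (fglift beta).
Proof.
have addB := @lift_is_additive S S M beta.
have add0 : fglift beta 0 = 0 by rewrite -[0 in LHS]subr0 addB subrr.
have addN x : fglift beta (- x) = - fglift beta x by rewrite -sub0r addB add0 sub0r.
have addD x y : fglift beta (x + y) = fglift beta x + fglift beta y.
  by rewrite -[y in LHS]opprK addB addN opprK.
have addS (s : seq S) (F : S -> {freeg S / S}) :
    fglift beta (\sum_(i <- s) F i) = \sum_(i <- s) fglift beta (F i).
  by elim: s => [|i s ih]; rewrite ?big_nil // !big_cons addD ih.
move=> a x y; rewrite addD; congr (_ + _).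
rewrite -{1 2}[x]freeg_sumE scaler_sumr !addS scaler_sumr.
apply: eq_bigr => b _; rewrite (liftU beta (coeff b x) b) (freegUZ (coeff b x) b).
by rewrite scalerA -freegUZ liftU scalerA.
Qed.

Definition tens_lift (t : tensor) : M := fglift beta (repr (t : {quot (submod_pred (span_pred tens_rel))})).

Lemma tens_lift_pi v : tens_lift (quot_pi (span_pred tens_rel) v) = fglift beta v.
Proof.
have FB : {morph fglift beta : x y / x - y} := zmod_morphism_linear fglift_linear.
have FP := fglift_linear.
have F0 : fglift beta 0 = 0 by rewrite -[0 in LHS](subrr 0) FB subrr.
have FZ c w : fglift beta (c *: w) = c *: fglift beta w.
  by rewrite -[c *: w]addr0 FP F0 addr0.
suff kill w : w \in span_pred tens_rel -> fglift beta w = 0.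
  apply/eqP; rewrite -subr_eq0 -FB; apply/eqP/kill.
  by apply/quot_piP; rewrite /quot_pi reprK.
move=> /asboolP[s hs ->]; elim: s hs => [|p s ih] hs; rewrite ?big_nil // big_cons FP.
rewrite ih ?addr0; last by move=> q qs; apply: hs; rewrite inE qs orbT.
case: (hs p (mem_head _ _)) => [[b [b' ->]]|[r [b [rR ->]]]].
  by rewrite !FB !liftU !scale1r betaD addrAC addrK subrr scaler0.
by rewrite FB FZ !liftU !scale1r betaR // subrr scaler0.
Qed.

Lemma tens_lift_linear : linear tens_lift.
Proof.
move=> a; elim/quot_piW => x; elim/quot_piW => y.
by rewrite -linearP !tens_lift_pi fglift_linear.
Qed.

Lemma tens_liftE a b : tens_lift (tens a b) = a *: beta b.
Proof. by rewrite /tens tens_lift_pi liftU. Qed.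

End Lift.
End Tensor.

(* G is the image of a faithful representation rG of the finite group gT; it
   acts on V = K^n by v |-> rG g *m v, and x_1, ..., x_n is the standard basis
   of V = S_1. *)
Section Action.
Variables (K : fieldType) (gT : finGroupType) (n : nat).
Variable rG : mx_representation K [set: gT] n.

Local Notation S := {mpoly K[n]}.
Local Notation Maps := {ffun gT -> S^o}.

Definition lin_form (v : 'cV[K]_n) : S := \sum_i v i 0 *: 'X_i.

Definition act (g : gT) (p : S) : S :=
  p \mPo [tuple lin_form (col j (rG g)) | j < n].

HB.instance Definition _ g := GRing.RMorphism.copy (act g)
  (comp_mpoly [tuple lin_form (col j (rG g)) | j < n]).

Lemma actZ g c p : act g (c *: p) = c *: act g p.
Proof. exact: comp_mpolyZ. Qed.

Lemma actX g j : act g 'X_j = lin_form (rG g *m delta_mx j 0).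
Proof.
rewrite /act comp_mpolyXU -tnth_nth tnth_mktuple; congr lin_form.
exact: colE.
Qed.

Lemma act_lin g v : act g (lin_form v) = lin_form (rG g *m v).
Proof.
rewrite /lin_form rmorph_sum /=.
under eq_bigr => i _ do rewrite actZ actX scaler_sumr.
rewrite exchange_big /=; apply: eq_bigr => i _.
under eq_bigr => j _ do rewrite scalerA.
rewrite -scaler_suml; congr (_ *: _); rewrite !mxE.
apply: eq_bigr => j _; rewrite !mxE mulrC; congr (_ * _).
rewrite (bigD1 j) //= big1 ?addr0 => [|k /negPf kj].
  by rewrite mxE !eqxx mulr1.
by rewrite mxE kj mulr0.
Qed.

Lemma act_ext (h h' : {rmorphism S -> S}) :
    (forall c p, h (c *: p) = c *: h p) -> (forall c p, h' (c *: p) = c *: h' p) ->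
  (forall i, h 'X_i = h' 'X_i) -> h =1 h'.
Proof.
move=> hZ hZ' hX p; rewrite [p]mpolyE !rmorph_sum; apply: eq_bigr => m _.
rewrite hZ hZ'; congr (_ *: _); rewrite mpolyXE_id !rmorph_prod.
by apply: eq_bigr => i _; rewrite !rmorphXn hX.
Qed.

Lemma lin_formX j : lin_form (delta_mx j 0) = 'X_j.
Proof.
rewrite /lin_form (bigD1 j) //= big1 ?addr0 => [|k /negPf kj].
  by rewrite mxE !eqxx scale1r.
by rewrite mxE kj scale0r.
Qed.

Lemma actM g h p : act (g * h)%g p = act g (act h p).
Proof.
move: p; pose F : {rmorphism S -> S} := act g \o act h.
apply: (@act_ext (act (g * h)%g) F) => [c p|c p|i] /=; rewrite ?actZ //.
by rewrite !actX act_lin repr_mxM ?inE // mulmxA.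
Qed.

Lemma act1 p : act 1%g p = p.
Proof.
move: p; apply: (@act_ext (act 1%g) idfun) => [c p|//|i]; first exact: actZ.
by rewrite -[LHS]/(act 1%g 'X_i) actX repr_mx1 mul1mx lin_formX.
Qed.

Definition inv_pred : {pred S} := fun p => [forall g, act g p == p].

Lemma inv_subring : subring_closed inv_pred.
Proof.
split=> [|p q|p q]; rewrite !unfold_in.
- by apply/forallP=> g; rewrite rmorph1.
- by move=> /forallP hp /forallP hq; apply/forallP=> g;
    rewrite rmorphB /= (eqP (hp g)) (eqP (hq g)).
- by move=> /forallP hp /forallP hq; apply/forallP=> g;
    rewrite rmorphM /= (eqP (hp g)) (eqP (hq g)).
Qed.
HB.instance Definition _ := GRing.isSubringClosed.Build S inv_pred inv_subring.

Record invariants := Invariant { inv_val : S; _ : inv_val \in inv_pred }.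
HB.instance Definition _ := [isSub for inv_val].
HB.instance Definition _ := [Choice of invariants by <:].
HB.instance Definition _ := [SubChoice_isSubComNzRing of invariants by <:].

Definition basic_invariants (f : n.-tuple S) : Prop :=
  [/\ forall i, exists d, tnth f i \is d.-homog,
      forall p, p \in inv_pred <-> exists q : {mpoly K[n]}, p = q \mPo f
    & forall q : {mpoly K[n]}, q \mPo f = 0 -> q = 0].

Definition jacobian (f : n.-tuple S) : S :=
  \det (\matrix_(i, j) mderiv j (tnth f i)).

Definition is_pseudo_reflection (s : 'M[K]_n) : Prop :=
  (0 < n)%N /\ exists (P : 'M[K]_n) (zeta : K),
    [/\ P \in unitmx, zeta != 1, exists2 m, (0 < m)%N & zeta ^+ m = 1
      & s = P *m diag_mx (\row_i (if val i == 0%N then zeta else 1)) *m invmx P].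

Definition pseudo_reflections : {set gT} :=
  [set g | `[< is_pseudo_reflection (rG g) >]].

(* A subspace H of V is encoded by the canonical matrix whose row space is
   {v^T | v in H}; in particular equality of mirrors is equality of matrices,
   and g H is encoded by <<H *m (rG g)^T>>. *)
Definition mirror (g : gT) : 'M[K]_n := <<eigenspace (rG g)^T 1>>%MS.

Definition mirrors : seq 'M[K]_n :=
  undup [seq mirror s | s <- enum pseudo_reflections].

Definition mirror_orbit (H : 'M[K]_n) : seq 'M[K]_n :=
  [seq H' <- mirrors | [exists g, H' == <<H *m (rG g)^T>>%MS]].

Definition ramif (H : 'M[K]_n) : nat := #|[set g | H *m (rG g)^T == H]|.

(* L H spans the image of s - 1 (a column space) for every pseudo-reflection
   s of G with mirror H. *)
Definition mirror_roots (L : 'M[K]_n -> 'cV[K]_n) : Prop :=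
  forall s, s \in pseudo_reflections ->
    ((L (mirror s))^T == (rG s - 1%:M)^T)%MS.

Definition orbit_discriminant (L : 'M[K]_n -> 'cV[K]_n) (H : 'M[K]_n) : S :=
  \prod_(H' <- mirror_orbit H) lin_form (L H') ^+ ramif H'.

(* x : skew is the element \sum_g x(g) delta_g. *)
Definition skew : Type := Maps.
HB.instance Definition _ := GRing.Lmodule.on skew.

Definition delta (g : gT) : skew := [ffun h => ((h == g)%:R : S^o)].

Definition skew_mul (x y : skew) : skew :=
  [ffun k => (\sum_g (x g : S) * act g (y (g^-1 * k)%g) : S^o)].

Lemma skew_mulA : associative skew_mul.
Proof.
move=> x y z; apply/ffunP => k; rewrite !ffunE.
under eq_bigr => g _ do rewrite ffunE rmorph_sum mulr_sumr.
under [RHS]eq_bigr => g _ do rewrite ffunE mulr_suml.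
rewrite [RHS]exchange_big; apply: eq_bigr => g _ /=.
rewrite [RHS](reindex_inj (mulgI g)); apply: eq_bigr => h _ /=.
by rewrite rmorphM /= -actM mulKg invMg mulgA mulrA.
Qed.

Lemma skew_mul1l : left_id (delta 1%g) skew_mul.
Proof.
move=> x; apply/ffunP => k; rewrite ffunE (bigD1 1%g) //= big1.
  by rewrite ffunE eqxx mul1r act1 invg1 mul1g addr0.
by move=> g /negPf g1; rewrite ffunE g1 mul0r.
Qed.

Lemma skew_mul1r : right_id (delta 1%g) skew_mul.
Proof.
move=> x; apply/ffunP => k; rewrite ffunE (bigD1 k) //= big1.
  by rewrite ffunE mulVg eqxx rmorph1 mulr1 addr0.
move=> g gk; rewrite ffunE -(inj_eq (mulgI g)) mulKVg mulg1 eq_sym (negPf gk).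
by rewrite rmorph0 mulr0.
Qed.

Lemma skew_mulDl : left_distributive skew_mul +%R.
Proof.
move=> x y z; apply/ffunP => k; rewrite !ffunE -big_split /=.
by apply: eq_bigr => g _; rewrite !ffunE mulrDl.
Qed.

Lemma skew_mulDr : right_distributive skew_mul +%R.
Proof.
move=> x y z; apply/ffunP => k; rewrite !ffunE -big_split /=.
by apply: eq_bigr => g _; rewrite !ffunE rmorphD mulrDr.
Qed.

Lemma skew_1neq0 : delta 1%g != 0.
Proof. by apply/eqP=> /ffunP/(_ 1%g)/eqP; rewrite !ffunE eqxx oner_eq0. Qed.

HB.instance Definition _ := GRing.Zmodule_isNzRing.Build skew
  skew_mulA skew_mul1l skew_mul1r skew_mulDl skew_mulDr skew_1neq0.

Lemma scale_deltaE (s : S) (g h : gT) : (s *: delta g) h = s * (h == g)%:R.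
Proof. by rewrite [LHS]ffunE [delta g h]ffunE. Qed.

Lemma skew_deltaM (s s' : S) (g g' : gT) :
  (s' *: delta g') * (s *: delta g) = (s' * act g' s) *: delta (g' * g)%g.
Proof.
apply/ffunP => k; apply: etrans (ffunE _ k) _; apply: etrans (esym (scale_deltaE _ _ k)).
transitivity (\sum_h (s' * (h == g')%:R) * act h (s * (h^-1 * k == g)%g%:R)).
  by apply: eq_bigr => h _; congr (_ * act _ _); exact: scale_deltaE.
rewrite (bigD1 g') //= big1 => [|h /negPf->]; last by rewrite mulr0 mul0r.
rewrite eqxx mulr1 addr0 rmorphM /= rmorph_nat mulrA.
by rewrite -(inj_eq (mulgI g')) mulKVg.
Qed.

Definition idem : skew := (#|gT|%:R^-1)%:MP *: \sum_g delta g.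

Definition ideal_pred : {pred skew} := fun x =>
  `[< exists s : seq (skew * skew), x = \sum_(p <- s) p.1 * idem * p.2 >].

Lemma skew_scaleAl (a : S) (x y : skew) : a *: (x * y) = (a *: x) * y.
Proof.
apply/ffunP => k; rewrite !ffunE scaler_sumr; apply: eq_bigr => g _.
by rewrite !ffunE /GRing.scale /= mulrA.
Qed.

Lemma ideal_submod : submod_closed ideal_pred.
Proof.
split=> [|a u v]; rewrite !unfold_in; first by apply/asboolP; exists [::]; rewrite big_nil.
move=> /asboolP[s ->] /asboolP[t ->]; apply/asboolP.
exists ([seq (a *: p.1, p.2) | p <- s] ++ t).
rewrite big_cat big_map scaler_sumr; congr (_ + _).
by apply: eq_bigr => p _; rewrite !skew_scaleAl.
Qed.
HB.instance Definition _ :=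
  GRing.isSubmodClosed.Build S skew ideal_pred ideal_submod.

Definition skew_quot := quot_mod ideal_pred.
HB.instance Definition _ := GRing.Lmodule.on skew_quot.

(* Maps(G, S) is identified with A as a left S-module by
   h |-> \sum_g h(g) delta_g. *)
Definition skew_pi (h : Maps) : skew_quot := quot_pi ideal_pred (h : skew).

Definition tensSS := tensor inv_pred.
HB.instance Definition _ := GRing.Lmodule.on tensSS.

Definition phi : tensSS -> Maps :=
  tens_lift (fun b : S => [ffun g => (act g b : S^o)] : Maps).

Lemma phi_subproof1 :
  {morph (fun b : S => [ffun g => (act g b : S^o)] : Maps) : b b' / b + b'}.
Proof. by move=> b b'; apply/ffunP => g; rewrite !ffunE rmorphD. Qed.

Lemma phi_subproof2 r b : r \in inv_pred ->
  [ffun g => (act g (r * b) : S^o)] = r *: [ffun g => (act g b : S^o)] :> Maps.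
Proof.
by move=> /forallP hr; apply/ffunP => g; rewrite !ffunE rmorphM /= (eqP (hr g)).
Qed.

HB.instance Definition _ := GRing.isLinear.Build S tensSS Maps *:%R phi
  (tens_lift_linear phi_subproof1 phi_subproof2).

Lemma phiE a b g : phi (tens inv_pred a b) g = a * act g b.
Proof. by rewrite /phi (tens_liftE phi_subproof1 phi_subproof2) !ffunE. Qed.

Lemma tens_sum (t : tensSS) :
  exists s : seq (S * S), t = \sum_(p <- s) tens inv_pred p.1 p.2.
Proof.
elim/quot_piW: t => v; exists [seq (coeff b v, b) | b <- dom v].
by rewrite big_map -[v in LHS]freeg_sumE raddf_sum; apply: eq_bigr.
Qed.

Lemma skew_idemE (x y : skew) (k : gT) : (x * idem * y) k =
  (\sum_h (x h : S) * (#|gT|%:R^-1)%:MP) * act k (\sum_u act u^-1%g (y u)).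
Proof.
have xe g : (x * idem) g = \sum_h (x h : S) * (#|gT|%:R^-1)%:MP.
  apply: etrans (ffunE _ g) _; apply: eq_bigr => h _; congr (_ * _).
  have -> : idem (h^-1 * g)%g = (#|gT|%:R^-1)%:MP.
    rewrite /idem ffunE sum_ffunE (bigD1 (h^-1 * g)%g) //= big1.
      by rewrite ffunE eqxx addr0 /GRing.scale /= mulr1.
    by move=> i /negPf ni; rewrite ffunE eq_sym ni.
  by rewrite /act comp_mpolyC.
apply: etrans (ffunE _ k) _.
under eq_bigr => g _ do rewrite xe.
rewrite -mulr_sumr; congr (_ * _); rewrite rmorph_sum /=.
rewrite (reindex_inj (inj_comp (mulgI k) invg_inj)) /=; apply: eq_bigr => u _.
by rewrite invMg invgK mulgKV actM.
Qed.

Lemma phi_coker : #|gT|%:R != 0 :> K ->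
  forall x : Maps, (x : skew) \in ideal_pred <-> exists t, x = phi t.
Proof.
move=> G0 x; split=> [/asboolP[s ->]|[t ->]].
  exists (\sum_(p <- s) tens inv_pred
    (\sum_h (p.1 h : S) * (#|gT|%:R^-1)%:MP) (\sum_u act u^-1%g (p.2 u))).
  rewrite raddf_sum; apply: eq_bigr => p _; apply/ffunP => k.
  by rewrite phiE skew_idemE.
have [s ->] := tens_sum t; apply/asboolP.
exists [seq ((p.1 * #|gT|%:R%:MP) *: delta 1%g, p.2 *: delta 1%g) | p <- s].
rewrite big_map raddf_sum; apply: eq_bigr => p _; apply/ffunP => k.
rewrite phiE skew_idemE /=; congr (_ * act k _).
  rewrite (bigD1 1%g) //= big1 => [|h /negPf h1]; last by rewrite scale_deltaE h1 mulr0 mul0r.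
  by rewrite scale_deltaE eqxx mulr1 addr0 -mulrA -mpolyCM divff // mpolyC1 mulr1.
rewrite (bigD1 1%g) //= big1 => [|h /negPf h1]; last by rewrite scale_deltaE h1 mulr0 rmorph0.
by rewrite scale_deltaE eqxx mulr1 addr0 invg1 act1.
Qed.

Definition maps_homog (h : Maps) : Prop :=
  exists d, forall g, (h g : S) \is d.-homog.

Definition tens_homog (t : tensSS) : Prop :=
  exists (d : nat) (s : seq (S * S)),
    t = \sum_(p <- s) tens inv_pred p.1 p.2 /\
    forall p, p \in s -> exists d1 d2,
      [/\ p.1 \is d1.-homog, p.2 \is d2.-homog & (d1 + d2 = d)%N].

(* rho exhibits k as the fraction field of R/(D). *)
Definition is_residue_field (D : invariants) (k : fieldType)
    (rho : {rmorphism invariants -> k}) : Prop :=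
  (forall a, rho a = 0 <-> exists b, a = b * D) /\
  (forall x, exists a b, rho b != 0 /\ x = rho a / rho b).

(* iota exhibits W as the localization of M at the complement of ker rho
   (elements of the complement act invertibly on the k-space W). *)
Definition is_localization (k : fieldType) (rho : {rmorphism invariants -> k})
    (M : lmodType S) (W : lmodType k) (iota : {additive M -> W}) : Prop :=
  [/\ forall (a : invariants) m, iota (inv_val a *: m) = rho a *: iota m,
      forall w, exists (a : invariants) m, rho a != 0 /\ w = (rho a)^-1 *: iota m
    & forall m, iota m = 0 <->
        exists a : invariants, rho a != 0 /\ inv_val a *: m = 0].

Definition rank_along (D : invariants) (M : lmodType S) (d : nat) : Prop :=
  exists (k : fieldType) (rho : {rmorphism invariants -> k}) (W : vectType k)
         (iota : {additive M -> W}),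
    [/\ is_residue_field D rho, is_localization rho iota & \dim {:W} = d].

End Action.

(* Main.v *)
Require Import Defs.
From mathcomp Require Import all_boot all_order all_fingroup all_algebra.
From mathcomp Require Import mxrepresentation functions reals complex.
From mathcomp.multinomials Require Import mpoly.
From HB Require Import structures.
From mathcomp Require Import ring zify cyclic generic_quotient ring_quotient.

(* By Chevalley's argument S has a finite R-basis of monomials b_i; since phi and
   psi are inverse to each other up to J, it has |G| elements, and psi(delta_1)
   yields a dual family u_i with sum_i h(b_i) u_i = J if h = 1, and 0 otherwise.
   In these bases phi has matrix (g(b_i)) and psi has matrix (det(g) g(u_i)), so
   writing u_i = sum_j M_ji b_j with M over R gives Psi = M^T Phi^T D, with D
   diagonal and constant.  Comparing the Hilbert series of S computed from the
   b_i and from the degrees of the f_i shows that det M is homogeneous of degree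
   0, hence M is invertible.  This gives (a) and (c), and (b) follows by sending
   theta to the family (det(g)^-1 theta(delta_g))_g.

   For (d), J vanishes to the order exactly r - 1 along every mirror of the orbit:
   at least r - 1 because it is a semi-invariant, and at most r - 1 because the
   invertibility of M makes J a divisor of products over h <> 1 of forms h x - g x.
   Let k be the fraction field of R/(Delta) and Delta = E^r.  Over k, the powers
   of E filter S with equal quotients, and J is E^(r-1) up to a unit, so that
   multiplication by J has rank N/r, where N = |G|.  The reductions of Phi and Psi
   have the same rank because one is equivalent to the transpose of the other,
   and the kernel of Psi is the image of Phi modulo J; hence the cokernel of Phi
   has dimension N (N - N/r) / 2. *)

Set Implicit Arguments.
Unset Strict Implicit.
Unset Printing Implicit Defensive.

Import GRing.Theory.
Local Open Scope ring_scope.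

(** * Divisibility by linear forms *)

(** Everything turns on the invertibility of [dual_mx], the matrix [M] expressing the family [u] in
    the basis [b]: it is the inverse Gram matrix of a Frobenius form of S over R. Besides the
    transpose relation over S it is needed a second time for the rank. Over the residue field each
    entry of Phi becomes an N by N block, and transposing the block matrix also transposes the
    blocks, so equivalence with [Phi^T] over S does not by itself compare ranks. The reduction of
    [M] intertwines multiplication by an element of S with its transpose, which repairs this. [J] is
    available only as a determinant, not as a product of linear forms, so both bounds for its order
    along a mirror must be proved; primality of linear forms is the only factorization property
    used. The factor 1/2 comes from rank-nullity: with [a] the rank of multiplication by [J], the
    rank of Phi is N a plus the nullity of Psi, and this nullity is N^2 minus the same rank. *)

Section MpolyDivisibility.
Variables (K : fieldType) (n : nat).
Local Notation S := {mpoly K[n]}.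

Definition mpdvd (p q : S) : Prop := exists r, q = r * p.

Lemma mpdvdD p q r : mpdvd p q -> mpdvd p r -> mpdvd p (q + r).
Proof. by case=> a -> [b ->]; exists (a + b); rewrite mulrDl. Qed.

Lemma mpdvd_mull p q r : mpdvd p q -> mpdvd p (r * q).
Proof. by case=> a ->; exists (r * a); rewrite mulrA. Qed.

Lemma mpdvd_mulr p q r : mpdvd p q -> mpdvd p (q * r).
Proof. by move=> h; rewrite mulrC; apply: mpdvd_mull. Qed.

Lemma mpdvd_trans q p r : mpdvd p q -> mpdvd q r -> mpdvd p r.
Proof. by move=> h [a ->]; apply: mpdvd_mull. Qed.

Lemma mpdvd_refl p : mpdvd p p.
Proof. by exists 1; rewrite mul1r. Qed.

Lemma mpdvd0 p : mpdvd p 0.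
Proof. by exists 0; rewrite mul0r. Qed.

Lemma mpoly_ring_ind (P : S -> Prop) :
  (forall c, P c%:MP) -> (forall i, P 'X_i) ->
  (forall p q, P p -> P q -> P (p + q)) -> (forall p q, P p -> P q -> P (p * q)) ->
  forall p, P p.
Proof.
move=> PC PX PD PM p; rewrite [p]mpolyE.
apply: big_ind => [||m _]; [exact: (PC 0) | exact: PD |].
rewrite -mul_mpolyC; apply: (PM _ _ (PC _)); rewrite mpolyXE_id.
apply: big_ind => [||i _]; [exact: (PC 1) | exact: PM |].
elim: (m i) => [|k ih]; first by rewrite expr0; exact: (PC 1).
by rewrite exprS; apply: PM.
Qed.

Lemma lin_formD v w : lin_form (v + w) = lin_form v + lin_form w :> S.
Proof.
by rewrite /lin_form -big_split; apply: eq_bigr => i _; rewrite mxE scalerDl.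
Qed.

Lemma lin_formZ c v : lin_form (c *: v) = c *: lin_form v :> S.
Proof.
by rewrite /lin_form scaler_sumr; apply: eq_bigr => i _; rewrite mxE scalerA.
Qed.

Lemma lin_formB v w : lin_form (v - w) = lin_form v - lin_form w :> S.
Proof. by rewrite lin_formD -scaleN1r lin_formZ scaleN1r. Qed.

Lemma mcoeff_lin_form v i : (lin_form v : S)@_U_(i) = v i 0.
Proof.
rewrite /lin_form raddf_sum /= (bigD1 i) //= big1 => [|j /negPf ji].
  by rewrite mcoeffZ mcoeffXU eqxx mulr1 addr0.
by rewrite mcoeffZ mcoeffXU ji mulr0.
Qed.

Lemma lin_form_eq0 v : (lin_form v == 0 :> S) = (v == 0).
Proof.
apply/eqP/eqP => [h|->]; last first.
  by rewrite /lin_form big1 // => i _; rewrite mxE scale0r.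
by apply/colP => i; rewrite mxE -mcoeff_lin_form h mcoeff0.
Qed.

Lemma lin_form_homog v : (lin_form v : S) \is 1.-homog.
Proof.
by apply: rpred_sum => i _; apply: dhomogZ; rewrite dhomogX /= mdeg1.
Qed.

(* Eliminating a variable that occurs in the linear form is a ring endomorphism
   whose kernel is the ideal generated by the form. *)
Lemma lin_form_elim (v : 'cV[K]_n) : v != 0 ->
  exists s : {rmorphism S -> S},
    (forall c p, s (c *: p) = c *: s p) /\
    forall p q, mpdvd (lin_form v) (p - q) <-> s p = s q.
Proof.
move=> /cV0Pn[i vi].
pose t := [tuple 'X_j - (if j == i then (v i 0)^-1 *: lin_form v else 0) | j < n].
pose s : {rmorphism S -> S} := comp_mpoly t.
have sZ c p : s (c *: p) = c *: s p by rewrite /s /= comp_mpolyZ.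
have sX j : s 'X_j = 'X_j - (if j == i then (v i 0)^-1 *: lin_form v else 0).
  by rewrite /s /= comp_mpolyXU -tnth_nth tnth_mktuple.
have sL : s (lin_form v) = 0.
  rewrite [in LHS]/lin_form rmorph_sum /=.
  under eq_bigr => j _ do rewrite sZ sX scalerBr.
  rewrite big_split /= -/(lin_form v) sumrN [X in _ - X](bigD1 i) //= eqxx.
  rewrite big1 => [|j /negPf ->]; last by rewrite scaler0.
  by rewrite addr0 scalerA mulfV // scale1r subrr.
have sub p : mpdvd (lin_form v) (p - s p).
  move: p; apply: mpoly_ring_ind => [c|j|p q hp hq|p q hp hq].
  - by rewrite /s /= comp_mpolyC subrr; exact: mpdvd0.
  - rewrite sX subKr; case: eqP => _; last exact: mpdvd0.
    by exists ((v i 0)^-1)%:MP; rewrite mul_mpolyC.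
  - by rewrite rmorphD opprD addrACA; exact: mpdvdD.
  - rewrite rmorphM /=.
    have -> : p * q - s p * s q = (p - s p) * q + s p * (q - s q) by ring.
    by apply: mpdvdD; [apply: mpdvd_mulr | apply: mpdvd_mull].
exists s; split=> // p q; split=> [[r /eqP]|h].
  rewrite -[s p = s q]/(_ ) => /eqP hr; apply/eqP; rewrite -subr_eq0 -rmorphB hr rmorphM /=.
  by rewrite sL mulr0.
have -> : p - q = (p - s p) + (-1) * (q - s q) by rewrite h; ring.
by apply: mpdvdD => //; apply: mpdvd_mull.
Qed.

(** Elimination embeds the quotient by the form into the domain [S]. *)
Lemma lin_form_prime (v : 'cV[K]_n) p q : v != 0 ->
  mpdvd (lin_form v) (p * q) -> mpdvd (lin_form v) p \/ mpdvd (lin_form v) q.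
Proof.
move=> /lin_form_elim[s [_ hs]]; rewrite -[p * q]subr0 => /hs.
rewrite rmorphM rmorph0 => /eqP; rewrite mulf_eq0 => /orP[] /eqP h; [left|right].
  by rewrite -[p]subr0; apply/hs; rewrite rmorph0.
by rewrite -[q]subr0; apply/hs; rewrite rmorph0.
Qed.

Lemma lin_form_not_unit (v : 'cV[K]_n) : v != 0 -> ~ mpdvd (lin_form v) 1.
Proof.
move=> v0; have [s [_ hs]] := lin_form_elim v0.
rewrite -[1]subr0 => /hs; rewrite rmorph1 rmorph0 => /eqP; by rewrite oner_eq0.
Qed.

Lemma lin_form_prime_prod (v : 'cV[K]_n) (T : eqType) (s : seq T) (F : T -> S) :
  v != 0 -> mpdvd (lin_form v) (\prod_(i <- s) F i) ->
  exists2 i, i \in s & mpdvd (lin_form v) (F i).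
Proof.
move=> v0; elim: s => [|i s ih]; first by rewrite big_nil => /(lin_form_not_unit v0).
rewrite big_cons => /(lin_form_prime v0)[h|/ih[j js h]].
  by exists i => //; rewrite mem_head.
by exists j => //; rewrite inE js orbT.
Qed.

Lemma lin_form_primeX (v : 'cV[K]_n) p m :
  v != 0 -> mpdvd (lin_form v) (p ^+ m) -> mpdvd (lin_form v) p.
Proof.
move=> v0; elim: m => [|m ih]; first by move/(lin_form_not_unit v0).
by rewrite exprS => /(lin_form_prime v0)[|/ih].
Qed.

Lemma msize_lin_form (v : 'cV[K]_n) : v != 0 -> msize (lin_form v : S) = 2%N.
Proof.
move=> v0; have h := lin_form_homog v.
have L0 : (lin_form v : S) != 0 by rewrite lin_form_eq0.
have := dhomog_msize h; move/(dhomog_uniq L0 h) => e.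
by move: e; case: (msize _) => //= k <-.
Qed.

(** Descent on [msize], which drops at each division by the form. *)
Lemma lin_form_mult (v : 'cV[K]_n) p : v != 0 -> p != 0 ->
  exists m q, p = lin_form v ^+ m * q /\ ~ mpdvd (lin_form v) q.
Proof.
move=> v0; have [k] := ubnP (msize p); elim: k p => // k ih p pk p0.
have [[q pE]|h] := boolp.pselect (mpdvd (lin_form v) p); last first.
  by exists 0%N, p; rewrite expr0 mul1r.
have q0 : q != 0 by apply: contraNneq p0 => q0; rewrite pE q0 mul0r.
have L0 : (lin_form v : S) != 0 by rewrite lin_form_eq0.
have [|m [r [qE hr]]] := ih q _ q0.
  move: pk; rewrite pE msizeM // msize_lin_form // addnC /= ltnS.
  exact: leq_trans.
by exists m.+1, r; rewrite pE qE exprS mulrC mulrA.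
Qed.

Lemma lin_form_mult_le (v : 'cV[K]_n) m m' p p' : v != 0 ->
  ~ mpdvd (lin_form v) p -> lin_form v ^+ m * p = lin_form v ^+ m' * p' ->
  (m' <= m)%N.
Proof.
move=> v0 hp e; rewrite leqNgt; apply/negP => mm; apply: hp.
have L0 : (lin_form v : S) ^+ m != 0 by rewrite expf_neq0 // lin_form_eq0.
move: e; rewrite -(subnKC (ltnW mm)) exprD -mulrA => /(mulfI L0) ->.
by rewrite -(prednK (n := m' - m)) ?subn_gt0 // exprS -mulrA mulrC; exists (lin_form v ^+ (m' - m).-1 * p').
Qed.

Lemma mpdvd_proportional (v w : 'cV[K]_n) : v != 0 -> w != 0 ->
  mpdvd (lin_form v) (lin_form w) -> exists2 c, c != 0 & w = c *: v.
Proof.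
move=> v0 w0 [q e].
have L0 : (lin_form v : S) != 0 by rewrite lin_form_eq0.
have W0 : (lin_form w : S) != 0 by rewrite lin_form_eq0.
have q0 : q != 0 by apply: contraNneq W0 => q0; rewrite e q0 mul0r.
have : (msize q == 1)%N.
  have := msizeM q0 L0; rewrite -e !msize_lin_form // addn2 /= => /eqP.
  by rewrite eqSS eq_sym.
move=> /msize_poly1P[c c0 qE]; exists c => //.
apply/eqP; rewrite -subr_eq0 -(lin_form_eq0 (w - c *: v)) lin_formB lin_formZ e qE.
by rewrite mul_mpolyC subrr.
Qed.

End MpolyDivisibility.

(** * Homogeneous components and degrees *)

Section Homogeneous.
Variables (K : fieldType) (n : nat).
Local Notation S := {mpoly K[n]}.

Lemma dhomog_prod_fin (I : finType) (F : I -> S) (d : I -> nat) :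
  (forall i, F i \is (d i).-homog) -> \prod_i F i \is (\sum_i d i)%N.-homog.
Proof.
move=> h; elim/big_rec2: _ => [|i e p _ hp]; first exact: dhomog1.
exact: dhomogM.
Qed.

Lemma dhomog0_const (p : S) : p \is 0.-homog -> p = (p@_0%MM)%:MP.
Proof.
move=> h; apply/mpolyP => m; rewrite mcoeffC; have [->|m0] := eqVneq m 0%MM.
  by rewrite mulr1.
by rewrite mulr0 (dhomog_nemf_coeff h) // mdeg_eq0.
Qed.

Lemma dhomog_const0 d (p : S) : p \is d.-homog -> (0 < d)%N -> p@_0%MM = 0.
Proof.
by move=> h d0; rewrite (dhomog_nemf_coeff h) //= mdeg0 eq_sym -lt0n.
Qed.

Lemma pihomogM e d (p q : S) : p \is e.-homog ->
  pihomog mdeg d (p * q) = if (e <= d)%N then p * pihomog mdeg (d - e) q else 0.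
Proof.
move=> hp; rewrite [in LHS](pihomog_partitionE (leqnn (msize q))) mulr_sumr raddf_sum /=.
have hd (i : nat) : p * pihomog mdeg i q \is (e + i).-homog.
  by apply: dhomogM => //; exact: pihomogP.
case: leqP => ed; last first.
  rewrite big1 // => i _; apply: (pihomog_ne0 _ (hd i)).
  by rewrite neq_ltn orbC (leq_trans ed (leq_addr _ _)).
have [lt|ge] := ltnP (d - e) (msize q).
  rewrite (bigD1 (Ordinal lt)) //= pihomog_dE; last by rewrite -[d in d.-homog](subnKC ed).
  rewrite big1 ?addr0 // => i /negPf ne; apply: (pihomog_ne0 _ (hd i)).
  by rewrite -(subnKC ed) eqn_add2l; move: ne; rewrite -val_eqE /= => ->.
rewrite big1 => [|i _]; last first.
  apply: (pihomog_ne0 _ (hd i)); rewrite -(subnKC ed) eqn_add2l neq_ltn.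
  by rewrite (leq_trans (ltn_ord i) ge).
rewrite /pihomog big_seq_cond big_pred0 ?mulr0 // => m.
apply/negP => /andP[/msize_mdeg_lt] /[swap] /eqP ->.
by rewrite ltnNge ge.
Qed.

(** The predecessor truncates at 0, hence the separate clause: a constant that is a multiple of a
    linear form vanishes. *)
Lemma dhomog_divr d (p q r : S) : q != 0 -> q \is 1.-homog -> p = r * q ->
  p \is d.-homog -> r \is d.-1.-homog /\ (d = 0%N -> r = 0).
Proof.
move=> q0 hq -> hp; case: d hp => [|d] hp.
  have r0 : r = 0.
    have := pihomogM 0 r hq; rewrite mulrC pihomog_dE //= => /eqP.
    by rewrite mulf_eq0 (negPf q0) orbF => /eqP.
  by split=> //; rewrite r0 dhomog0.
split=> //=; have := pihomogM d.+1 r hq; rewrite mulrC pihomog_dE //= mulrC subn1 /=.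
by move/(mulfI q0) ->; exact: pihomogP.
Qed.

Lemma dhomog_mderiv d i (p : S) : p \is d.-homog -> mderiv i p \is d.-1.-homog.
Proof.
move=> /dhomogP hp; rewrite [p]mpolyE raddf_sum big_seq; apply: rpred_sum => m /hp /= hm.
rewrite mderivZ mderivX; apply: dhomogZ.
have [->|mi] := eqVneq (m i) 0%N; first by rewrite scale0r dhomog0.
apply: dhomogZ; rewrite dhomogX /= -hm -[in X in (_ == X.-1)](@submK _ U_(i)%MM m).
  by rewrite mdegD mdeg1 addn1.
by rewrite lep1mP.
Qed.

Lemma dhomog_det k (A : 'M[S]_k) (d : 'I_k -> nat) :
  (forall i j, A i j \is (d i).-homog) ->
  \det A \is (\sum_i d i)%N.-homog.
Proof.
move=> h; apply: rpred_sum => s _; rewrite -signr_odd.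
case: odd; rewrite ?expr1 ?expr0 ?mulN1r ?mul1r ?dhomogN;
  by apply: dhomog_prod_fin.
Qed.

End Homogeneous.

(** * Freeness over the invariants *)

Section Reflections.
Variables (K : fieldType) (gT : finGroupType) (n : nat).
Variable rG : mx_representation K [set: gT] n.
Local Notation S := {mpoly K[n]}.
Local Notation act := (Defs.act rG).

Lemma mcoeff0M (p q : S) : (p * q)@_0%MM = p@_0%MM * q@_0%MM.
Proof. by have [h _] := mcoeff0_is_multiplicative n K; rewrite h. Qed.

Lemma act_homog g d (p : S) : p \is d.-homog -> act g p \is d.-homog.
Proof.
move=> /dhomogP hp; rewrite [p]mpolyE rmorph_sum big_seq; apply: rpred_sum => m /hp /= <-.
rewrite actZ; apply: dhomogZ; rewrite /Defs.act comp_mpolyX mdegE.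
apply: dhomog_prod_fin => i; rewrite tnth_mktuple -[X in X.-homog]mul1n.
by apply: dhomogMn; exact: lin_form_homog.
Qed.

(** After elimination of the form, [act g] and the identity are ring morphisms that agree on the
    variables. *)
Lemma act_dvd g (v : 'cV[K]_n) : v != 0 ->
  (forall w, exists c, rG g *m w - w = c *: v) ->
  forall p : S, mpdvd (lin_form v) (act g p - p).
Proof.
move=> /lin_form_elim[s [sZ hs]] hw p; apply/hs; move: p.
pose F : {rmorphism S -> S} := s \o act g.
apply: (@act_ext _ _ F s) => [c p|//|i]; first by rewrite /F /= actZ sZ.
rewrite /F /= Defs.actX; apply/hs; have [c] := hw (delta_mx i 0).
rewrite -[in X in lin_form _ - X](lin_formX K i) -lin_formB => ->.
by rewrite lin_formZ -mul_mpolyC; exists c%:MP.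
Qed.

(** In the diagonalizing basis [g - 1] has a single nonzero entry, so the first column of [P] spans
    its image. *)
Lemma reflection_root g : g \in pseudo_reflections rG ->
  exists2 v : 'cV[K]_n, v != 0 & forall w, exists c, rG g *m w - w = c *: v.
Proof.
rewrite inE => /boolp.asboolP[n0 [P [z [uP z1 _ ->]]]]; pose i0 := Ordinal n0.
exists (col i0 P).
  apply: contraL uP => /eqP c0; rewrite unitmxE -det_tr (expand_det_row _ i0) big1 ?unitr0 //.
  by move=> j _; rewrite mxE; move/colP: c0 => /(_ j); rewrite !mxE => ->; rewrite mul0r.
move=> w; pose y := invmx P *m w.
exists ((z - 1) * y i0 0); have -> : w = P *m y by rewrite mulKVmx.
rewrite !mulmxA mulmxKV // -!mulmxA -mulmxBr.
have -> : diag_mx (\row_i (if val i == 0%N then z else 1)) *m y - y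
          = ((z - 1) * y i0 0) *: delta_mx i0 0.
  apply/colP => i; rewrite !mxE (bigD1 i) //= big1 => [|j ji]; last first.
    by rewrite !mxE [i == j]eq_sym (negPf ji) mulr0n mul0r.
  rewrite !mxE !eqxx mulr1n addr0 andbT -val_eqE /=.
  case: eqP => i0E; last by rewrite mul1r subrr mulr0.
  have -> : i = i0 by apply: val_inj.
  by rewrite mulr1 mulrBl mul1r.
by rewrite -scalemxAr -colE.
Qed.

Hypothesis charK : [pchar K] =i pred0.
Hypothesis G_reflection : <<pseudo_reflections rG>>%g = [set: gT].
Variable f : n.-tuple S.
Hypothesis f_basic : basic_invariants rG f.
Variable dg : 'I_n -> nat.
Hypothesis f_homog : forall i, tnth f i \is (dg i).-homog.

Lemma card_neq0 : #|gT|%:R != 0 :> K.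
Proof. by rewrite (pcharf0P _).1 // -lt0n; apply/card_gt0P; exists 1%g. Qed.

Lemma invP (p : S) : reflect (forall g, act g p = p) (p \in inv_pred rG).
Proof. by apply: (iffP forallP) => h g; [apply/eqP | rewrite h]. Qed.

Lemma mpolyC_inv c : c%:MP \in inv_pred rG.
Proof. by apply/invP => g; rewrite /Defs.act comp_mpolyC. Qed.

Lemma f_inv i : tnth f i \in inv_pred rG.
Proof.
have [_ h _] := f_basic; apply/h; exists 'X_i.
by rewrite comp_mpolyXU -tnth_nth.
Qed.

(** A basic invariant of degree 0 would be a constant, against algebraic independence. *)
Lemma dg_gt0 i : (0 < dg i)%N.
Proof.
rewrite lt0n; apply/negP => /eqP d0; have [_ _ alg] := f_basic.
have := f_homog i; rewrite d0 => /dhomog0_const fE.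
have /mpolyP/(_ U_(i)%MM) : 'X_i - ((tnth f i)@_0%MM)%:MP = 0 :> {mpoly K[n]}.
  by apply: alg; rewrite comp_mpolyB comp_mpolyXU comp_mpolyC -tnth_nth -fE subrr.
by rewrite mcoeffB mcoeffC mcoeffXU eqxx mcoeff0 mnm1_eq0 mulr0 subr0 => /eqP; rewrite oner_eq0.
Qed.

(** Since the [f_i] have positive degree, this is the ideal generated by the invariants without
    constant term; the quotient is the coinvariant algebra. *)
Definition hilbert_ideal (p : S) : Prop :=
  exists q : 'I_n -> S, p = \sum_i tnth f i * q i.

Lemma hilbert_idealD p q :
  hilbert_ideal p -> hilbert_ideal q -> hilbert_ideal (p + q).
Proof.
case=> a -> [b ->]; exists (fun i => a i + b i).
by rewrite -big_split; apply: eq_bigr => i _; rewrite mulrDr.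
Qed.

Lemma hilbert_idealM p q : hilbert_ideal q -> hilbert_ideal (p * q).
Proof.
case=> a ->; exists (fun i => p * a i).
by rewrite mulr_sumr; apply: eq_bigr => i _; rewrite mulrCA.
Qed.

Lemma hilbert_idealZ c q : hilbert_ideal q -> hilbert_ideal (c *: q).
Proof. by rewrite -mul_mpolyC; apply: hilbert_idealM. Qed.

Lemma hilbert_idealN p : hilbert_ideal p -> hilbert_ideal (- p).
Proof. by rewrite -mulN1r; apply: hilbert_idealM. Qed.

Lemma hilbert_ideal0 : hilbert_ideal 0.
Proof. by exists (fun=> 0); rewrite big1 // => i _; rewrite mulr0. Qed.

Lemma hilbert_ideal_sum (T : Type) (s : seq T) (P : pred T) (F : T -> S) :
  (forall i, P i -> hilbert_ideal (F i)) -> hilbert_ideal (\sum_(i <- s | P i) F i).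
Proof.
by move=> h; apply: big_ind => //; [exact: hilbert_ideal0 | exact: hilbert_idealD].
Qed.

Lemma hilbert_ideal_act g p : hilbert_ideal p -> hilbert_ideal (act g p).
Proof.
case=> a ->; exists (fun i => act g (a i)); rewrite rmorph_sum.
by apply: eq_bigr => i _; rewrite rmorphM /= (invP _ (f_inv i)).
Qed.

Lemma hilbert_ideal_const0 p : hilbert_ideal p -> p@_0%MM = 0.
Proof.
case=> a ->; rewrite raddf_sum big1 // => i _; rewrite -[LHS]/(mcoeff 0%MM _) mcoeff0M.
by rewrite (dhomog_const0 (f_homog i) (dg_gt0 i)) mul0r.
Qed.

Lemma hilbert_ideal_inv p : p \in inv_pred rG -> p@_0%MM = 0 -> hilbert_ideal p.
Proof.
have [_ h _] := f_basic; move=> /h[q ->].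
(* Modulo the ideal every polynomial in the [f_i] is a constant, and that constant is its constant
   term. *)
suff [c hc] : exists c : K, hilbert_ideal (q \mPo f - c%:MP).
  have := hilbert_ideal_const0 hc; rewrite mcoeffB mcoeffC eqxx mulr1 => /[swap] ->.
  by rewrite sub0r => /eqP; rewrite oppr_eq0 => /eqP c0; move: hc; rewrite c0 mpolyC0 subr0.
move: q; apply: mpoly_ring_ind => [c|i|p' q [a ha] [b hb]|p' q [a ha] [b hb]].
- by exists c; rewrite comp_mpolyC subrr; exact: hilbert_ideal0.
- exists 0; rewrite mpolyC0 subr0 comp_mpolyXU -tnth_nth.
  exists (fun j => (j == i)%:R); rewrite (bigD1 i) //= eqxx mulr1 big1 ?addr0 // => j /negPf ->.
  by rewrite mulr0.
- by exists (a + b); rewrite comp_mpolyD mpolyCD opprD addrACA; apply: hilbert_idealD.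
exists (a * b); rewrite rmorphM mpolyCM /=.
set x := p' \mPo f in ha *; set y := q \mPo f in hb *.
have -> : x * y - a%:MP * b%:MP = y * (x - a%:MP) + a%:MP * (y - b%:MP) by ring.
by apply: hilbert_idealD; apply: hilbert_idealM.
Qed.

(** Models composites of [e] divided differences. The vanishing clause covers [d < e], where the
    truncated [d - e] carries no information. *)
Definition degree_op (e : nat) (T : S -> S) : Prop :=
  [/\ forall r p, r \in inv_pred rG -> T (r * p) = r * T p,
      {morph T : p q / p + q}
    & forall d p, p \is d.-homog -> T p \is (d - e).-homog /\ ((d < e)%N -> T p = 0)].

Lemma divided_difference g v : v != 0 ->
    (forall w, exists c, rG g *m w - w = c *: v) ->
  exists2 D : S -> S, degree_op 1 D & forall p, act g p - p = D p * lin_form v.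
Proof.
move=> v0 hv; have [D DE] := boolp.choice (act_dvd v0 hv).
have L0 : lin_form v != 0 :> S by rewrite lin_form_eq0.
exists D => //; split=> [r p rR|p q|d p hp].
- by apply: (mulIf L0); rewrite -mulrA -!DE rmorphM /= (invP _ rR) mulrBr.
- by apply: (mulIf L0); rewrite mulrDl -!DE rmorphD opprD addrACA.
have hd : act g p - p \is d.-homog by rewrite rpredB // act_homog.
have [h1 h2] := dhomog_divr L0 (lin_form_homog v) (DE p) hd.
by rewrite subn1; split=> //; rewrite ltnS leqn0 => /eqP.
Qed.

(* If all the divided differences of [p] lay in the Hilbert ideal then [p] would be
   congruent to its average over the group, an invariant of positive degree. *)
Lemma degree_op_detect e (p : S) : p \is e.-homog -> ~ hilbert_ideal p ->
  exists2 T, degree_op e T & exists2 c, c != 0 & T p = c%:MP.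
Proof.
elim: e p => [|e ih] p hp pI.
  exists id; first by split=> // d q hq; rewrite subn0.
  exists (p@_0%MM); last exact: dhomog0_const.
  apply: contra_not_neq pI => p0; rewrite (dhomog0_const hp) p0 mpolyC0.
  exact: hilbert_ideal0.
suff [g [v [v0 hv hg]]] : exists (g : gT) (v : 'cV[K]_n), [/\ v != 0,
    forall w : 'cV[K]_n, exists c : K, rG g *m w - w = c *: v & ~ hilbert_ideal (act g p - p)].
  have [D hD DE] := divided_difference v0 hv.
  have [D1 D2 D3] := hD; have [Dp _] := D3 _ _ hp; rewrite subn1 /= in Dp.
  have DI : ~ hilbert_ideal (D p).
    by apply: contra_not hg => h; rewrite DE mulrC; apply: hilbert_idealM.
  have [T [T1 T2 T3] [c c0 TE]] := ih _ Dp DI.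
  exists (T \o D); last by exists c.
  split=> [r q rR|q r|d q hq] /=; rewrite ?D1 ?T1 ?D2 ?T2 //.
  have [h1 h2] := D3 _ _ hq; have [h3 h4] := T3 _ _ h1.
  rewrite -add1n subnDA; split=> //; rewrite add1n ltnS leq_eqVlt => /orP[/eqP de|de].
    case: d hq h1 h2 h3 h4 de => [|d] hq h1 h2 h3 h4 de.
      by rewrite h2 //; apply: (addrI (T 0)); rewrite -T2 !addr0.
    by rewrite h4 // subn1 /= de.
  case: d hq h1 h2 h3 h4 de => [|d] hq h1 h2 h3 h4 de.
    by rewrite h2 //; apply: (addrI (T 0)); rewrite -T2 !addr0.
  by rewrite h4 // subn1 /= (leq_trans _ de).
apply: boolp.contrapT => none; apply: pI.
(* The ideal is stable under the group, so the elements fixing [p] modulo it form a subgroup; if it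
   contains all pseudo-reflections it is the whole group. *)
pose H := [set g | boolp.asbool (hilbert_ideal (act g p - p))].
have gH : group_set H.
  apply/group_setP; split=> [|g h].
    by rewrite inE; apply/boolp.asboolP; rewrite Defs.act1 subrr; exact: hilbert_ideal0.
  rewrite !inE => /boolp.asboolP hg /boolp.asboolP hh; apply/boolp.asboolP.
  rewrite Defs.actM -[_ - p](subrKA (act g p)) -rmorphB.
  by apply: hilbert_idealD => //; exact: hilbert_ideal_act.
have HT : [set: gT] \subset Group gH.
  rewrite -G_reflection gen_subG; apply/subsetP => g gR; rewrite inE.
  apply/boolp.asboolP; apply: boolp.contrapT => hg; apply: none.
  by have [v v0 hv] := reflection_root gR; exists g, v.
pose q := \sum_g act g p.
have qI : hilbert_ideal q.
  apply: hilbert_ideal_inv.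
    apply/invP => h; rewrite rmorph_sum /= [RHS](reindex_inj (mulgI h)).
    by apply: eq_bigr => g _; rewrite Defs.actM.
  rewrite raddf_sum big1 //= => g _.
  by rewrite (dhomog_const0 (act_homog g hp)).
have : hilbert_ideal (\sum_(g : gT) (act g p - p)).
  apply: hilbert_ideal_sum => g _; have := subsetP HT g (in_setT g).
  by rewrite inE => /boolp.asboolP.
rewrite sumrB -/q sumr_const cardT -cardE => hs.
have -> : p = #|gT|%:R^-1 *: (q - (q - p *+ #|gT|)).
  by rewrite subKr -scaler_nat scalerA mulVf ?card_neq0 // scale1r.
apply: hilbert_idealZ; apply: hilbert_idealD => //; exact: hilbert_idealN.
Qed.

(** Chevalley's argument, by descending induction on the degree of [b_i]. An operator of degree
    [e i] kills every [b_j] of smaller degree and makes constants of those of equal degree, while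
    the coefficients at larger degree are already zero. Applied to the relation, it leaves a linear
    relation with constant coefficients between the [r_j] of equal degree. *)
Lemma invariants_free k (b : 'I_k -> S) (e : 'I_k -> nat) :
    (forall i, b i \is (e i).-homog) ->
    (forall c : 'I_k -> K, hilbert_ideal (\sum_i c i *: b i) -> forall i, c i = 0) ->
  forall r : 'I_k -> S, (forall i, r i \in inv_pred rG) ->
    \sum_i r i * b i = 0 -> forall i, r i = 0.
Proof.
move=> be bI r rR r0.
pose E := (\sum_i e i)%N.
have eE i : (e i <= E)%N by rewrite /E (bigD1 i) //= leq_addr.
suff claim m : forall i, (E < e i + m)%N -> r i = 0.
  by move=> i; apply: (claim E.+1); rewrite addnS ltnS leq_addl.
elim: m => [|m ih] i; first by rewrite addn0 ltnNge eE.
rewrite addnS ltnS leq_eqVlt => /orP[/eqP Ei|/ih //].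
have hi j : (e i < e j)%N -> r j = 0.
  by move=> ij; apply: ih; rewrite Ei ltn_add2r.
apply/mpolyP => mm; rewrite mcoeff0.
(* One coefficient of the [r_j] at a time: [T] of this scalar combination is the [mm]-coefficient of
   [T] applied to the relation, hence zero, although [T] was chosen not to kill it. *)
pose c j := if e j == e i then (r j)@_mm else 0.
suff : hilbert_ideal (\sum_j c j *: b j) by move=> /bI/(_ i); rewrite /c eqxx.
apply: boolp.contrapT => nI.
have hom : \sum_j c j *: b j \is (e i).-homog.
  apply: rpred_sum => j _; rewrite /c; case: eqP => [<-|_]; first exact: dhomogZ.
  by rewrite scale0r dhomog0.
have [T [T1 T2 T3] [z z0 TE]] := degree_op_detect hom nI.
have T0 : T 0 = 0 by apply: (addrI (T 0)); rewrite -T2 !addr0.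
have Tsum (F : 'I_k -> S) : T (\sum_j F j) = \sum_j T (F j).
  exact: (big_morph T T2 T0).
have TZ a p : T (a *: p) = a *: T p.
  by rewrite -!mul_mpolyC T1 ?mpolyC_inv.
case/eqP: z0; apply/eqP; rewrite -(mpolyC_eq0 n) -TE Tsum; apply/eqP.
have /(congr1 T) := r0; rewrite T0 Tsum => /(congr1 (mcoeff mm)).
rewrite mcoeff0 raddf_sum /= => h.
have Tb j : e j = e i -> T (b j) = ((T (b j))@_0%MM)%:MP.
  by move=> ej; apply: dhomog0_const; have [] := T3 _ _ (be j); rewrite ej subnn.
have -> : \sum_j T (c j *: b j) = (\sum_j (T (r j * b j))@_mm)%:MP; last by rewrite h mpolyC0.
rewrite [RHS](raddf_sum (@mpolyC n K)); apply: eq_bigr => j _; rewrite TZ T1 // /c.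
have [ej|ej|ej] := ltngtP (e j) (e i).
- by rewrite scale0r (proj2 (T3 _ _ (be j)) ej) mulr0 /= mcoeff0 mpolyC0.
- by rewrite scale0r (hi _ ej) mul0r /= mcoeff0 mpolyC0.
by rewrite Tb // mulrC mul_mpolyC mcoeffZ -mul_mpolyC mulrC -mpolyCM.
Qed.

End Reflections.

(** * A finite basis of monomials over the invariants *)

Section InvariantBasis.
Variables (K : fieldType) (gT : finGroupType) (n : nat).
Variable rG : mx_representation K [set: gT] n.
Local Notation S := {mpoly K[n]}.
Local Notation act := (Defs.act rG).
Hypothesis charK : [pchar K] =i pred0.
Hypothesis G_reflection : <<pseudo_reflections rG>>%g = [set: gT].
Variable f : n.-tuple S.
Hypothesis f_basic : basic_invariants rG f.
Variable dg : 'I_n -> nat.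
Hypothesis f_homog : forall i, tnth f i \is (dg i).-homog.

(** Witness that [p] is integral over the invariants. *)
Definition orbit_poly (p : S) : {poly S} := \prod_g ('X - (act g p)%:P).

Lemma orbit_poly_inv p k : (orbit_poly p)`_k \in inv_pred rG.
Proof.
apply/invP => h; have E : map_poly (act h) (orbit_poly p) = orbit_poly p.
  rewrite rmorph_prod /= [RHS](reindex_inj (mulgI h)); apply: eq_bigr => g _.
  by rewrite rmorphB /= map_polyX map_polyC /= Defs.actM.
by rewrite -[in RHS]E coef_map.
Qed.

Lemma size_orbit_poly p : size (orbit_poly p) = #|gT|.+1.
Proof. by rewrite size_prod_XsubC [index_enum _]unlock -enumT -cardE. Qed.

Lemma orbit_poly_root p : (orbit_poly p).[p] = 0.
Proof.
rewrite /orbit_poly (bigD1 1%g) // hornerM (hornerXsubC (act 1%g p) p) Defs.act1.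
by rewrite subrr mul0r.
Qed.

(** All lower coefficients of the orbit polynomial of ['X_i] are invariants without constant term,
    because every translate of ['X_i] is a linear form; evaluating at ['X_i] isolates the leading
    power. *)
Lemma hilbert_ideal_X i : hilbert_ideal f ('X_i ^+ #|gT|).
Proof.
pose P := orbit_poly 'X_i.
have PE : map_poly (mcoeff 0%MM : S -> K) P = 'X^#|gT|.
  rewrite rmorph_prod /= (eq_bigr (fun=> 'X)) => [|g _].
    by rewrite prodr_const cardT -cardE.
  rewrite rmorphB /= map_polyX map_polyC /= (dhomog_const0 (d := 1)) ?subr0 //.
  by apply: act_homog; rewrite dhomogX /= mdeg1.
have P0 (k : 'I_#|gT|) : hilbert_ideal f P`_k.
  apply: (hilbert_ideal_inv f_basic f_homog); first exact: orbit_poly_inv.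
  by rewrite -[LHS](coef_map (mcoeff 0%MM : {rmorphism S -> K})) PE coefXn ltn_eqF.
have PN : P`_#|gT| = 1.
  have : P \is monic by rewrite monic_prod // => g _; exact: monicXsubC.
  by rewrite monicE lead_coefE size_orbit_poly => /eqP.
have := orbit_poly_root 'X_i; rewrite horner_coef size_orbit_poly big_ord_recr /= -/P PN mul1r.
move=> /eqP; rewrite addr_eq0 => /eqP h.
rewrite -[_ ^+ _]opprK -h; apply: hilbert_idealN; apply: hilbert_ideal_sum => k _.
by rewrite mulrC; apply: hilbert_idealM.
Qed.

Lemma hilbert_ideal_monomial m : (n * #|gT| < mdeg m)%N -> hilbert_ideal f 'X_[m].
Proof.
move=> mN; have [i iN] : exists i, (#|gT| <= m i)%N.
  apply: boolp.contrapT => h; move: mN; rewrite ltnNge mdegE => /negP; apply.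
  rewrite -[n in (n * _)%N]card_ord -sum_nat_const; apply: leq_sum => i _.
  by rewrite leqNgt; apply/negP => hi; apply: h; exists i; exact: ltnW.
have -> : m = (m - U_(i) *+ #|gT| + U_(i) *+ #|gT|)%MM.
  rewrite submK //; apply/mnm_lepP => j; rewrite mulmnE mnm1E.
  by case: eqP => [<-|_]; rewrite ?mul1n ?mul0n.
by rewrite mpolyXD -mpolyXn; apply: hilbert_idealM; exact: hilbert_ideal_X.
Qed.

(** Monomials of degree above [n * #|gT|] lie in the ideal, so finitely many span the quotient; a
    spanning set of least cardinality is independent. *)
Lemma monomials_mod_hilbert : exists (k : nat) (m : 'I_k -> 'X_{1..n}),
  (forall c : 'I_k -> K, hilbert_ideal f (\sum_i c i *: 'X_[m i]) -> forall i, c i = 0) /\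
  forall p, exists c : 'I_k -> K, hilbert_ideal f (p - \sum_i c i *: 'X_[m i]).
Proof.
pose B := 'X_{1..n < (n * #|gT|).+1}.
pose gen (A : {set B}) := boolp.asbool (forall p, exists c : B -> K,
   hilbert_ideal f (p - \sum_(m in A) c m *: 'X_[m])).
have genT : gen setT.
  apply/boolp.asboolP => p; rewrite [p]mpolyE; elim/big_rec: _ => [|m q _ [c hc]].
    exists (fun=> 0); rewrite big1 ?subr0; first exact: hilbert_ideal0.
    by move=> m _; rewrite scale0r.
  have [mB|mB] := ltnP (mdeg m) (n * #|gT|).+1; last first.
    exists c; rewrite -addrA; apply: hilbert_idealD => //.
    by apply: hilbert_idealZ; exact: hilbert_ideal_monomial.
  pose b : B := BMultinom mB; exists (fun b' => p@_m *+ (b' == b) + c b').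
  under eq_bigr => b' _ do rewrite scalerDl.
  rewrite big_split (bigD1 b) // eqxx big1 ?addr0 => [|b' /andP[_ /negPf ->]]; last first.
    by rewrite scale0r.
  by rewrite /= mulr1n addr0 opprD addrACA subrr add0r.
case: (@arg_minnP _ setT gen (fun A => #|A|) genT) => A /boolp.asboolP hA minA.
exists #|A|, (fun i => bmnm (enum_val i)); split; last first.
  move=> p; have [c hc] := hA p; exists (fun i => c (enum_val i)).
  by rewrite -(big_enum_val (fun m : B => c m *: 'X_[m])).
move=> c hc i; apply: boolp.contrapT => /eqP ci.
pose m0 : B := enum_val i; have m0A : m0 \in A := enum_valP i.
suff : gen (A :\ m0) by move=> /minA; rewrite (cardsD1 m0 A) m0A ltnn.
apply/boolp.asboolP => p; have [d hd] := hA p.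
pose c' m := c (enum_rank_in m0A m).
have cc : \sum_i0 c i0 *: 'X_[enum_val i0] = \sum_(m in A) c' m *: 'X_[m].
  rewrite (big_enum_val (fun m : B => c' m *: 'X_[m])); apply: eq_bigr => j _.
  by rewrite /c' enum_valK_in.
(* The relation [c], solved for [m0], is subtracted with the multiple that cancels the coefficient
   of [m0]. *)
exists (fun m => d m - d m0 / c i * c' m).
have -> : p - \sum_(m in A :\ m0) (d m - d m0 / c i * c' m) *: 'X_[m] =
   (p - \sum_(m in A) d m *: 'X_[m]) + (d m0 / c i) *: \sum_i0 c i0 *: 'X_[enum_val i0].
  rewrite cc (big_setD1 m0 m0A) [in X in _ + _ *: X](big_setD1 m0 m0A) /=.
  have -> : c' m0 = c i by rewrite /c' /m0 enum_valK_in.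
  rewrite scalerDr scalerA divfK // opprD.
  rewrite (addrC (- _) (- _)) addrA addrA subrK scaler_sumr -addrA -sumrN -sumrN -big_split /=.
  by congr (_ + _); apply: eq_bigr => m _; rewrite scalerBl opprB scalerA addrC.
by apply: hilbert_idealD => //; apply: hilbert_idealZ.
Qed.

(** Graded Nakayama: in the remainder [\sum_i f_i q_i] the relevant components of the [q_i] have
    smaller degree, since each [f_i] has positive degree. *)
Lemma hilbert_span k (m : 'I_k -> 'X_{1..n}) :
    (forall p, exists c : 'I_k -> K, hilbert_ideal f (p - \sum_i c i *: 'X_[m i])) ->
  forall p, exists2 r : 'I_k -> S, forall i, r i \in inv_pred rG & p = \sum_i r i * 'X_[m i].
Proof.
move=> gen; pose span p := exists2 r : 'I_k -> S,
  forall i, r i \in inv_pred rG & p = \sum_i r i * 'X_[m i].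
have span0 : span 0.
  by exists (fun=> 0) => [i|]; [exact: rpred0 | rewrite big1 // => i _; rewrite mul0r].
have spanD p q : span p -> span q -> span (p + q).
  case=> a aR -> [b bR ->]; exists (fun i => a i + b i) => [i|]; first exact: rpredD.
  by rewrite -big_split; apply: eq_bigr => i _; rewrite mulrDl.
have spanM r p : r \in inv_pred rG -> span p -> span (r * p).
  move=> rR [a aR ->]; exists (fun i => r * a i) => [i|]; first exact: rpredM.
  by rewrite mulr_sumr; apply: eq_bigr => i _; rewrite mulrA.
have spanS (T : Type) (s : seq T) (F : T -> S) : (forall i, span (F i)) -> span (\sum_(i <- s) F i).
  by move=> h; apply: big_ind.
have spanX i c : span (c *: 'X_[m i]).
  exists (fun j => (c *+ (j == i))%:MP) => [j|]; first exact: mpolyC_inv.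
  rewrite (bigD1 i) //= eqxx mul_mpolyC big1 ?addr0 // => j /negPf ->.
  by rewrite mul0r.
suff hom d : forall p, p \is d.-homog -> span p.
  move=> p; rewrite (pihomog_partitionE (leqnn (msize p))); apply: spanS => d.
  by apply: (hom d); exact: pihomogP.
have [e] := ubnP d; elim: e d => // e ih d de p hp.
have [c [q /(congr1 (pihomog mdeg d))]] := gen p.
rewrite raddfB /= (pihomog_dE hp) => /eqP; rewrite subr_eq => /eqP ->.
rewrite !raddf_sum /=; apply: spanD; apply: spanS => i.
  rewrite (pihomogM _ _ (f_homog i)); case: leqP => // di.
  apply: spanM; first exact: (f_inv f_basic).
  apply: (ih (d - dg i)%N); last exact: pihomogP.
  rewrite ltnS in de; apply: leq_trans de.
  have d0 := dg_gt0 f_basic f_homog i.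
  by rewrite ltn_subrL d0 (leq_trans d0 di).
rewrite -[_ *: _]mul_mpolyC (pihomogM _ _ (e := 0)); last by rewrite -[_%:MP]mulr1 mul_mpolyC dhomogZ // dhomog1.
by rewrite leq0n subn0 pihomogX mul_mpolyC; case: eqP => _; rewrite ?scaler0.
Qed.

Theorem invariants_basis : exists (k : nat) (m : 'I_k -> 'X_{1..n}),
  (forall p, exists2 r : 'I_k -> S, forall i, r i \in inv_pred rG & p = \sum_i r i * 'X_[m i]) /\
  forall r : 'I_k -> S, (forall i, r i \in inv_pred rG) ->
    \sum_i r i * 'X_[m i] = 0 -> forall i, r i = 0.
Proof.
have [k [m [ind gen]]] := monomials_mod_hilbert.
exists k, m; split; first exact: hilbert_span.
have hom i : ('X_[m i] : S) \is (mdeg (m i)).-homog by rewrite dhomogX.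
exact: (invariants_free charK G_reflection f_basic f_homog hom ind).
Qed.

End InvariantBasis.

(** * Nonvanishing and semi-invariance of the Jacobian *)

Section Jacobian.
Variables (K : fieldType) (gT : finGroupType) (n : nat).
Variable rG : mx_representation K [set: gT] n.
Local Notation S := {mpoly K[n]}.
Local Notation act := (Defs.act rG).
Hypothesis charK : [pchar K] =i pred0.

Lemma derivation_horner (D : {additive S -> S}) (P : {poly S}) x :
    (forall p q, D (p * q) = D p * q + p * D q) -> (forall i, D P`_i = 0) ->
  D P.[x] = P^`().[x] * D x.
Proof.
move=> DM; elim/poly_ind: P => [|P c ih] DP.
  by rewrite deriv0 !horner0 raddf0 mul0r.
have DPi i : D P`_i = 0 by move: (DP i.+1); rewrite coefD coefMX coefC /= addr0.
have Dc : D c = 0 by move: (DP 0%N); rewrite coefD coefMX coefC /= add0r.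
rewrite hornerD hornerMX hornerC raddfD /= Dc addr0 DM ih // derivD derivM derivX derivC addr0.
rewrite hornerD hornerMX mulr1 mulrDl.
by rewrite mulrAC.
Qed.

Lemma mulrn_mpoly_eq0 (p : S) k : p *+ k.+1 = 0 -> p = 0.
Proof.
rewrite -scaler_nat => /eqP; rewrite scaler_eq0 => /orP[|/eqP //].
by rewrite (pcharf0P _).1.
Qed.

(* A derivation over the invariants vanishes at the root of a separable polynomial
   with invariant coefficients. *)
Lemma derivation_inv_eq0 (D : {additive S -> S}) :
    (forall p q, D (p * q) = D p * q + p * D q) ->
    (forall r, r \in inv_pred rG -> D r = 0) -> forall x, D x = 0.
Proof.
(* Take an annihilating polynomial of least size. Its derivative also has invariant coefficients and
   is shorter, so it cannot vanish at [x] unless it is zero, which characteristic zero excludes. *)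
move=> DM DR x; pose ok k := boolp.asbool (exists P : {poly S},
  [/\ size P = k, P != 0, P.[x] = 0 & forall i, P`_i \in inv_pred rG]).
have exk : exists k, ok k.
  exists #|gT|.+1; apply/boolp.asboolP; exists (orbit_poly rG x); split.
  - exact: size_orbit_poly.
  - by rewrite -size_poly_gt0 size_orbit_poly.
  - exact: orbit_poly_root.
  - by move=> i; exact: orbit_poly_inv.
case: (ex_minnP exk) => k /boolp.asboolP[P [Pk P0 Px PR]] mink.
have := derivation_horner x DM (fun i => DR _ (PR i)).
rewrite Px raddf0 => /esym/eqP; rewrite mulf_eq0 => /orP[/eqP P'x|/eqP //].
have [P'0|P'0] := eqVneq P^`() 0.
  case: (size P) (Pk) (lead_coefE P) => [|[|j]] Pj.
  - by move: P0; rewrite -size_poly_eq0 Pk -Pj.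
  - have /size1_polyC PE : (size P <= 1)%N by rewrite Pk -Pj.
    by move: Px P0; rewrite PE hornerC => ->; rewrite polyC0 eqxx.
  move=> lc; have /polyP/(_ j) := P'0; rewrite coef_deriv coef0 => /mulrn_mpoly_eq0.
  by rewrite -lc => /eqP; rewrite lead_coef_eq0 (negPf P0).
have : (k <= size P^`())%N.
  apply: mink; apply/boolp.asboolP; exists P^`(); split=> // i.
  by rewrite coef_deriv rpredMn.
by rewrite leqNgt -Pk lt_size_deriv.
Qed.

Variable f : n.-tuple S.
Hypothesis f_basic : basic_invariants rG f.

(** A vector [th] in the kernel of the Jacobian matrix is a derivation [\sum_i th_i d/dx_i] that
    kills every [f_i], hence all invariants, hence all of [S]; its value at ['X_j] is [th_j]. *)
Lemma jacobian_neq0 : jacobian f != 0.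
Proof.
apply/negP => /eqP J0.
have : \det (\matrix_(i, j) mderiv j (tnth f i))^T == 0.
  by rewrite det_tr; apply/eqP.
case/det0P => th th0 thJ; case/eqP: th0; apply/rowP => j; rewrite mxE.
pose D0 (p : S) := \sum_i th 0 i * mderiv i p.
have DB : zmod_morphism D0.
  move=> p q; rewrite /D0 -sumrB; apply: eq_bigr => i _.
  by rewrite mderivB mulrBr.
pose D := HB.pack_for {additive S -> S} D0 (GRing.isZmodMorphism.Build S S D0 DB).
have DM p q : D (p * q) = D p * q + p * D q.
  rewrite /= /D0 mulr_suml mulr_sumr -big_split /=; apply: eq_bigr => i _.
  by rewrite mderivM mulrDr mulrA [p * (_ * _)]mulrCA.
have DC c : D c%:MP = 0.
  by rewrite /= /D0 big1 // => i _; rewrite mderivC mulr0.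
have Df i : D (tnth f i) = 0.
  move/rowP: thJ => /(_ i); rewrite !mxE => <-.
  by apply: eq_bigr => k _; rewrite !mxE.
have DR r : r \in inv_pred rG -> D r = 0.
  have [_ h _] := f_basic; move=> /h[q ->]; move: q.
  apply: mpoly_ring_ind => [c|i|p q hp hq|p q hp hq].
  - by rewrite comp_mpolyC DC.
  - by rewrite comp_mpolyXU -tnth_nth Df.
  - by rewrite comp_mpolyD (raddfD D) hp hq addr0.
  - by rewrite rmorphM DM hp hq mul0r mulr0 addr0.
have := derivation_inv_eq0 DM DR 'X_j.
rewrite /= /D0 (bigD1 j) //= big1 => [|i /negPf ij]; last first.
  by rewrite mderivX mnm1E eq_sym ij scale0r mulr0.
rewrite addr0 mderivX mnm1E eqxx scale1r.
have -> : (U_(j) - U_(j) = 0 :> 'X_{1..n})%MM.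
  by apply/mnmP => i; rewrite mnmBE subnn mnm0E.
by rewrite mpolyX0 mulr1.
Qed.

(** Chain rule for the linear substitution, applied to the invariant [f_i]. *)
Lemma act_jacobian g : act g (jacobian f) * (\det (rG g))%:MP = jacobian f.
Proof.
have chain p i : mderiv i (act g p) = \sum_j (rG g i j)%:MP * act g (mderiv j p).
  move: p; apply: mpoly_ring_ind => [c|k|p q hp hq|p q hp hq].
  - rewrite {1}/Defs.act comp_mpolyC mderivC big1 // => j _.
    by rewrite mderivC rmorph0 mulr0.
  - rewrite Defs.actX; have -> : lin_form (rG g *m delta_mx k 0) = \sum_l rG g l k *: 'X_l :> S.
      by apply: eq_bigr => l _; rewrite -colE mxE.
    rewrite raddf_sum /= (bigD1 i) //= big1 => [|l /negPf li]; last first.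
      by rewrite mderivZ mderivX mnm1E li scale0r scaler0.
    rewrite (bigD1 k) //= [X in _ = _ + X]big1 => [|l /negPf li]; last first.
      by rewrite mderivX mnm1E eq_sym li scale0r rmorph0 mulr0.
    have U0 l : (U_(l) - U_(l) = 0 :> 'X_{1..n})%MM.
      by apply/mnmP => l'; rewrite mnmBE subnn mnm0E.
    rewrite mderivZ !mderivX !mnm1E !eqxx !scale1r !U0 mpolyX0 rmorph1 mulr1.
    by rewrite -mul_mpolyC mulr1.
  - rewrite rmorphD mderivD hp hq -big_split; apply: eq_bigr => j _.
    by rewrite mderivD rmorphD mulrDr.
  - rewrite rmorphM mderivM /= hp hq mulr_suml mulr_sumr -big_split /=; apply: eq_bigr => j _.
    by rewrite mderivM rmorphD !rmorphM /=; ring.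
rewrite -(det_map_mx (@mpolyC n K)) -det_map_mx -[X in _ * X]det_tr -det_mulmx.
congr (\det _); apply/matrixP => i k; rewrite !mxE.
rewrite -[tnth f i in RHS](invP _ _ (f_inv f_basic i) g) chain; apply: eq_bigr => j _.
by rewrite !mxE mulrC.
Qed.

End Jacobian.

(** Dividing by [a] in the fraction field gives a one-sided inverse, where ranks decide. *)
Lemma mulmx_scalar_min (R : idomainType) m n (A : 'M[R]_(m, n)) B a :
  a != 0 -> A *m B = a%:M -> (m <= n)%N.
Proof.
move=> a0 AB; pose F := {fraction R}.
pose A' : 'M[F]_(m, n) := (fraction.FracField.tofrac a)^-1 *: map_mx (@fraction.FracField.tofrac R) A.
apply: (@mulmx1_min F m n A' (map_mx (@fraction.FracField.tofrac R) B)).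
rewrite /A' -scalemxAl -map_mxM AB map_scalar_mx scale_scalar_mx mulVf //.
by rewrite fraction.tofrac_eq0.
Qed.

(** * Coordinates on the tensor product *)

Section TensorBasis.
Variables (K : fieldType) (gT : finGroupType) (n : nat).
Variable rG : mx_representation K [set: gT] n.
Local Notation S := {mpoly K[n]}.
Local Notation act := (Defs.act rG).
Local Notation R := (inv_pred rG).
Variables (k : nat) (b : 'I_k -> S).
Hypothesis b_span : forall p, exists2 r : 'I_k -> S, forall i, r i \in R & p = \sum_i r i * b i.
Hypothesis b_free : forall r : 'I_k -> S, (forall i, r i \in R) ->
  \sum_i r i * b i = 0 -> forall i, r i = 0.

Lemma coord_exists : exists co : S -> 'I_k -> S,
  [/\ forall p i, co p i \in R,
      forall p, p = \sum_i co p i * b i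
    & forall p (r : 'I_k -> S), (forall i, r i \in R) -> p = \sum_i r i * b i ->
        forall i, co p i = r i].
Proof.
have /boolp.choice[co h] : forall p, exists r : 'I_k -> S,
    (forall i, r i \in R) /\ p = \sum_i r i * b i.
  by move=> p; have [r r1 r2] := b_span p; exists r.
exists co; split=> [p|p|p r rR pE i]; [by have [] := h p|by have [] := h p|].
have [cR pE'] := h p; apply/eqP; rewrite -subr_eq0; apply/eqP.
apply: (b_free (r := fun i => co p i - r i)) => [j|]; first exact: rpredB.
rewrite (eq_bigr (fun j => co p j * b j - r j * b j)) => [|j _]; last by rewrite mulrBl.
by rewrite sumrB -pE' -pE subrr.
Qed.

Variable co : S -> 'I_k -> S.
Hypothesis coR : forall p i, co p i \in R.
Hypothesis coE : forall p, p = \sum_i co p i * b i.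
Hypothesis coU : forall p (r : 'I_k -> S), (forall i, r i \in R) -> p = \sum_i r i * b i ->
  forall i, co p i = r i.

Lemma coD p q i : co (p + q) i = co p i + co q i.
Proof.
apply: (coU (r := fun i => co p i + co q i)) => [j|]; first exact: rpredD.
rewrite (eq_bigr (fun j => co p j * b j + co q j * b j)) => [|j _]; last by rewrite mulrDl.
by rewrite big_split /= -!coE.
Qed.

Lemma coM r p i : r \in R -> co (r * p) i = r * co p i.
Proof.
move=> rR; apply: (coU (r := fun i => r * co p i)) => [j|]; first exact: rpredM.
by rewrite {1}(coE p) mulr_sumr; apply: eq_bigr => j _; rewrite mulrA.
Qed.

Lemma co_basis i j : co (b i) j = (i == j)%:R.
Proof.
apply: (coU (r := fun j => (i == j)%:R)) => [l|]; first exact: rpred_nat.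
rewrite (bigD1 i) //= eqxx mul1r big1 ?addr0 // => l /negPf li.
by rewrite eq_sym li mul0r.
Qed.

Definition tens_basis i : tensSS rG := tens R 1 (b i).

Lemma tens_expand a p : tens R a p = \sum_i (a * co p i) *: tens_basis i.
Proof.
have tensS (F : 'I_k -> S) : tens R a (\sum_i F i) = \sum_i tens R a (F i).
  apply: (big_morph (tens R a)) => [x y|]; first exact: tensDr.
  by apply: (addrI (tens R a 0)); rewrite -tensDr !addr0.
rewrite {1}(coE p) tensS; apply: eq_bigr => i _.
by rewrite -tens_balanced // scale_tens mulr1.
Qed.

Definition tens_coord : tensSS rG -> 'rV[S]_k :=
  tens_lift (fun p => \row_i co p i).

Lemma tens_coord_linear : linear tens_coord.
Proof.
apply: tens_lift_linear => [p q|r p rR]; apply/rowP => i; rewrite !mxE ?coD //.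
by rewrite coM.
Qed.

Lemma tens_coordE a p i : tens_coord (tens R a p) 0 i = a * co p i.
Proof.
rewrite /tens_coord tens_liftE ?mxE // => [x y|r x rR]; apply/rowP => j.
  by rewrite !mxE coD.
by rewrite !mxE coM.
Qed.

HB.instance Definition _ :=
  GRing.isLinear.Build S (tensSS rG) 'rV[S]_k *:%R tens_coord tens_coord_linear.

Lemma tens_coord_sum t : t = \sum_i tens_coord t 0 i *: tens_basis i.
Proof.
have [s ->] := tens_sum t; elim: s => [|p s ih].
  by rewrite big_nil raddf0 big1 // => i _; rewrite mxE scale0r.
rewrite big_cons raddfD /= {1}ih {1}tens_expand -big_split; apply: eq_bigr => i _ /=.
by rewrite mxE tens_coordE scalerDl.
Qed.

Lemma tens_coord_basis (c : 'rV[S]_k) : tens_coord (\sum_i c 0 i *: tens_basis i) = c.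
Proof.
rewrite raddf_sum /=; apply/rowP => j; rewrite summxE (bigD1 j) //=.
rewrite linearZ /= mxE /tens_basis tens_coordE co_basis eqxx !mulr1 big1 ?addr0 // => i /negPf ij.
by rewrite linearZ /= mxE /tens_basis tens_coordE co_basis ij !mulr0.
Qed.

Lemma tens_basisP : is_basis tens_basis.
Proof.
move=> t; exists (tens_coord t); split; first exact: tens_coord_sum.
by move=> c ->; rewrite tens_coord_basis.
Qed.

Variable f : n.-tuple S.
Variable psi : {linear {ffun gT -> S^o} -> tensSS rG}.
Hypothesis phi_psi : forall h, phi (psi h) = jacobian f *: h.
Hypothesis psi_phi : forall t : tensSS rG, psi (phi t) = jacobian f *: t.
Hypothesis J0 : jacobian f != 0.

Definition mdelta (g : gT) : {ffun gT -> S^o} := [ffun h => ((h == g)%:R : S^o)].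

Lemma mdelta_sum (h : {ffun gT -> S^o}) : h = \sum_g (h g : S) *: mdelta g.
Proof.
apply/ffunP => g; rewrite sum_ffunE (bigD1 g) //= big1 => [|l /negPf lg].
  by rewrite !ffunE eqxx addr0 /GRing.scale /= mulr1.
by rewrite !ffunE eq_sym lg /GRing.scale /= mulr0.
Qed.

Lemma phi_coord t g : phi t g = \sum_i tens_coord t 0 i * act g (b i).
Proof.
rewrite {1}(tens_coord_sum t) raddf_sum sum_ffunE; apply: eq_bigr => i _.
by rewrite /= linearZ /= ffunE phiE mul1r.
Qed.

Lemma basis_size : k = #|gT|.
Proof.
pose A : 'M[S]_(#|gT|, k) := \matrix_(p, i) act (enum_val p) (b i).
pose B : 'M[S]_(k, #|gT|) := \matrix_(i, p) tens_coord (psi (mdelta (enum_val p))) 0 i.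
apply/eqP; rewrite eqn_leq; apply/andP; split.
  apply: (@mulmx_scalar_min _ _ _ B A _ J0); apply/matrixP => i j; rewrite !mxE.
  have : tens_coord (psi (phi (tens_basis j))) 0 i = jacobian f * (i == j)%:R.
    by rewrite psi_phi linearZ /= mxE /tens_basis tens_coordE co_basis mul1r eq_sym.
  rewrite {1}(mdelta_sum (phi (tens_basis j))) !raddf_sum /= summxE => h.
  rewrite -mulr_natr -h [RHS](reindex (@enum_val _ (mem gT))) /=; last first.
    by apply: onW_bij; exact: enum_val_bij.
  apply: eq_bigr => p _; rewrite !mxE !linearZ /= mxE mulrC.
  by rewrite [phi _ _]phiE mul1r.
apply: (@mulmx_scalar_min _ _ _ A B _ J0); apply/matrixP => p q; rewrite !mxE.
have /ffunP/(_ (enum_val p)) := phi_psi (mdelta (enum_val q)).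
rewrite phi_coord !ffunE (inj_eq enum_val_inj) => e; rewrite -mulr_natr -[RHS]e.
by apply: eq_bigr => i _; rewrite !mxE mulrC.
Qed.

Lemma dual_family : exists u : 'I_k -> S,
  forall h, \sum_i act h (b i) * u i = jacobian f *+ (h == 1%g).
Proof.
exists (fun i => tens_coord (psi (mdelta 1%g)) 0 i) => h.
have /ffunP/(_ h) := phi_psi (mdelta 1%g).
rewrite phi_coord !ffunE => e; rewrite -mulr_natr -[RHS]e.
by apply: eq_bigr => i _; rewrite mulrC.
Qed.

End TensorBasis.

(** * The Hilbert series *)

Section HilbertSeries.

Lemma free_family_leq (K : fieldType) (V : lmodType K) (I J : finType) (v : I -> V) (w : J -> V) :
    (forall c : I -> K, \sum_i c i *: v i = 0 -> forall i, c i = 0) ->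
    (forall i, exists c : J -> K, v i = \sum_j c j *: w j) ->
    (forall j, exists c : I -> K, w j = \sum_i c i *: v i) ->
  (#|I| <= #|J|)%N.
Proof.
move=> free /boolp.choice[A vA] /boolp.choice[B wB].
pose A' : 'M[K]_(#|I|, #|J|) := \matrix_(p, q) A (enum_val p) (enum_val q).
pose B' : 'M[K]_(#|J|, #|I|) := \matrix_(q, p) B (enum_val q) (enum_val p).
apply: (@mulmx1_min _ _ _ A' B'); apply/matrixP => p q; rewrite !mxE.
pose i := enum_val p; pose c l := (\sum_j A i j * B j l) - (i == l)%:R.
have c0 : \sum_l c l *: v l = 0.
  rewrite (eq_bigr (fun l => \sum_j (A i j * B j l) *: v l - (i == l)%:R *: v l)); last first.
    by move=> l _; rewrite scalerBl scaler_suml.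
  rewrite sumrB exchange_big /= [X in _ - X](bigD1 i) //= eqxx scale1r.
  rewrite [X in _ - (_ + X)]big1 => [|l /negPf li]; last by rewrite eq_sym li scale0r.
  rewrite addr0 [v i]vA; apply/eqP; rewrite subr_eq0; apply/eqP.
  apply: eq_bigr => j _; rewrite [in RHS]wB scaler_sumr; apply: eq_bigr => l _.
  by rewrite scalerA.
have /eqP := free c c0 (enum_val q).
rewrite subr_eq0 (inj_eq enum_val_inj) => /eqP <-.
rewrite [RHS](reindex (@enum_val _ (mem J))) /=; last by apply: onW_bij; exact: enum_val_bij.
by apply: eq_bigr => j _; rewrite !mxE.
Qed.

Variables (K : fieldType) (gT : finGroupType) (n : nat).
Variable rG : mx_representation K [set: gT] n.
Local Notation S := {mpoly K[n]}.
Local Notation R := (inv_pred rG).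
Variable f : n.-tuple S.
Hypothesis f_basic : basic_invariants rG f.
Variable dg : 'I_n -> nat.
Hypothesis f_homog : forall i, tnth f i \is (dg i).-homog.
Variables (k : nat) (b : 'I_k -> S) (e : 'I_k -> nat).
Hypothesis be : forall i, b i \is (e i).-homog.
Hypothesis b_span : forall p, exists2 r : 'I_k -> S, forall i, r i \in R & p = \sum_i r i * b i.
Hypothesis b_free : forall r : 'I_k -> S, (forall i, r i \in R) ->
  \sum_i r i * b i = 0 -> forall i, r i = 0.

(** Bounding the exponents by [T] makes the index set finite; this loses nothing in degrees below
    [T], as all weights are positive. *)
Definition multinom_of T (a : {ffun 'I_n -> 'I_T}) : 'X_{1..n} :=
  [multinom (a j : nat) | j < n].

Lemma multinom_of_inj T : injective (@multinom_of T).
Proof.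
move=> a a' /mnmP h; apply/ffunP => j; apply: val_inj.
by have := h j; rewrite !mnmE.
Qed.

Lemma multinom_ofP T (m : 'X_{1..n}) : (forall j, (m j < T)%N) -> exists a : {ffun 'I_n -> 'I_T}, multinom_of a = m.
Proof.
by move=> h; exists [ffun j => Ordinal (h j)]; apply/mnmP => j; rewrite mnmE ffunE.
Qed.

Definition weight (d : 'I_n -> nat) (m : 'X_{1..n}) : nat := (\sum_j d j * m j)%N.

Lemma comp_f_homog m : 'X_[m] \mPo f \is (weight dg m).-homog.
Proof.
by rewrite comp_mpolyX; apply: dhomog_prod_fin => j; exact: dhomogMn.
Qed.

Definition basis_degree T D : {pred {ffun 'I_n -> 'I_T} * 'I_k} :=
  fun x => (weight dg (multinom_of x.1) + e x.2 == D)%N.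
Definition monomial_degree T D : {pred {ffun 'I_n -> 'I_T}} :=
  fun a => weight (fun=> 1%N) (multinom_of a) == D.

Arguments basis_degree : clear implicits.
Arguments monomial_degree : clear implicits.

Lemma free_monomials T (A : {pred {ffun 'I_n -> 'I_T}}) (c : {ffun 'I_n -> 'I_T} -> K) :
  \sum_(a in A) c a *: 'X_[K, multinom_of a] = 0 -> {in A, forall a, c a = 0}.
Proof.
move=> h a Aa; have /mpolyP/(_ (multinom_of a)) := h.
rewrite mcoeff0 raddf_sum /= (bigD1 a) //= mcoeffZ mcoeffX eqxx mulr1 big1 ?addr0 //.
by move=> a' /andP[_ /negPf ne]; rewrite mcoeffZ mcoeffX (inj_eq (@multinom_of_inj T)) ne mulr0.
Qed.

Lemma monomial_span T D (p : S) : (D < T)%N -> p \is D.-homog -> exists c : {x in monomial_degree T D} -> K,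
  p = \sum_x c x *: 'X_[K, multinom_of (val x)].
Proof.
move=> DT /dhomogP hp; pose span (q : S) := exists c : {x in monomial_degree T D} -> K,
  q = \sum_x c x *: 'X_[K, multinom_of (val x)].
rewrite -/(span p) [p]mpolyE big_seq.
apply: (big_ind span) => [|p1 p2 [c1 ->] [c2 ->]|m /hp /= mD].
- by exists (fun=> 0); rewrite big1 // => x _; rewrite scale0r.
- exists (fun x => c1 x + c2 x); rewrite -big_split; apply: eq_bigr => x _.
  by rewrite scalerDl.
have [a am] : exists a : {ffun 'I_n -> 'I_T}, multinom_of a = m.
  apply: multinom_ofP => j; apply: leq_ltn_trans DT; rewrite -mD mdegE.
  by rewrite (bigD1 j) //= leq_addr.
have aD : weight (fun=> 1%N) (multinom_of a) == D.
  by rewrite am -mD mdegE; apply/eqP/eq_bigr => j _; rewrite mul1n.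
pose x0 : {x in monomial_degree T D} := Sub a aD.
exists (fun x => p@_m *+ (x == x0)); rewrite (bigD1 x0) //= eqxx mulr1n am big1 ?addr0 //.
by move=> x /negPf ->; rewrite scale0r.
Qed.

Lemma basis_span T D (p : S) : (D < T)%N -> p \is D.-homog -> exists c : {x in basis_degree T D} -> K,
  p = \sum_x c x *: (('X_[multinom_of (val x).1] \mPo f) * b (val x).2).
Proof.
move=> DT hp; pose span q := exists c : {x in basis_degree T D} -> K,
  q = \sum_x c x *: (('X_[multinom_of (val x).1] \mPo f) * b (val x).2).
have span0 : span 0.
  by exists (fun=> 0); rewrite big1 // => x _; rewrite scale0r.
have spanD q1 q2 : span q1 -> span q2 -> span (q1 + q2).
  move=> [c1 ->] [c2 ->]; exists (fun x => c1 x + c2 x).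
  by rewrite -big_split; apply: eq_bigr => x _; rewrite scalerDl.
have spanZ c q : span q -> span (c *: q).
  move=> [c1 ->]; exists (fun x => c * c1 x); rewrite scaler_sumr.
  by apply: eq_bigr => x _; rewrite scalerA.
rewrite -/(span p) -(pihomog_dE hp); have [r rR {1}->] := b_span p.
rewrite raddf_sum; apply: big_ind => // i _ /=.
have [_ hR _] := f_basic; have [q ->] := (hR _).1 (rR i).
rewrite [q]mpolyE (big_morph (comp_mpoly f) (comp_mpolyD f) (comp_mpoly0 f)) mulr_suml raddf_sum.
apply: big_ind => // m _ /=.
rewrite comp_mpolyZ -scalerAl linearZ /=; apply: spanZ.
have hm : ('X_[m] \mPo f) * b i \is (weight dg m + e i).-homog.
  by apply: dhomogM => //; exact: comp_f_homog.
have [mD|ne] := eqVneq (weight dg m + e i)%N D; last by rewrite (pihomog_ne0 _ hm).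
rewrite pihomog_dE -?mD //.
have [a am] : exists a : {ffun 'I_n -> 'I_T}, multinom_of a = m.
  apply: multinom_ofP => j; apply: leq_ltn_trans DT; rewrite -mD.
  apply: leq_trans (leq_addr _ _); rewrite /weight (bigD1 j) //=.
  by apply: leq_trans (leq_addr _ _); rewrite leq_pmull // (dg_gt0 f_basic f_homog).
have aD : (weight dg (multinom_of (a, i).1) + e (a, i).2 == D)%N by rewrite /= am mD.
pose x0 : {x in basis_degree T D} := Sub (a, i) aD.
exists (fun x => (x == x0)%:R); rewrite (bigD1 x0) //= eqxx scale1r am big1 ?addr0 //.
by move=> x /negPf ->; rewrite scale0r.
Qed.

Lemma basis_degree_free T D (c : {x in basis_degree T D} -> K) :
  \sum_x c x *: (('X_[multinom_of (val x).1] \mPo f) * b (val x).2) = 0 -> forall x, c x = 0.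
Proof.
pose c' (x : {ffun 'I_n -> 'I_T} * 'I_k) := if insub x is Some y then c y else 0.
have cE y : c y = c' (val y) by rewrite /c' valK.
move=> h x; rewrite cE.
have {}h : \sum_i (\sum_a c' (a, i) *: 'X_[K, multinom_of a] \mPo f) * b i = 0.
  rewrite -[RHS]h (eq_bigr (fun x : {x in basis_degree T D} =>
    c' (val x) *: (('X_[multinom_of (val x).1] \mPo f) * b (val x).2))); last first.
    by move=> y _; rewrite -cE.
  rewrite -(big_sub (basis_degree T D) (fun x => c' x *: (('X_[multinom_of x.1] \mPo f) * b x.2))).
  rewrite [RHS]big_mkcond /= (eq_bigr (fun x => c' (x.1, x.2) *: (('X_[multinom_of x.1] \mPo f) * b x.2))).
    rewrite -(pair_bigA _ (fun a i => c' (a, i) *: (('X_[multinom_of a] \mPo f) * b i))) exchange_big.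
    apply: eq_bigr => i _; rewrite (big_morph (comp_mpoly f) (comp_mpolyD f) (comp_mpoly0 f)).
    by rewrite mulr_suml; apply: eq_bigr => a _; rewrite comp_mpolyZ -scalerAl.
  by move=> [a i] _ /=; case: ifP => // /negbT yD; rewrite /c' insubN // scale0r.
have [_ hR alg] := f_basic.
have h0 i : \sum_a c' (a, i) *: 'X_[K, multinom_of a] = 0.
  apply: alg; apply: (b_free _ h) => j; apply/hR; by eexists.
case: x => -[a i] xD /=.
by apply: (free_monomials (A := predT) (c := fun a => c' (a, i))).
Qed.

(** Both sets index a basis over [K] of the degree [D] part of [S]: the monomials in the [f_j] times
    the [b_i], and the monomials in the variables. *)
Lemma hilbert_count T D : (D < T)%N -> #|basis_degree T D| = #|monomial_degree T D|.
Proof.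
move=> DT; rewrite -[LHS]card_sig -[RHS]card_sig.
have wD (x : {x in basis_degree T D}) :
    ('X_[multinom_of (val x).1] \mPo f) * b (val x).2 \is D.-homog.
  by have /eqP xD := valP x; rewrite -[X in X.-homog]xD; apply: dhomogM => //; exact: comp_f_homog.
have mD (x : {x in monomial_degree T D}) : ('X_[multinom_of (val x)] : S) \is D.-homog.
  have /eqP xD := valP x; rewrite dhomogX /= -[X in _ == X]xD mdegE.
  by apply/eqP/eq_bigr => j _; rewrite mul1n.
apply/eqP; rewrite eqn_leq; apply/andP; split.
  apply: (free_family_leq (V := S) _ (fun x => monomial_span DT (wD x)) (fun x => basis_span DT (mD x))).
  exact: basis_degree_free.
apply: (free_family_leq (V := S) _ (fun x => basis_span DT (mD x)) (fun x => monomial_span DT (wD x))).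
move=> c h x; pose c' a := if insub a is Some y then c y else 0.
have cE (y : {x in monomial_degree T D}) : c y = c' (val y) by rewrite /c' valK.
rewrite cE; apply: (free_monomials (A := monomial_degree T D)); last exact: valP.
by rewrite big_sub -[RHS]h; apply: eq_bigr => y _; rewrite -cE.
Qed.

End HilbertSeries.

(** * Integer polynomials modulo a power of the variable *)

Section TruncatedSeries.
Variable T : nat.

(** Congruence modulo ['X^T], standing in for equality of power series as [T] varies. *)
Definition eqXn (p q : {poly int}) : Prop := forall i, (i < T)%N -> p`_i = q`_i.

Lemma eqXnM p p' q q' : eqXn p p' -> eqXn q q' -> eqXn (p * q) (p' * q').
Proof.
move=> hp hq i iT; rewrite !coefM; apply: eq_bigr => j _.
have ji : (j <= i)%N by rewrite -ltnS.
by rewrite hp ?hq // ?(leq_ltn_trans (leq_subr _ _)) // (leq_ltn_trans ji).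
Qed.

Lemma eqXn_subXn d : (0 < d)%N -> eqXn (1 - 'X^(d * T)) 1.
Proof.
move=> d0 i iT; rewrite coefB coefXn (_ : (i == d * T)%N = false) ?subr0 //.
by rewrite ltn_eqF // (leq_trans iT) // leq_pmull.
Qed.

Lemma eqXn_prod (I : finType) (F : I -> {poly int}) :
  (forall i, eqXn (F i) 1) -> eqXn (\prod_i F i) 1.
Proof.
move=> h; apply: (big_ind (fun p => eqXn p 1)) => // p q hp hq.
by rewrite -[1]mulr1; apply: eqXnM.
Qed.

Lemma geometric_sum d :
  (1 - 'X^d) * (\sum_(i < T) 'X^(d * i)) = 1 - 'X^(d * T) :> {poly int}.
Proof.
rewrite -opprB mulNr (eq_bigr (fun i : 'I_T => ('X^d) ^+ i)) => [|i _]; last first.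
  by rewrite exprM.
by rewrite -subrX1 -exprM opprB.
Qed.

Lemma coef_geometric_prod n k (d : 'I_n -> nat) (e : 'I_k -> nat) D :
  ((\sum_i 'X^(e i)) * \prod_j \sum_(l < T) 'X^(d j * l) : {poly int})`_D =
  #|[pred x : {ffun 'I_n -> 'I_T} * 'I_k | (\sum_j d j * x.1 j + e x.2 == D)%N]|%:R.
Proof.
rewrite bigA_distr_bigA /= mulr_suml coef_sum -sum1_card natr_sum.
rewrite (eq_bigr (fun i => \sum_(a : {ffun 'I_n -> 'I_T})
   (if (\sum_j d j * a j + e i == D)%N then 1 else 0))); last first.
  move=> i _; rewrite mulr_sumr coef_sum; apply: eq_bigr => a _.
  rewrite (eq_bigr (fun j => 'X ^+ (d j * a j)%N)) // prodrXr -exprD coefXn.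
  by rewrite eq_sym addnC; case: eqP.
rewrite exchange_big pair_bigA -big_mkcond /=.
by apply: eq_bigl => -[a i].
Qed.

End TruncatedSeries.

Lemma cyclotomic_factor d : 1 - 'X^d = (1 - 'X) * \sum_(i < d) 'X^i :> {poly int}.
Proof. by rewrite -opprB subrX1 -mulNr opprB. Qed.

(** Logarithmic derivative at 1: a factor with [d] terms contributes [(d - 1) / 2], and the factor 2
    keeps the identity integral. *)
Lemma deriv_prod_at1 n (d : 'I_n -> nat) (P := \prod_j \sum_(i < d j) 'X^i : {poly int}) :
  (forall j, 0 < d j)%N ->
  P.[1] = (\prod_j d j)%:R /\ 2 * (P^`()).[1] = P.[1] * (\sum_j (d j).-1)%:R.
Proof.
move=> d0; have H j (G : {poly int} := \sum_(i < d j) 'X^i) :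
    G.[1] = (d j)%:R /\ 2 * (G^`()).[1] = G.[1] * ((d j).-1)%:R.
  rewrite /G; case: (d j) (d0 j) => // m _ {G}; elim: m => [|m [ih1 ih2]].
    by rewrite big_ord1 expr0 hornerC derivC horner0 !mulr0.
  rewrite big_ord_recr /= hornerD derivD hornerD ih1 mulrDr ih2 ih1 hornerXn expr1n derivXn.
  rewrite hornerMn hornerXn expr1n; split; first by rewrite natr1.
  by rewrite /= -!natr1; ring.
rewrite /P; elim/big_rec3: _ => [|j p s Q _ [h1 h2]].
  by rewrite hornerC derivC horner0 !mulr0.
have [g1 g2] := H j.
rewrite derivM hornerD !hornerM h1 g1 natrM; split=> //.
rewrite mulrDr mulrA g2 g1 mulrCA h2 h1 natrD; ring.
Qed.

(** With [F] the sum of the ['X^(e i)], equal counts mean that [F] over the product of the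
    [1 - 'X^(d j)] is [(1 - 'X)^-n]. So [F] is the product of the [1 + ... + 'X^(d j - 1)]; its
    value at 1 is [k], and its derivative there is the sum of the [e i]. *)
Lemma hilbert_degrees n k (d : 'I_n -> nat) (e : 'I_k -> nat) :
    (forall j, 0 < d j)%N ->
    (forall T D, (D < T)%N ->
       #|[pred x : {ffun 'I_n -> 'I_T} * 'I_k | (\sum_j d j * x.1 j + e x.2 == D)%N]| =
       #|[pred a : {ffun 'I_n -> 'I_T} | (\sum_j 1 * a j == D)%N]|) ->
  (2 * \sum_i e i = k * \sum_j (d j).-1)%N.
Proof.
move=> d0 cnt.
pose F : {poly int} := \sum_i 'X^(e i).
pose U : {poly int} := \prod_j (1 - 'X^(d j)).
pose V : {poly int} := \prod_(j < n) (1 - 'X).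
have key T : eqXn T (F * V) U.
  pose A : {poly int} := \prod_j \sum_(l < T) 'X^(d j * l).
  pose B : {poly int} := \prod_(j < n) \sum_(l < T) 'X^(1 * l).
  have AB : eqXn T (F * A) B.
    move=> D DT; rewrite coef_geometric_prod cnt //.
    (* The count of plain monomials is the case of weights 1 and a single basis element of degree
       0. *)
    have := @coef_geometric_prod T n 1 (fun=> 1%N) (fun=> 0%N) D.
    rewrite big_ord1 mul1r => ->; congr (_%:R).
    rewrite -!sum1_card (reindex (fun a : {ffun 'I_n -> 'I_T} => (a, ord0 : 'I_1))) /=.
      by apply: eq_bigl => a; rewrite !inE /= addn0.
    by exists fst => [a //|[a i] _]; rewrite (ord1 i).
  have AU : eqXn T (A * U) 1.
    rewrite mulrC -big_split /=; apply: eqXn_prod => j.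
    by rewrite geometric_sum; exact: eqXn_subXn.
  have BV : eqXn T (B * V) 1.
    rewrite mulrC -big_split /=; apply: eqXn_prod => j.
    by have := geometric_sum T 1; rewrite expr1 => ->; exact: eqXn_subXn.
  move=> i iT; transitivity ((F * V) * (A * U))`_i.
    by rewrite -[F * V in LHS]mulr1; apply: eqXnM iT => // l lT; rewrite AU.
  have -> : F * V * (A * U) = (F * A) * (V * U) by ring.
  transitivity (B * (V * U))`_i; first by apply: eqXnM iT.
  rewrite mulrA -[U in RHS]mul1r; apply: eqXnM iT => //.
have FV : F * V = U.
  apply/polyP => i; exact: (key i.+1).
have FP : F = \prod_j \sum_(i < d j) 'X^i.
  have V0 : V != 0.
    apply/prodf_neq0 => j _; rewrite -size_poly_gt0 -opprB size_polyN.
    by rewrite -[1]/(1%:P) size_XsubC.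
  apply: (mulIf V0); rewrite FV mulrC -big_split /=.
  by apply: eq_bigr => j _; rewrite cyclotomic_factor.
have [_] := deriv_prod_at1 d0; rewrite -FP.
have -> : F.[1] = k%:R.
  rewrite /F horner_sum (eq_bigr (fun=> 1)) => [|i _]; last by rewrite hornerXn expr1n.
  by rewrite sumr_const card_ord.
have -> : F^`().[1] = (\sum_i e i)%:R.
  rewrite /F raddf_sum horner_sum natr_sum; apply: eq_bigr => i _ /=.
  by rewrite derivXn hornerMn hornerXn expr1n.
by rewrite -!natrM => /eqP; rewrite Num.Theory.eqr_nat => /eqP.
Qed.

(** * The matrix factorization *)

Lemma mulmx_det_cancel (R : idomainType) m p (A : 'M[R]_m) (X Y : 'M[R]_(m, p)) :
  \det A != 0 -> A *m X = A *m Y -> X = Y.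
Proof.
move=> A0 /(congr1 (mulmx (\adj A))); rewrite !mulmxA mul_adj_mx !mul_scalar_mx => h.
apply/matrixP => i j; apply: (mulfI A0).
by move/matrixP: h => /(_ i j); rewrite !mxE.
Qed.

Lemma basis_change (S : comUnitRingType) (M : lmodType S) m (b b' : 'I_m -> M) :
  is_basis b -> is_basis b' ->
  exists2 A : 'M[S]_m, A \in unitmx & forall j, b j = \sum_i A i j *: b' i.
Proof.
move=> hb hb'.
have ex (d d' : 'I_m -> M) : is_basis d' -> exists A : 'M[S]_m, forall j, d j = \sum_i A i j *: d' i.
  move=> hd; have /boolp.choice[c cE] j : exists c : 'rV[S]_m, d j = \sum_i c 0 i *: d' i.
    by have [c [cE _]] := hd (d j); exists c.
  by exists (\matrix_(i, j) c j 0 i) => j; rewrite {1}cE; apply: eq_bigr => i _; rewrite mxE.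
have [A AE] := ex b b' hb'; have [B BE] := ex b' b hb; exists A => //.
have BA : B *m A = 1%:M.
  apply/matrixP => i j; have [c [_ cU]] := hb (b j).
  have -> : (B *m A) i j = c 0 i.
    rewrite (cU (\row_l (B *m A) l j)) ?mxE //.
    rewrite {1}AE; under eq_bigr => l _ do rewrite BE scaler_sumr.
    rewrite exchange_big; apply: eq_bigr => l _; rewrite !mxE scaler_suml.
    by apply: eq_bigr => l' _; rewrite scalerA mulrC.
  rewrite (cU (\row_l (l == j)%:R)) ?mxE // (bigD1 j) //= mxE eqxx scale1r big1 ?addr0 //.
  by move=> l /negPf lj; rewrite mxE lj scale0r.
by case: (mulmx1_unit BA).
Qed.

Lemma is_matrix_change (S : comNzRingType) (M N : lmodType S) m (h : {linear M -> N})
    (b b' : 'I_m -> M) (c c' : 'I_m -> N) (P P' A C : 'M[S]_m) :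
    is_basis c' -> is_matrix b c h P -> is_matrix b' c' h P' ->
    (forall j, b j = \sum_i A i j *: b' i) -> (forall j, c j = \sum_i C i j *: c' i) ->
  C *m P = P' *m A.
Proof.
move=> hc' hP hP' bA cC; apply/matrixP => i j.
have [r [_ rU]] := hc' (h (b j)).
transitivity (r 0 i).
  rewrite (rU (\row_l (C *m P) l j)) ?mxE //.
  rewrite hP; under eq_bigr => l _ do rewrite cC scaler_sumr.
  rewrite exchange_big; apply: eq_bigr => l _; rewrite !mxE scaler_suml.
  by apply: eq_bigr => l' _; rewrite scalerA mulrC.
rewrite (rU (\row_l (P' *m A) l j)) ?mxE //.
rewrite bA raddf_sum; under eq_bigr => l _ do rewrite /= linearZ /= hP' scaler_sumr.
rewrite exchange_big; apply: eq_bigr => l _; rewrite !mxE scaler_suml.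
by apply: eq_bigr => l' _; rewrite scalerA mulrC.
Qed.

Section MatrixFactorization.
Variables (K : fieldType) (gT : finGroupType) (n : nat).
Variable rG : mx_representation K [set: gT] n.
Local Notation S := {mpoly K[n]}.
Local Notation act := (Defs.act rG).
Local Notation R := (inv_pred rG).
Local Notation N := #|gT|.
Hypothesis charK : [pchar K] =i pred0.
Variable f : n.-tuple S.
Hypothesis f_basic : basic_invariants rG f.
Local Notation J := (jacobian f).
Variables (b : 'I_N -> S) (co : S -> 'I_N -> S).
Hypothesis coR : forall p i, co p i \in R.
Hypothesis coE : forall p, p = \sum_i co p i * b i.
Hypothesis coU : forall p (r : 'I_N -> S), (forall i, r i \in R) -> p = \sum_i r i * b i ->
  forall i, co p i = r i.
Variable u : 'I_N -> S.
Hypothesis b_dual_u : forall h, \sum_i act h (b i) * u i = J *+ (h == 1%g).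

Definition phi_mx : 'M[S]_N := \matrix_(p, i) act (enum_val p) (b i).
Definition psi_mx : 'M[S]_N :=
  \matrix_(i, p) ((\det (rG (enum_val p)))%:MP * act (enum_val p) (u i)).
Definition dual_mx : 'M[S]_N := \matrix_(j, i) co (u i) j.
Definition det_mx : 'M[S]_N := diag_mx (\row_p (\det (rG (enum_val p)))%:MP).

(** The entry at [(g, h)] is the duality relation for [h^-1 g] translated by [h]; the factor [det h]
    in [psi_mx] turns [h(J)] back into [J]. *)
Lemma phi_psi_mx : phi_mx *m psi_mx = J%:M.
Proof.
apply/matrixP => p q; rewrite !mxE.
set g := enum_val p; set h := enum_val q.
have /(congr1 (act h)) := b_dual_u (h^-1 * g)%g.
rewrite rmorph_sum rmorphMn /= -eq_mulVg1 (inj_eq enum_val_inj) eq_sym => e.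
rewrite -[J in RHS](act_jacobian f_basic h) [in RHS]mulrC -mulrnAr -e mulr_sumr.
apply: eq_bigr => i _; rewrite !mxE rmorphM /= -Defs.actM mulKVg.
by rewrite mulrCA.
Qed.

Lemma psi_mxE : psi_mx = dual_mx^T *m phi_mx^T *m det_mx.
Proof.
apply/matrixP => i p; rewrite !mxE (bigD1 p) //= big1 => [|q /negPf qp]; last first.
  by rewrite !mxE eq_sym [p == q]eq_sym qp mulr0n mulr0.
rewrite !mxE eqxx mulr1n addr0 mulrC {1}(coE (u i)) rmorph_sum /=; congr (_ * _).
apply: eq_bigr => j _; rewrite !mxE rmorphM /=; congr (_ * _).
exact: (invP _ _ (coR _ _)).
Qed.

Lemma det_phi_mx_neq0 : \det phi_mx != 0.
Proof.
have := congr1 determinant phi_psi_mx; rewrite det_mulmx det_scalar => h.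
have : J ^+ N != 0 by rewrite expf_neq0 // (jacobian_neq0 charK f_basic).
by apply: contraNneq => h0; rewrite -h h0 mul0r.
Qed.

Lemma psi_phi_mx : psi_mx *m phi_mx = J%:M.
Proof.
apply: (mulmx_det_cancel det_phi_mx_neq0).
by rewrite mulmxA phi_psi_mx mul_scalar_mx mul_mx_scalar.
Qed.

Lemma det_repr_neq0 g : \det (rG g) != 0.
Proof. by rewrite -unitfE -unitmxE repr_mx_unit. Qed.

Lemma det_det_mx : exists2 c, c != 0 & \det det_mx = c%:MP.
Proof.
exists (\prod_(p < N) \det (rG (enum_val p))).
  by apply/prodf_neq0 => p _; exact: det_repr_neq0.
rewrite det_diag (rmorph_prod (@mpolyC n K)).
by apply: eq_bigr => p _; rewrite mxE.
Qed.

Variable e : 'I_N -> nat.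
Hypothesis be : forall i, b i \is (e i).-homog.
Variable dg : 'I_n -> nat.
Hypothesis f_homog : forall i, tnth f i \is (dg i).-homog.

Lemma msize_dhomog d (p : S) : p != 0 -> p \is d.-homog -> msize p = d.+1.
Proof.
move=> p0 hp; have /(dhomog_uniq p0 hp) -> := dhomog_msize hp.
by rewrite prednK // lt0n msize_poly_eq0.
Qed.

Lemma jacobian_homog : J \is (\sum_j (dg j).-1)%N.-homog.
Proof.
by apply: dhomog_det => i j; rewrite mxE; exact: dhomog_mderiv.
Qed.

Lemma phi_mx_homog : \det phi_mx \is (\sum_i e i)%N.-homog.
Proof.
rewrite -det_tr; apply: dhomog_det => i j; rewrite !mxE; exact: act_homog.
Qed.

Lemma det_dual_mx : exists2 c, c != 0 & \det dual_mx = c%:MP.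
Proof.
have J0 := jacobian_neq0 charK f_basic.
have P0 := det_phi_mx_neq0.
have [d d0 dE] := det_det_mx.
have b_span p : exists2 r : 'I_N -> S, forall i, r i \in R & p = \sum_i r i * b i.
  by exists (co p).
have b_free (r : 'I_N -> S) : (forall i, r i \in R) ->
    \sum_i r i * b i = 0 -> forall i, r i = 0.
  move=> rR r0 i; have z : 0 = \sum_i (fun=> 0 : S) i * b i.
    by rewrite big1 // => j _; rewrite mul0r.
  rewrite -(coU rR (esym r0)) (coU (r := fun=> 0) _ z) // => j; exact: rpred0.
have deg : (2 * \sum_i e i = N * \sum_j (dg j).-1)%N.
  apply: (hilbert_degrees (dg_gt0 f_basic f_homog)) => T D DT.
  have := hilbert_count f_basic f_homog be b_span b_free DT.
  have wE d' (a : {ffun 'I_n -> 'I_T}) : weight d' (multinom_of a) = (\sum_j d' j * a j)%N.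
    by apply: eq_bigr => j _; rewrite mnmE.
  move=> h; transitivity #|basis_degree (T := T) dg e D|.
    by apply: eq_card => x; rewrite !inE [RHS]unfold_in wE.
  by rewrite h; apply: eq_card => x; rewrite !inE [LHS]unfold_in wE.
(* Determinant of [Phi *m Psi = J%:M] with [Psi] written through [Phi^T]. By [deg], [J ^+ N] and the
   square of [\det phi_mx] have the same degree, which leaves size 1 for the other factor. *)
have eqn : \det phi_mx ^+ 2 * (\det dual_mx * d%:MP) = J ^+ N.
  have := congr1 determinant phi_psi_mx; rewrite det_mulmx det_scalar psi_mxE.
  rewrite !det_mulmx !det_tr dE => <-; ring.
have h1 : J ^+ N \is ((\sum_i e i) * 2)%N.-homog.
  by rewrite mulnC deg mulnC; apply: dhomogMn; exact: jacobian_homog.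
have h2 : \det phi_mx ^+ 2 \is ((\sum_i e i) * 2)%N.-homog by apply/dhomogMn/phi_mx_homog.
have X0 : \det dual_mx * d%:MP != 0.
  by apply: contraNneq (expf_neq0 N J0) => X0; rewrite -eqn X0 mulr0.
have := msizeM (expf_neq0 2 P0) X0; rewrite eqn.
rewrite (msize_dhomog (expf_neq0 N J0) h1) (msize_dhomog (expf_neq0 2 P0) h2) addSn /= => sz.
have /msize_poly1P[c c0 cE] : msize (\det dual_mx * d%:MP) == 1%N.
  by apply/eqP; move: sz; set z := msize _; set s := (\sum_i e i)%N; lia.
exists (c / d); first by rewrite mulf_neq0 ?invr_neq0.
by rewrite mpolyCM -cE -mulrA -mpolyCM divff // mulr1.
Qed.

Lemma dual_mx_unit : dual_mx \in unitmx.
Proof.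
have [c c0 cE] := det_dual_mx; rewrite unitmxE cE.
by apply/unitrPr; exists (c^-1)%:MP; rewrite -mpolyCM divff.
Qed.

Lemma det_phi_mx_sqr : exists2 c, c != 0 & c *: \det phi_mx ^+ 2 = J ^+ N.
Proof.
have [c c0 cE] := det_dual_mx; have [d d0 dE] := det_det_mx.
exists (c * d); first by rewrite mulf_neq0.
have := congr1 determinant phi_psi_mx; rewrite det_mulmx det_scalar psi_mxE.
rewrite !det_mulmx !det_tr dE cE -mul_mpolyC mpolyCM => <-; ring.
Qed.

End MatrixFactorization.

Lemma linear_at0 (A : nzRingType) (V W : lmodType A) (h : V -> W) : linear h -> h 0 = 0.
Proof. by move=> hl; apply: (addrI (h 0)); have := hl 1 0 0; rewrite !scale1r !addr0. Qed.

Lemma sub_mod_valP (A : nzRingType) (V : lmodType A) (U : submodClosed V) a (x y : sub_mod U) :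
  val (a *: x + y) = a *: val x + val y.
Proof. by []. Qed.

Lemma sub_mod_iso (A : comNzRingType) (V W : lmodType A) (U : submodClosed V) (U' : submodClosed W)
    (D : V -> W) :
    linear D -> (forall x, x \in U -> D x \in U') ->
    {in U &, injective D} -> (forall y, y \in U' -> exists2 x, x \in U & D x = y) ->
  lmod_iso (sub_mod U) (sub_mod U').
Proof.
move=> Dl DU Dinj Dsurj.
have mem (T : lmodType A) (X : submodClosed T) (x : sub_mod X) : val x \in X := valP x.
pose F (x : sub_mod U) : sub_mod U' := SubMod (DU _ (mem _ _ x)).
have Fl : linear F.
  by move=> a x y; apply: val_inj; rewrite sub_mod_valP -[LHS]/(D (val (a *: x + y))) sub_mod_valP; exact: Dl.
exists (HB.pack_for {linear sub_mod U -> sub_mod U'} F (GRing.isLinear.Build _ _ _ _ F Fl)).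
have /boolp.choice[G GF] (y : sub_mod U') : exists x, F x = y.
  have [x xU xy] := Dsurj (val y) (mem _ _ y).
  by exists (SubMod (xU : x \in submod_pred U)); apply: val_inj.
exists G => [x|y]; last exact: GF.
apply: val_inj; apply: Dinj; rewrite ?mem //; exact: (congr1 (fun z : sub_mod U' => val z) (GF (F x))).
Qed.

Lemma linear_sum_scale (A : nzRingType) (V W : lmodType A) (h : V -> W) (I : finType)
    (a : I -> A) (v : I -> V) :
  linear h -> h (\sum_i a i *: v i) = \sum_i a i *: h (v i).
Proof.
move=> hl; elim/big_rec2: _ => [|i x y _ <-]; last exact: hl.
exact: linear_at0.
Qed.

Lemma transpose_change (R : comUnitRingType) m (A C D M P P0 Q Q0 : 'M[R]_m) :
    A \in unitmx -> C *m P = P0 *m A -> A *m Q = Q0 *m C -> Q0 = M^T *m P0^T *m D ->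
  Q = (invmx A *m M^T *m (invmx A)^T) *m P^T *m (C^T *m D *m C).
Proof.
move=> uA e1 e2 e3; have -> : Q = invmx A *m (Q0 *m C) by rewrite -e2 mulKmx.
have -> : Q0 = M^T *m (C *m P *m invmx A)^T *m D.
  by rewrite e1 -[P0 *m A *m _]mulmxA mulmxV // mulmx1.
by rewrite !trmx_mul !mulmxA.
Qed.

Lemma mpolyC_scaleK (K : fieldType) n (V : lmodType {mpoly K[n]}) (c : K) (x : V) :
  c != 0 -> c%:MP *: (c^-1%:MP *: x) = x.
Proof. by move=> c0; rewrite scalerA -mpolyCM divff // scale1r. Qed.

Lemma mpolyC_scaleVK (K : fieldType) n (V : lmodType {mpoly K[n]}) (c : K) (x : V) :
  c != 0 -> c^-1%:MP *: (c%:MP *: x) = x.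
Proof. by move=> c0; rewrite scalerA -mpolyCM mulVf // scale1r. Qed.

Lemma scaler_lincomb (A : comNzRingType) (V : lmodType A) (a c : A) (x y : V) :
  c *: (a *: x + y) = a *: (c *: x) + c *: y.
Proof. by rewrite scalerDr !scalerA mulrC. Qed.

Lemma ffun_comb_linear (A : comNzRingType) (V : lmodType A) (I : finType) (w : I -> V) :
  linear (fun h : {ffun I -> A^o} => \sum_i (h i : A) *: w i).
Proof.
move=> a x y; rewrite scaler_sumr -big_split; apply: eq_bigr => i _.
by rewrite !ffunE scalerDl scalerA.
Qed.

(** * The factorization in arbitrary bases and the dual of the cokernel *)

Section CokernelDuality.
Variables (K : fieldType) (gT : finGroupType) (n : nat).
Variable rG : mx_representation K [set: gT] n.
Local Notation S := {mpoly K[n]}.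
Local Notation act := (Defs.act rG).
Local Notation R := (inv_pred rG).
Local Notation N := #|gT|.
Hypothesis charK : [pchar K] =i pred0.
Variable f : n.-tuple S.
Hypothesis f_basic : basic_invariants rG f.
Local Notation J := (jacobian f).
Variables (b : 'I_N -> S) (co : S -> 'I_N -> S).
Hypothesis coR : forall p i, co p i \in R.
Hypothesis coE : forall p, p = \sum_i co p i * b i.
Hypothesis coU : forall p (r : 'I_N -> S), (forall i, r i \in R) -> p = \sum_i r i * b i ->
  forall i, co p i = r i.
Variable u : 'I_N -> S.
Hypothesis b_dual_u : forall h, \sum_i act h (b i) * u i = J *+ (h == 1%g).
Hypothesis dual_unit : dual_mx co u \in unitmx.
Variable psi : {linear {ffun gT -> S^o} -> tensSS rG}.
Hypothesis phi_psi : forall h, phi (psi h) = jacobian f *: h.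

Local Notation Phi := (phi_mx rG b).
Local Notation Psi := (psi_mx rG u).
Local Notation std := (fun p : 'I_N => mdelta K n (enum_val p)).

Lemma sum_enum (V : nmodType) (F : gT -> V) : \sum_g F g = \sum_(p < N) F (enum_val p).
Proof. by rewrite (reindex (@enum_val _ (mem gT))) //=; apply: onW_bij; exact: enum_val_bij. Qed.

Lemma mdelta_basis : is_basis std.
Proof.
move=> h; exists (\row_p (h (enum_val p) : S)); split.
  by rewrite {1}(mdelta_sum h) sum_enum; apply: eq_bigr => p _; rewrite mxE.
move=> c /ffunP hc; apply/rowP => p; rewrite mxE hc sum_ffunE (bigD1 p) //= big1.
  by rewrite !ffunE eqxx addr0 /GRing.scale /= mulr1.
move=> q /negPf qp; rewrite !ffunE (inj_eq enum_val_inj) eq_sym qp /GRing.scale /=.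
by rewrite mulr0.
Qed.

Lemma phi_is_matrix : is_matrix (tens_basis rG b) std (phi (rG := rG)) Phi.
Proof.
move=> i; rewrite {1}(mdelta_sum (phi _)) sum_enum; apply: eq_bigr => p _.
by rewrite mxE [phi _ _]phiE mul1r.
Qed.

(** Both [Psi] and the matrix of [psi] give [J] when multiplied by [Phi], and [Phi] has nonzero
    determinant. *)
Lemma psi_is_matrix : is_matrix std (tens_basis rG b) psi Psi.
Proof.
pose X : 'M[S]_N := \matrix_(i, p) tens_coord co (psi (mdelta K n (enum_val p))) 0 i.
suff -> : Psi = X.
  move=> p; rewrite {1}(tens_coord_sum coR coE coU (psi _)).
  by apply: eq_bigr => i _; rewrite mxE.
apply: (mulmx_det_cancel (det_phi_mx_neq0 charK f_basic b_dual_u)).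
rewrite (phi_psi_mx f_basic b_dual_u); apply/matrixP => p q; rewrite !mxE.
have /ffunP/(_ (enum_val p)) := phi_psi (mdelta K n (enum_val q)).
rewrite (phi_coord coR coE coU) !ffunE (inj_eq enum_val_inj) => e; rewrite -mulr_natr -[LHS]e.
by apply: eq_bigr => i _; rewrite !mxE mulrC.
Qed.

Theorem psi_transpose (b' : 'I_N -> tensSS rG) (c' : 'I_N -> {ffun gT -> S^o}) (Phi' Psi' : 'M[S]_N) :
  is_basis b' -> is_basis c' ->
  is_matrix b' c' (phi (rG := rG)) Phi' -> is_matrix c' b' psi Psi' ->
  exists P Q : 'M[S]_N, [/\ P \in unitmx, Q \in unitmx & Psi' = P *m Phi'^T *m Q].
Proof.
move=> hb hc hPhi hPsi.
have hT := tens_basisP coR coE coU.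
have [A uA AE] := basis_change hb hT.
have [C uC CE] := basis_change hc mdelta_basis.
have e1 := is_matrix_change mdelta_basis hPhi phi_is_matrix AE CE.
have e2 := is_matrix_change hT hPsi psi_is_matrix CE AE.
have uD : det_mx rG \in unitmx.
  have [d d0 dE] := det_det_mx rG; rewrite unitmxE dE.
  by apply/unitrPr; exists (d^-1)%:MP; rewrite -mpolyCM divff.
exists (invmx A *m (dual_mx co u)^T *m (invmx A)^T), (C^T *m det_mx rG *m C); split.
- by rewrite !unitmx_mul !unitmx_tr unitmx_inv uA dual_unit.
- by rewrite !unitmx_mul unitmx_tr uC uD.
exact: (transpose_change uA e1 e2 (psi_mxE coR coE u)).
Qed.

(** Determinants of base changes are units of a polynomial ring, that is, nonzero constants. *)
Theorem det_phi (b' : 'I_N -> tensSS rG) (c' : 'I_N -> {ffun gT -> S^o}) (Phi' : 'M[S]_N) :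
  is_basis b' -> is_basis c' -> is_matrix b' c' (phi (rG := rG)) Phi' ->
  exists2 c, c != 0 & \det Phi' = c *: \det Phi.
Proof.
move=> hb hc hPhi.
have hT := tens_basisP coR coE coU.
have [A uA AE] := basis_change hb hT.
have [C uC CE] := basis_change hc mdelta_basis.
have := is_matrix_change mdelta_basis hPhi phi_is_matrix AE CE.
move=> /(congr1 determinant); rewrite !det_mulmx.
have const (x : S) : x \is a GRing.unit -> exists2 c, c != 0 & x = c%:MP.
  move=> /andP[/eqP xE c0]; exists (x@_0%MM) => //.
  by rewrite -unitfE.
have [a a0 ->] : exists2 c, c != 0 & \det A = c%:MP by apply: const; rewrite -unitmxE.
have [c c0 ->] : exists2 c, c != 0 & \det C = c%:MP by apply: const; rewrite -unitmxE.
move=> e; exists (c^-1 * a); first by rewrite mulf_neq0 ?invr_neq0.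
by rewrite -scalerA -[a *: _]mul_mpolyC [_ * \det Phi]mulrC -e mul_mpolyC scalerA mulVf // scale1r.
Qed.

(** The image of [Phi] consists of the vectors whose product with [Psi] is divisible by [J]. As
    [Psi] is [M^T Phi^T D] and [M] is invertible, this can be tested on [Phi^T D] alone, and that
    product is the displayed sum. *)
Lemma phi_image (h : {ffun gT -> S^o}) :
  (exists t : tensSS rG, h = phi t) <->
  forall i, mpdvd J (\sum_g (\det (rG g))%:MP * act g (b i) * (h g : S)).
Proof.
have J0 := jacobian_neq0 charK f_basic.
pose H : 'cV[S]_N := \col_p (h (enum_val p) : S).
have sumE i : \sum_g (\det (rG g))%:MP * act g (b i) * (h g : S) = (Phi^T *m det_mx rG *m H) i 0.
  rewrite sum_enum !mxE; apply: eq_bigr => p _; rewrite !mxE (bigD1 p) //= big1.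
    by rewrite !mxE eqxx mulr1n addr0 [_ * act _ _]mulrC.
  by move=> q /negPf qp; rewrite !mxE qp mulr0n mulr0.
have PsiH : Psi *m H = (dual_mx co u)^T *m (Phi^T *m det_mx rG *m H).
  by rewrite (psi_mxE coR coE) !mulmxA.
split=> [[t tE] i|/boolp.choice[y yE]].
  pose Y : 'cV[S]_N := (tens_coord co t)^T.
  have HY : H = Phi *m Y.
    apply/colP => p; rewrite !mxE tE (phi_coord coR coE coU).
    by apply: eq_bigr => j _; rewrite !mxE mulrC.
  have := PsiH; rewrite {1}HY mulmxA (psi_phi_mx charK f_basic b_dual_u) mul_scalar_mx.
  move=> /(congr1 (mulmx (invmx (dual_mx co u)^T))); rewrite mulKmx ?unitmx_tr //.
  rewrite sumE => <-; rewrite -scalemxAr mxE.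
  by rewrite mulrC; eexists.
pose Y : 'cV[S]_N := \col_i y i.
have hY : Phi^T *m det_mx rG *m H = J *: Y.
  by apply/colP => i; rewrite -sumE yE !mxE mulrC.
have HE : H = Phi *m ((dual_mx co u)^T *m Y).
  have : Phi *m (Psi *m H) = J *: H.
    by rewrite mulmxA (phi_psi_mx f_basic b_dual_u) mul_scalar_mx.
  rewrite PsiH hY -!scalemxAr => e; apply/colP => p; apply: (mulfI J0).
  by move/colP: e => /(_ p); rewrite !mxE.
exists (\sum_i ((dual_mx co u)^T *m Y) i 0 *: tens_basis rG b i).
apply/ffunP => g; rewrite raddf_sum sum_ffunE.
move/colP: HE => /(_ (enum_rank g)); rewrite [in LHS]mxE enum_rankK => ->.
rewrite [LHS]mxE; apply: eq_bigr => i _; rewrite /= linearZ ffunE /= [phi _ _]phiE mul1r mxE.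
by rewrite enum_rankK /GRing.scale /= mulrC.
Qed.

Lemma tens_linear_eq0 (W : lmodType S) (L : tensSS rG -> W) :
  linear L -> (forall i, L (tens_basis rG b i) = 0) -> forall t, L t = 0.
Proof.
move=> Ll L0 t; have tE := tens_coord_sum coR coE coU t.
rewrite [in LHS]tE; have E := linear_sum_scale (fun i => tens_coord co t 0 i) (tens_basis rG b) Ll.
refine (eq_trans _ (eq_trans E _)); first reflexivity.
by rewrite big1 // => i _; rewrite L0 scaler0.
Qed.

(** * The duality for any surjections with the kernels of the two quotient maps *)

Section AbstractSyzygy.
Variables (M W : lmodType S) (P : {ffun gT -> S^o} -> M) (pi : S -> W).
Hypothesis P_lin : linear P.
Hypothesis P_surj : forall w, exists h, P h = w.
Hypothesis P_eq : forall h h', P h = P h' <-> exists t : tensSS rG, h - h' = phi t.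
Hypothesis pi_lin : forall a x y, pi (a * x + y) = a *: pi x + pi y.
Hypothesis pi_surj : forall w, exists x, pi x = w.
Hypothesis pi_eq : forall x y, pi x = pi y <-> mpdvd J (x - y).

Let pi0 : pi 0 = 0.
Proof. exact: (linear_at0 (V := S^o) pi_lin). Qed.

Let pi_sum (a x : gT -> S) : pi (\sum_g a g * x g) = \sum_g a g *: pi (x g).
Proof. exact: (linear_sum_scale (V := S^o) a x pi_lin). Qed.

Let dg (g : gT) : K := \det (rG g).

Let dg0 g : dg g != 0.
Proof. exact: det_repr_neq0. Qed.

Let phiT i g : phi (tens_basis rG b i) g = act g (b i).
Proof. by rewrite [LHS]phiE mul1r. Qed.

(** Multiples of [J] lie in the image of [phi], because [phi (psi w)] is [J *: w]. *)
Let P_pi (h h' : {ffun gT -> S^o}) : (forall g, pi (h g) = pi (h' g)) -> P h = P h'.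
Proof.
move=> hh; apply/P_eq.
have /boolp.choice[w wE] g : mpdvd J ((h g : S) - h' g) by apply/pi_eq.
exists (psi [ffun g => w g]); rewrite phi_psi; apply/ffunP => g.
by rewrite !ffunE wE /GRing.scale /= mulrC.
Qed.

Let theta_expand (th : M -> W) (h : {ffun gT -> S^o}) : linear th ->
  th (P h) = \sum_g (h g : S) *: th (P (mdelta K n g)).
Proof.
move=> thl; have hl : linear (fun h : {ffun gT -> S^o} => th (P h)).
  by move=> a x y; rewrite P_lin thl.
by rewrite [in LHS](mdelta_sum h) (linear_sum_scale _ _ hl).
Qed.

Let lift_image (y : gT -> W) (s : gT -> S) : (forall g, pi (s g) = y g) ->
  (exists t : tensSS rG, [ffun g => s g : S^o] = phi t) <->
  forall i, \sum_g act g (b i) *: ((dg g)%:MP *: y g) = 0.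
Proof.
move=> sE; have e i : \sum_g act g (b i) *: ((dg g)%:MP *: y g) =
    pi (\sum_g (dg g)%:MP * act g (b i) * ([ffun g => s g : S^o] g : S)).
  rewrite pi_sum; apply: eq_bigr => g _.
  by rewrite ffunE sE scalerA mulrC.
split=> [/phi_image h i|h].
  by rewrite e -pi0; apply/pi_eq; rewrite subr0.
by apply/phi_image => i; rewrite -[\sum_g _]subr0; apply/pi_eq; rewrite pi0 -e h.
Qed.

Definition syzygy_duality : Prop :=
  exists q : {linear {ffun gT -> W} -> M},
    (forall h : {ffun gT -> S^o}, q [ffun g => pi (h g)] = P h) /\
    lmod_iso (hom_mod M W) (kernel q).

(** A linear [th] is determined by its values on the [delta_g], and a family of values is admissible
    exactly when it annihilates the image of [phi], that is, [\sum_g g(b_i) th(delta_g) = 0] for all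
    [i]. Divided by [det g], such families satisfy the criterion of [phi_image] read modulo [J],
    which describes the kernel of [q]. *)
Lemma abstract_syzygy : syzygy_duality.
Proof.
have [s sE] := boolp.choice pi_surj.
pose lift (y : {ffun gT -> W}) : {ffun gT -> S^o} := [ffun g => s (y g)].
pose q0 y := P (lift y).
have q0_lin : linear q0.
  move=> a y z; rewrite /q0 -P_lin; apply: P_pi => g.
  rewrite !ffunE sE -[X in pi X]/(a * s (y g) + s (z g)).
  by rewrite pi_lin !sE.
pose q := HB.pack_for {linear {ffun gT -> W} -> M} q0
  (GRing.isLinear.Build _ _ _ _ q0 q0_lin).
have qE (h : {ffun gT -> S^o}) : q [ffun g => pi (h g)] = P h.
  by apply: P_pi => g; rewrite !ffunE sE.
exists q; split=> //.
have kerE y : (y \in ker_pred q) <-> forall i, \sum_g act g (b i) *: ((dg g)%:MP *: y g) = 0.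
  rewrite -(lift_image (y := y) (s := fun g => s (y g))) //.
  have e : q y = P (lift y) by [].
  have := P_eq (lift y) 0; rewrite subr0 (linear_at0 P_lin) -e => h.
  by rewrite unfold_in; split=> [/eqP/h|/h/eqP].
pose D (th : M -> W) : {ffun gT -> W} :=
  [ffun g => (dg g)^-1%:MP *: th (P (mdelta K n g))].
apply: (sub_mod_iso (D := D)) => [a x y|th /boolp.asboolP thl|x y /boolp.asboolP xl /boolp.asboolP yl|y].
- apply/ffunP => g; rewrite !ffunE; exact: scaler_lincomb.
- apply/kerE => i; under eq_bigr => g _ do rewrite ffunE mpolyC_scaleK //.
  have z : P (phi (tens_basis rG b i)) = 0.
    by rewrite -(linear_at0 P_lin); apply/P_eq; rewrite subr0; eexists.
  have := theta_expand (phi (tens_basis rG b i)) thl.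
  rewrite z (linear_at0 thl) => e; rewrite [RHS]e; apply: eq_bigr => g _.
  by rewrite phiT.
- move=> /ffunP e; apply: boolp.funext => w; have [h <-] := P_surj w.
  rewrite !theta_expand //.
  apply: eq_bigr => g _; congr (_ *: _); have := e g; rewrite !ffunE.
  by move=> /(congr1 (fun z => (dg g)%:MP *: z)); rewrite !mpolyC_scaleK.
move=> /kerE hy.
(* The preimage of [y]: prescribe the values on the [delta_g], extend linearly, and descend through
   [P] because the image of [phi] is killed. *)
pose T0 (h : {ffun gT -> S^o}) : W := \sum_g (h g : S) *: ((dg g)%:MP *: y g).
have T0l : linear T0 := ffun_comb_linear _.
have T0phi (t : tensSS rG) : T0 (phi t) = 0.
  have hl : linear (fun t : tensSS rG => T0 (phi t)).
    by move=> a x z; rewrite -T0l; congr T0; exact: linearP.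
  refine (@tens_linear_eq0 W (fun t => T0 (phi t)) hl _ t) => i.
  by rewrite -[RHS](hy i); apply: eq_bigr => g _; rewrite phiT.
have [rep repE] := boolp.choice P_surj.
have T0rep h : T0 (rep (P h)) = T0 h.
  have /P_eq[t tE] := repE (P h).
  apply/eqP; rewrite -subr_eq0 -[_ - _]addrC -scaleN1r -T0l scaleN1r addrC tE T0phi.
  by [].
exists (fun w => T0 (rep w)).
  apply/boolp.asboolP => a w w'; have [h <-] := P_surj w; have [h' <-] := P_surj w'.
  by rewrite -P_lin !T0rep T0l.
apply/ffunP => g; rewrite ffunE T0rep /T0 (bigD1 g) //= big1 => [|l /negPf lg].
  by rewrite ffunE eqxx scale1r addr0 mpolyC_scaleVK.
by rewrite ffunE lg scale0r.
Qed.

End AbstractSyzygy.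

Lemma skew_pi_linear : linear (skew_pi rG).
Proof. by move=> a x y; rewrite /skew_pi linearP. Qed.

Lemma skew_pi_eq (h h' : {ffun gT -> S^o}) :
  skew_pi rG h = skew_pi rG h' <-> exists t : tensSS rG, h - h' = phi t.
Proof.
have hc := phi_coker rG (card_neq0 gT charK) (h - h').
split=> [/quot_piP h1|/hc h1]; last exact/quot_piP.
exact: (hc.1 h1).
Qed.

Lemma skew_pi_surj w : exists h, skew_pi rG h = w.
Proof. by elim/quot_piW: w => h; exists h. Qed.

Theorem hom_syzygy :
  exists q : {linear {ffun gT -> quot_principal J} -> skew_quot rG},
    (forall h : {ffun gT -> S^o},
       q [ffun g => quot_pi (principal_pred J) (h g)] = skew_pi rG h) /\
    lmod_iso (hom_mod (skew_quot rG) (quot_principal J)) (kernel q).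
Proof.
have pl a (x y : S) : quot_pi (principal_pred J) (a * x + y) =
    a *: quot_pi (principal_pred J) x + quot_pi (principal_pred J) y.
  exact: (linearP (quot_pi (principal_pred J)) a x y).
have ps : forall w : quot_principal J, exists x, quot_pi (principal_pred J) x = w.
  by elim/quot_piW => v; exists v.
have pe (x y : S) : quot_pi (principal_pred J) x = quot_pi (principal_pred J) y <-> mpdvd J (x - y).
  by split=> [/quot_piP/boolp.asboolP //|h]; apply/quot_piP; exact/boolp.asboolP.
change (syzygy_duality (skew_pi rG) (quot_pi (principal_pred J))).
exact: (abstract_syzygy skew_pi_linear skew_pi_surj skew_pi_eq pl ps pe).
Qed.

End CokernelDuality.

(** * Mirrors and the Jacobian *)

(** Matrix determinant lemma: the same two block matrices are multiplied in both orders. *)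
Lemma det_rank1_update (R : comNzRingType) n (a : 'cV[R]_n) (b : 'rV[R]_n) :
  \det (1%:M + a *m b) = 1 + (b *m a) 0 0.
Proof.
have e1 : block_mx 1%:M (- b) a 1%:M *m block_mx 1%:M b 0 1%:M
          = block_mx 1%:M 0 a (1%:M + a *m b) :> 'M[R]_(1 + n).
  rewrite mulmx_block !mul1mx !mulmx1 !mulmx0 !addr0 [_ + - b]addrC addNr.
  by rewrite [a *m b + _]addrC.
have e2 : block_mx 1%:M b 0 1%:M *m block_mx 1%:M (- b) a 1%:M
          = block_mx (1%:M + b *m a) 0 a 1%:M :> 'M[R]_(1 + n).
  by rewrite mulmx_block !mul1mx !mulmx1 !mul0mx !add0r addNr.
have := congr1 determinant e1; rewrite det_mulmx mulrC -det_mulmx e2.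
rewrite !det_lblock !det1 mulr1 mul1r => <-.
by rewrite [1%:M + _]mx11_scalar det_scalar1 !mxE.
Qed.

Lemma mulmx_rank1 (R : comNzRingType) n (a a' : 'cV[R]_n) (b b' : 'rV[R]_n) :
  (a *m b) *m (a' *m b') = (b *m a') 0 0 *: (a *m b').
Proof.
have -> : a *m b *m (a' *m b') = a *m (b *m a') *m b' by rewrite !mulmxA.
by rewrite [b *m a' in LHS]mx11_scalar mul_mx_scalar -scalemxAl.
Qed.

Lemma rank1_commute (R : comNzRingType) n (a a' : 'cV[R]_n) (b b' : 'rV[R]_n) :
    (1%:M + a *m b) *m (1%:M + a' *m b') = (1%:M + a' *m b') *m (1%:M + a *m b) ->
  (b *m a') 0 0 *: (a *m b') = (b' *m a) 0 0 *: (a' *m b).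
Proof.
rewrite -!mulmx_rank1 !mulmxDl !mulmxDr !mul1mx !mulmx1 -!addrA => /addrI.
by rewrite [a' *m b' + (_ + _)]addrCA => /addrI/addrI.
Qed.

(** * The pointwise stabilizer of a mirror *)

Section MirrorGeometry.
Variables (K : fieldType) (gT : finGroupType) (n : nat).
Variable rG : mx_representation K [set: gT] n.
Hypothesis charK : [pchar K] =i pred0.
Hypothesis rG_faithful : mx_faithful rG.

Lemma repr_eq1 g : rG g = 1%:M -> g = 1%g.
Proof.
move=> h; have := subsetP rG_faithful g; rewrite inE => /(_ _)/set1P; apply.
by rewrite in_setT mul1mx h eqxx.
Qed.

Lemma repr_inv_mul g : rG g^-1%g *m rG g = 1%:M.
Proof. by rewrite -repr_mxM ?inE // mulVg repr_mx1. Qed.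

(* If the determinant [1 + b a] is 1 then [g] is unipotent of finite order, hence
   trivial in characteristic zero. *)
Lemma rank1_det1 g (a : 'cV[K]_n) (b : 'rV[K]_n) :
  rG g = 1%:M + a *m b -> \det (rG g) = 1 -> g = 1%g.
Proof.
move=> gE; rewrite gE det_rank1_update => /eqP.
rewrite -subr_eq0 addrAC subrr add0r => /eqP ba.
have ba0 : b *m a = 0 by rewrite [b *m a]mx11_scalar ba raddf0.
pose A := a *m b; have AA : A *m A = 0 by rewrite /A -mulmxA (mulmxA b) ba0 mul0mx mulmx0.
have pow k : rG (g ^+ k)%g = 1%:M + A *+ k.
  elim: k => [|k ih]; first by rewrite expg0 repr_mx1 mulr0n addr0.
  rewrite expgS repr_mxM ?inE // ih gE -/A mulmxDl mul1mx mulmxDr mulmx1 mulrS.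
  by rewrite -[A *+ k]scaler_nat -scalemxAr AA scaler0 addr0 -addrA [_ + A]addrC.
have := pow #[g]%g; rewrite expg_order repr_mx1 => /eqP.
rewrite -subr_eq0 opprD addrA subrr add0r oppr_eq0 -scaler_nat scaler_eq0.
rewrite (pcharf0P _).1 // (gtn_eqF (order_gt0 g)) /= => /eqP ab0.
by apply: repr_eq1; rewrite gE -/A ab0 addr0.
Qed.

(** Commutators have determinant 1. *)
Lemma commute_of_det (A : {set gT}) g h : group_set A ->
    (forall x, x \in A -> \det (rG x) = 1 -> x = 1%g) ->
  g \in A -> h \in A -> rG g *m rG h = rG h *m rG g.
Proof.
move=> gA det1 gA' hA; pose B := Group gA.
have comm1 : [~ g, h]%g = 1%g.
  apply: det1; first by rewrite -[A]/(gval B) groupR.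
  rewrite commgEl conjgE !repr_mxM ?inE // !det_mulmx.
  have := congr1 determinant (repr_inv_mul g); have := congr1 determinant (repr_inv_mul h).
  rewrite !det_mulmx det1; set x := \det (rG g); set y := \det (rG h).
  set x' := \det (rG g^-1%g); set y' := \det (rG h^-1%g) => eh eg.
  by transitivity ((x' * x) * (y' * y)); [ring | rewrite eg eh mulr1].
rewrite -!repr_mxM ?inE //; congr (rG _).
by apply/commgP/eqP.
Qed.

Variables (s : gT) (v : 'cV[K]_n) (l : 'rV[K]_n).
Hypothesis sE : rG s = 1%:M + v *m l.
Hypothesis s1 : s != 1%g.

Lemma root_pairing_neq0 : (l *m v) 0 0 != 0.
Proof.
apply: contra_neq s1 => lv; apply: (rank1_det1 sE).
by rewrite sE det_rank1_update lv addr0.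
Qed.

Lemma root_neq0 : v != 0.
Proof. by apply: contraNneq root_pairing_neq0 => ->; rewrite mulmx0 mxE. Qed.

Lemma coroot_neq0 : l != 0.
Proof. by apply: contraNneq root_pairing_neq0 => ->; rewrite mul0mx mxE. Qed.

(** Equality of matrices, not of row spaces, makes this the pointwise stabilizer; its cardinality is
    [ramif] of the mirror. *)
Definition fixer : {set gT} := [set g | mirror rG s *m (rG g)^T == mirror rG s].

Lemma mirror_kernel m (X : 'M[K]_(m, n)) : (X <= mirror rG s)%MS = (X *m l^T == 0).
Proof.
rewrite /mirror genmxE; apply/eigenspaceP/eqP; rewrite scale1r sE linearD /= trmx1 trmx_mul.
  rewrite mulmxDr mulmx1 mulmxA => /(canRL (addKr X)); rewrite addNr => h.
  have := congr1 (mulmx^~ l^T) h; rewrite mul0mx -mulmxA -trmx_mul [l *m v]mx11_scalar.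
  rewrite tr_scalar_mx mul_mx_scalar => /eqP; rewrite scaler_eq0.
  by rewrite (negPf root_pairing_neq0) => /eqP.
by move=> h; rewrite mulmxDr mulmx1 mulmxA h mul0mx addr0.
Qed.

Lemma fixerP g : reflect (exists w : 'cV[K]_n, rG g = 1%:M + w *m l) (g \in fixer).
Proof.
rewrite inE; apply: (iffP eqP) => [h|[w ->]]; last first.
  rewrite linearD /= trmx1 trmx_mul mulmxDr mulmx1 mulmxA.
  have /eqP -> : mirror rG s *m l^T == 0 by rewrite -mirror_kernel.
  by rewrite mul0mx addr0.
(* Normalized so that [l] takes the value 1 at [y]; then [1 - y l] is the projection onto the mirror
   along the root, and [g - 1] is determined by its value at [y]. *)
pose y := ((l *m v) 0 0)^-1 *: v.
have ly : l *m y = 1%:M.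
  rewrite -scalemxAr; have /esym := mx11_scalar (l *m v).
  by set c := (l *m v) 0 0 => <-; rewrite scale_scalar_mx mulVf ?root_pairing_neq0.
pose B := (rG g - 1%:M)^T; have HB : mirror rG s *m B = 0.
  by rewrite /B linearB /= trmx1 mulmxBr mulmx1 h subrr.
have /submxP[D DE] : (1%:M - l^T *m y^T <= mirror rG s)%MS.
  by rewrite mirror_kernel mulmxBl mul1mx -mulmxA -trmx_mul ly trmx1 mulmx1 subrr.
have : (1%:M - l^T *m y^T) *m B = 0 by rewrite DE -mulmxA HB mulmx0.
rewrite mulmxBl mul1mx => /eqP; rewrite subr_eq0 => /eqP BE.
exists (y^T *m B)^T; rewrite -[l]trmxK -trmx_mul mulmxA -BE /B trmxK.
by rewrite addrC subrK.
Qed.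

Lemma fixer_group : group_set fixer.
Proof.
apply/group_setP; split=> [|g h /fixerP[w wE] /fixerP[w' wE']]; apply/fixerP.
  by exists 0; rewrite repr_mx1 mul0mx addr0.
exists (w' + w + (l *m w') 0 0 *: w); rewrite repr_mxM ?inE // wE wE'.
rewrite mulmxDl mul1mx mulmxDr mulmx1 -mulmxA (mulmxA l) [l *m w']mx11_scalar mul_scalar_mx.
by rewrite -scalemxAr !mulmxDl -scalemxAl -!addrA !mxE.
Qed.

Lemma fixer_det1 g : g \in fixer -> \det (rG g) = 1 -> g = 1%g.
Proof. by move=> /fixerP[w wE]; exact: rank1_det1 wE. Qed.

Lemma s_fixer : s \in fixer.
Proof. by apply/fixerP; exists v. Qed.

(** The determinant has trivial kernel on the fixer, so the fixer is commutative; commuting with [s]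
    forces the root of [g] onto the line of [v]. *)
Lemma fixer_root g : g \in fixer -> exists c, rG g = 1%:M + c *: (v *m l).
Proof.
move=> gC; have := commute_of_det fixer_group fixer_det1 gC s_fixer.
have [w wE] := fixerP _ gC; rewrite wE sE => /rank1_commute e.
exists ((l *m w) 0 0 / (l *m v) 0 0); congr (_ + _).
by rewrite mulrC -scalerA -e scalerA mulVf ?root_pairing_neq0 // scale1r.
Qed.

(** The dual argument: the elements whose [g - 1] has image in the line of [v] also form a group on
    which the determinant has trivial kernel, and commuting with [s] forces the coroot to be a
    multiple of [l]. *)
Lemma root_fixer g : (exists b : 'rV[K]_n, rG g = 1%:M + v *m b) -> g \in fixer.
Proof.
pose D := [set g | boolp.asbool (exists b : 'rV[K]_n, rG g = 1%:M + v *m b)].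
have DP x : reflect (exists b : 'rV[K]_n, rG x = 1%:M + v *m b) (x \in D).
  by rewrite inE; apply: boolp.asboolP.
have gD : group_set D.
  apply/group_setP; split=> [|x y /DP[b bE] /DP[b' bE']]; apply/DP.
    by exists 0; rewrite repr_mx1 mulmx0 addr0.
  exists (b' + b + (b *m v) 0 0 *: b'); rewrite repr_mxM ?inE // bE bE'.
  rewrite mulmxDl mul1mx mulmxDr mulmx1 -mulmxA (mulmxA b) [b *m v]mx11_scalar mul_scalar_mx.
  by rewrite !mulmxDr -!addrA !mxE.
have det1 x : x \in D -> \det (rG x) = 1 -> x = 1%g.
  by move=> /DP[b bE]; exact: rank1_det1 bE.
move=> /DP xD; have sD : s \in D by apply/DP; exists l.
have := commute_of_det gD det1 xD sD; have [b bE] := DP _ xD; rewrite bE sE => /rank1_commute e.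
apply/fixerP; exists ((b *m v) 0 0 / (l *m v) 0 0 *: v); rewrite bE; congr (_ + _).
by rewrite -scalemxAl mulrC -scalerA e scalerA mulVf ?root_pairing_neq0 // scale1r.
Qed.

End MirrorGeometry.

(** * Orders of vanishing along one mirror *)

Section MirrorValuation.
Variables (K : fieldType) (gT : finGroupType) (n : nat).
Variable rG : mx_representation K [set: gT] n.
Local Notation S := {mpoly K[n]}.
Local Notation act := (Defs.act rG).
Hypothesis charK : [pchar K] =i pred0.
Hypothesis rG_faithful : mx_faithful rG.
Variables (s : gT) (v : 'cV[K]_n) (l : 'rV[K]_n).
Hypothesis sE : rG s = 1%:M + v *m l.
Hypothesis s1 : s != 1%g.
Local Notation L := (lin_form v).
Local Notation C := (fixer rG s).

Let v0 : v != 0.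
Proof. exact: (root_neq0 charK rG_faithful sE s1). Qed.

Lemma fixer_dvd g (p : S) : g \in C -> mpdvd L (act g p - p).
Proof.
move=> /(fixer_root charK rG_faithful sE s1)[c gE]; apply: (act_dvd v0) => w.
exists (c * (l *m w) 0 0); rewrite gE mulmxDl mul1mx addrAC subrr add0r.
by rewrite -scalemxAl -mulmxA [l *m w in LHS]mx11_scalar mul_mx_scalar scalerA.
Qed.

Lemma fixer_act_root g : g \in C -> act g L = \det (rG g) *: L.
Proof.
move=> /(fixer_root charK rG_faithful sE s1)[c gE]; rewrite act_lin -lin_formZ; congr lin_form.
rewrite gE mulmxDl mul1mx scalemxAl det_rank1_update scalerDl scale1r; congr (_ + _).
by rewrite -mulmxA -scalemxAl [l *m v in LHS]mx11_scalar mul_mx_scalar scalerA -scalemxAr [in RHS]mxE.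
Qed.

(** After division by [L ^+ m] the equation is reduced modulo [L], where [g] acts trivially; only
    the factor [det g] by which [g] scales [L] remains. *)
Lemma semi_invariant_mult g (p p' : S) m c : g \in C ->
  act g p = c *: p -> p = L ^+ m * p' -> ~ mpdvd L p' -> c = \det (rG g) ^+ m.
Proof.
move=> gC gp pE Lp'; have L0 : (L : S) ^+ m != 0 by rewrite expf_neq0 // lin_form_eq0.
have e : c *: p' = \det (rG g) ^+ m *: act g p'.
  apply: (mulfI L0); rewrite -scalerAr -pE -gp pE rmorphM rmorphXn /= fixer_act_root //.
  by rewrite exprZn -scalerAl scalerAr.
have [sg [sgZ sgP]] := lin_form_elim v0.
have sg_p' : sg (act g p') = sg p' by apply/sgP; exact: fixer_dvd.
have p'0 : sg p' != 0.
  apply/eqP => h; apply: Lp'; rewrite -[p']subr0; apply/sgP.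
  by rewrite h rmorph0.
have := congr1 sg e; rewrite !sgZ sg_p' => /eqP.
by rewrite -subr_eq0 -scalerBl scaler_eq0 (negPf p'0) orbF subr_eq0 => /eqP.
Qed.

(** The determinant embeds the fixer into the multiplicative group of [K], so it is cyclic, and the
    hypothesis is applied to a generator. *)
Lemma fixer_order_dvd m : (forall g, g \in C -> \det (rG g) ^+ m = 1) -> (#|C| %| m)%N.
Proof.
move=> h; pose CG := Group (fixer_group charK rG_faithful sE s1).
have detM : {in CG &, {morph (fun g => \det (rG g)) : x y / (x * y)%g >-> x * y}}.
  by move=> x y _ _; rewrite repr_mxM ?inE // det_mulmx.
have detC1 : {in CG, forall x, \det (rG x) = 1 <-> x = 1%g}.
  move=> x xC; split=> [|->]; last by rewrite repr_mx1 det1.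
  exact: (fixer_det1 charK rG_faithful sE s1).
have /cyclicP[t tE] := field_mul_group_cyclic detM detC1.
have tC : t \in CG by rewrite tE cycle_id.
have tmC : (t ^+ m)%g \in CG by rewrite groupX.
have powt k : \det (rG (t ^+ k)%g) = \det (rG t) ^+ k.
  elim: k => [|k ih]; first by rewrite expg0 repr_mx1 det1 expr0.
  by rewrite expgS exprS repr_mxM ?inE // det_mulmx ih.
have : (t ^+ m == 1)%g.
  apply/eqP/(fixer_det1 charK rG_faithful sE s1); first exact: tmC.
  by rewrite powt; apply: h.
by rewrite -order_dvdn /order -tE.
Qed.

Lemma act_sub_X g j : act g 'X_j - 'X_j = lin_form (col j (rG g - 1%:M)) :> S.
Proof. by rewrite Defs.actX -[in X in _ - X](lin_formX K j) -lin_formB colE mulmxBl mul1mx. Qed.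

(** Otherwise every column of [g - 1] lies on the line of [v], and [root_fixer] applies. *)
Lemma separated_variable g : g \notin C -> exists j, ~ mpdvd L (act g 'X_j - 'X_j).
Proof.
move=> gC; apply: boolp.contrapT => h; case/negP: gC.
have /boolp.choice[b bE] j : exists c : K, col j (rG g - 1%:M) = c *: v.
  have : mpdvd L (act g 'X_j - 'X_j).
    by apply: boolp.contrapT => hj; apply: h; exists j.
  rewrite act_sub_X; have [->|w0] := eqVneq (col j (rG g - 1%:M)) 0.
    by exists 0; rewrite scale0r.
  by move=> /(mpdvd_proportional v0 w0)[c _ ->]; exists c.
apply: (root_fixer charK rG_faithful sE s1); exists (\row_j b j).
rewrite addrC -[LHS](subrK 1%:M); congr (_ + _).
apply/matrixP => i j; have /colP/(_ i) := bE j; rewrite mxE => ->.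
by rewrite !mxE big_ord1 !mxE mulrC.
Qed.

Lemma ramified_variable g : g \in C -> g != 1%g ->
  exists j, exists2 c, c != 0 & act g 'X_j - 'X_j = c *: L :> S.
Proof.
move=> /(fixer_root charK rG_faithful sE s1)[c gE] g1.
have c0 : c != 0.
  by apply: contraNneq g1 => c0; apply/eqP/(repr_eq1 rG_faithful); rewrite gE c0 scale0r addr0.
have /cV0Pn[j lj] : l^T != 0.
  by rewrite trmx_eq0; exact: (coroot_neq0 charK rG_faithful sE s1).
exists j, (c * l 0 j); first by rewrite mulf_neq0 //; rewrite mxE in lj.
rewrite act_sub_X gE addrAC subrr add0r -lin_formZ; congr lin_form.
by apply/colP => i; rewrite !mxE big_ord1 mulrA mulrAC -mulrA.
Qed.

(** With well chosen variables, each nontrivial element of the fixer contributes exactly one factor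
    [L], and every other element none. *)
Lemma separating_product : exists j : gT -> 'I_n, exists q : S,
  \prod_(h | h != 1%g) (act h 'X_(j h) - 'X_(j h)) = L ^+ (#|C|.-1) * q /\ ~ mpdvd L q.
Proof.
have /cV0Pn[s0 _] := v0.
have /boolp.choice[j jE] h : exists j,
    h != 1%g -> if h \in C then (exists2 c, c != 0 & act h 'X_j - 'X_j = c *: L :> S)
                else ~ mpdvd L (act h 'X_j - 'X_j).
  have [->|h1] := eqVneq h 1%g; first by exists s0.
  have [hC|/separated_variable[j hj]] := boolP (h \in C); last by exists j.
  by have [j hj] := ramified_variable hC h1; exists j.
pose F h : S := act h 'X_(j h) - 'X_(j h).
have /boolp.choice[c cE] h : exists c : K, h != 1%g -> h \in C -> c != 0 /\ F h = c *: L.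
  have [->|h1] := eqVneq h 1%g; first by exists 0.
  have := jE h h1; case: ifP => // _; last by exists 0.
  by case=> c c0 hE; exists c.
exists j, ((\prod_(h in C :\ 1%g) c h) *: \prod_(h in ~: C) F h); split; last first.
  have c0 : \prod_(h in C :\ 1%g) c h != 0.
    by apply/prodf_neq0 => h /setD1P[h1 hC]; have [] := cE h h1 hC.
  move=> [q /(congr1 (fun p => (\prod_(h in C :\ 1%g) c h)^-1 *: p))].
  rewrite scalerA mulVf // scale1r scalerAl => e.
  have : mpdvd L (\prod_(h in ~: C) F h) by eexists; exact: e.
  rewrite -big_enum => /(lin_form_prime_prod v0)[h]; rewrite mem_enum inE => hC.
  have h1 : h != 1%g.
    apply: contraNneq hC => ->.
    by rewrite -[C]/(gval (Group (fixer_group charK rG_faithful sE s1))) group1.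
  by have := jE h h1; rewrite (negPf hC).
have C1 : 1%g \in C by rewrite -[C]/(gval (Group (fixer_group charK rG_faithful sE s1))) group1.
rewrite (bigID (mem C)) /= -scalerAr scalerAl; congr (_ * _).
  rewrite (eq_bigl (fun h => h \in C :\ 1%g)) => [|h]; last by rewrite !inE.
  rewrite (eq_bigr (fun h => c h *: L)) => [|h /setD1P[h1 hC]]; last first.
    by have [] := cE h h1 hC.
  rewrite scaler_prod prodr_const; congr (_ *: _ ^+ _).
  by rewrite (cardsD1 1%g C) C1.
apply: eq_bigl => h; rewrite in_setC; case hC: (h \in C); rewrite /= ?andbF ?andbT //.
by apply/negP => /eqP h1; rewrite h1 C1 in hC.
Qed.

End MirrorValuation.

(** * The exact order of the Jacobian along a mirror *)

Section JacobianMultiplicity.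
Variables (K : fieldType) (gT : finGroupType) (n : nat).
Variable rG : mx_representation K [set: gT] n.
Local Notation S := {mpoly K[n]}.
Local Notation act := (Defs.act rG).
Local Notation R := (inv_pred rG).
Local Notation N := #|gT|.
Hypothesis charK : [pchar K] =i pred0.
Variable f : n.-tuple S.
Hypothesis f_basic : basic_invariants rG f.
Local Notation J := (jacobian f).
Variables (b : 'I_N -> S) (co : S -> 'I_N -> S).
Hypothesis coR : forall p i, co p i \in R.
Hypothesis coE : forall p, p = \sum_i co p i * b i.
Variable u : 'I_N -> S.
Hypothesis b_dual_u : forall h, \sum_i act h (b i) * u i = J *+ (h == 1%g).
Hypothesis dual_unit : dual_mx co u \in unitmx.

Lemma dual_span p : exists a : 'I_N -> S, p = \sum_i a i * u i.
Proof.
pose a : 'cV[S]_N := invmx (dual_mx co u) *m \col_j co p j.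
exists (fun i => a i 0); rewrite {1}(coE p).
have aE : dual_mx co u *m a = \col_j co p j by rewrite mulKVmx.
transitivity (\sum_j (dual_mx co u *m a) j 0 * b j).
  by apply: eq_bigr => j _; rewrite aE mxE.
under eq_bigr => j _ do rewrite mxE mulr_suml.
rewrite exchange_big; apply: eq_bigr => i _ /=.
rewrite [in RHS](coE (u i)) mulr_sumr; apply: eq_bigr => j _.
by rewrite mxE mulrCA mulrA mulrAC.
Qed.

(* The functions [g |-> \sum a g(p)] form the image of [phi]; they are closed under
   products, so that products of [h x_j - g x_j] interpolate the group. *)
Lemma separating_interpolation (j : gT -> 'I_n) (D : {set gT}) :
  exists w : 'I_N -> S, forall g,
    \sum_i w i * act g (b i) = \prod_(h in D) (act h 'X_(j h) - act g 'X_(j h)).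
Proof.
pose im (F : gT -> S) := exists t : seq (S * S), forall g, F g = \sum_(p <- t) p.1 * act g p.2.
have imM F F' : im F -> im F' -> im (fun g => F g * F' g).
  move=> [t tE] [t' tE']; exists [seq (p.1 * q.1, p.2 * q.2) | p <- t, q <- t'] => g.
  rewrite tE tE' big_allpairs_dep mulr_suml; apply: eq_bigr => p _.
  by rewrite mulr_sumr; apply: eq_bigr => q _; rewrite /= rmorphM /=; ring.
have [t tE] : im (fun g => \prod_(h <- enum D) (act h 'X_(j h) - act g 'X_(j h))).
  elim: (enum D) => [|h D' ih].
    by exists [:: (1, 1)] => g; rewrite big_nil big_seq1 /= rmorph1 mulr1.
  have im1 : im (fun g => act h 'X_(j h) - act g 'X_(j h)).
    exists [:: (act h 'X_(j h), 1); (-1, 'X_(j h))] => g.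
    by rewrite big_cons big_seq1 /= rmorph1 mulr1 mulN1r.
  by have [t tE] := imM _ _ im1 ih; exists t => g; rewrite big_cons tE.
exists (fun i => \sum_(p <- t) p.1 * co p.2 i) => g; rewrite -[RHS]big_enum /= tE.
under eq_bigr => i _ do rewrite mulr_suml.
rewrite exchange_big; apply: eq_bigr => p _ /=.
rewrite [in RHS](coE p.2) rmorph_sum mulr_sumr; apply: eq_bigr => i _.
by rewrite rmorphM /= (invP _ _ (coR _ _)) mulrA.
Qed.

(** The interpolating family [w] satisfies the duality relation with the product [Q] in place of
    [J], so [J w_i = Q u_i] by injectivity of [Phi]. Since [M] is invertible, 1 is a combination of
    the [u_i], and [J] divides [Q]. *)
Lemma jacobian_dvd_separating (j : gT -> 'I_n) :
  mpdvd J (\prod_(h | h != 1%g) (act h 'X_(j h) - 'X_(j h))).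
Proof.
set Q := \prod_(h | _) _.
have [w wE] := separating_interpolation j [set h | h != 1%g].
have wE1 g : \sum_i act g (b i) * w i = Q *+ (g == 1%g).
  rewrite (eq_bigr (fun i => w i * act g (b i))) => [|i _]; last by rewrite mulrC.
  rewrite wE; have [->|g1] := eqVneq g 1%g.
    by rewrite mulr1n; apply: eq_big => [h|h _]; rewrite ?inE // Defs.act1.
  by rewrite (bigD1 g) ?inE //= subrr mul0r.
have Jw i : J * w i = Q * u i.
  pose W : 'cV[S]_N := J *: \col_i w i; pose U : 'cV[S]_N := Q *: \col_i u i.
  suff /colP/(_ i) : W = U by rewrite !mxE.
  apply: (mulmx_det_cancel (det_phi_mx_neq0 charK f_basic b_dual_u)); apply/colP => p.
  rewrite -!scalemxAr !mxE.
  rewrite (eq_bigr (fun i => act (enum_val p) (b i) * w i)) => [|k _]; last by rewrite !mxE.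
  rewrite [X in _ = Q * X](eq_bigr (fun i => act (enum_val p) (b i) * u i)) => [|k _]; last by rewrite !mxE.
  by rewrite wE1 b_dual_u !mulrnAr mulrC.
have [a aE] := dual_span 1.
exists (\sum_i a i * w i); rewrite -[Q]mulr1 aE mulr_sumr mulr_suml.
by apply: eq_bigr => i _; rewrite mulrCA -Jw mulrCA mulrC.
Qed.

Hypothesis rG_faithful : mx_faithful rG.
Variables (s : gT) (v : 'cV[K]_n) (l : 'rV[K]_n).
Hypothesis sE : rG s = 1%:M + v *m l.
Hypothesis s1 : s != 1%g.

Lemma jacobian_mult : exists q, J = lin_form v ^+ (#|fixer rG s|.-1) * q /\ ~ mpdvd (lin_form v) q.
Proof.
have v0 := root_neq0 charK rG_faithful sE s1.
have [m [q [qE Lq]]] := lin_form_mult v0 (jacobian_neq0 charK f_basic).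
suff <- : m = #|fixer rG s|.-1 by exists q.
(* Lower bound: [g] multiplies [J] by the inverse of its determinant, which must equal the [m]-th
   power of that determinant; hence the order of the fixer divides [m + 1]. *)
have Jdet g : g \in fixer rG s -> \det (rG g) ^+ m.+1 = 1.
  move=> gC; have d0 : \det (rG g) != 0 by exact: det_repr_neq0.
  have gJ : act g J = (\det (rG g))^-1 *: J.
    by rewrite -{2}(act_jacobian f_basic g) mulrC mul_mpolyC scalerA mulVf // scale1r.
  have := semi_invariant_mult charK rG_faithful sE s1 gC gJ qE Lq.
  by move=> e; rewrite exprS -e divff.
have := fixer_order_dvd charK rG_faithful sE s1 Jdet.
have C0 : (0 < #|fixer rG s|)%N.
  by apply/card_gt0P; exists s; exact: (s_fixer charK rG_faithful sE s1).
move=> /(dvdn_leq (ltn0Sn _)); rewrite -{1}(prednK C0) ltnS => lem.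
apply/eqP; rewrite eqn_leq lem andbT.
(* Upper bound: [J] divides a product that vanishes only to the order of the fixer minus one. *)
have [j [Q [QE LQ]]] := separating_product charK rG_faithful sE s1.
have [p pE] := jacobian_dvd_separating j.
apply: (lin_form_mult_le v0 LQ (p' := p * q)).
by rewrite -QE pE qE mulrCA.
Qed.

End JacobianMultiplicity.

Section CoprimePowers.
Variables (K : fieldType) (n : nat).
Local Notation S := {mpoly K[n]}.

Lemma lin_form_coprimeX (v w : 'cV[K]_n) m r (p : S) : v != 0 -> w != 0 ->
    ~ mpdvd (lin_form w) (lin_form v) ->
  mpdvd (lin_form w ^+ r) (lin_form v ^+ m * p) -> mpdvd (lin_form w ^+ r) p.
Proof.
move=> v0 w0 vw; have W0 : (lin_form w : S) != 0 by rewrite lin_form_eq0.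
elim: r p => [|r ih] p; first by move=> _; exists p; rewrite expr0 mulr1.
move=> [q e].
have : mpdvd (lin_form w) (lin_form v ^+ m * p).
  by rewrite e exprS mulrCA mulrC; eexists.
move=> /(lin_form_prime w0)[/(lin_form_primeX w0)//|[p' pE]].
have [|q' p'E] := ih p'; last by exists q'; rewrite pE p'E exprSr mulrA.
by exists q; apply: (mulIf W0); rewrite -mulrA -pE e exprSr mulrA.
Qed.

(** Stands in for unique factorization: powers of pairwise nonproportional forms are divided out one
    after another. *)
Lemma lin_form_prod_dvd (T : eqType) (t : seq T) (V : T -> 'cV[K]_n) r (p : S) :
    uniq t -> {in t, forall x, V x != 0} ->
    {in t &, forall x y, x != y -> ~ mpdvd (lin_form (V x)) (lin_form (V y))} ->
    {in t, forall x, mpdvd (lin_form (V x) ^+ r) p} ->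
  mpdvd (\prod_(x <- t) lin_form (V x) ^+ r) p.
Proof.
elim: t p => [|x t ih] p; first by move=> _ _ _ _; exists p; rewrite big_nil mulr1.
move=> /andP[xt ut] V0 cop dv; have [p' pE] := dv x (mem_head _ _).
have V0x : V x != 0 by apply: V0; rewrite mem_head.
have [||y yt|q qE] := ih p' ut.
- by move=> y yt; apply: V0; rewrite inE yt orbT.
- by move=> y z yt zt; apply: cop; rewrite inE (yt, zt) orbT.
- have yx : y != x by apply: contraNneq xt => <-.
  have yxt : y \in x :: t by rewrite inE yt orbT.
  apply: (lin_form_coprimeX (m := r) V0x (V0 y yxt) (cop y x yxt (mem_head _ _) yx)).
  by rewrite mulrC -pE; exact: dv.
by exists q; rewrite big_cons pE qE mulrCA mulrC mulrA.
Qed.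

End CoprimePowers.

(** * Orbits of mirrors and their discriminants *)

Section MirrorOrbits.
Variables (K : fieldType) (gT : finGroupType) (n : nat).
Variable rG : mx_representation K [set: gT] n.
Local Notation S := {mpoly K[n]}.
Local Notation act := (Defs.act rG).
Local Notation R := (inv_pred rG).
Hypothesis charK : [pchar K] =i pred0.
Hypothesis rG_faithful : mx_faithful rG.
Hypothesis G_reflection : <<pseudo_reflections rG>>%g = [set: gT].

Definition mirror_act (g : gT) (H : 'M[K]_n) : 'M[K]_n := <<H *m (rG g)^T>>%MS.

Lemma mirror_actM g h H : mirror_act g (mirror_act h H) = mirror_act (g * h)%g H.
Proof.
rewrite /mirror_act repr_mxM ?inE // trmx_mul mulmxA; apply: eq_genmx.
by apply: eqmxMr; exact: genmxE.
Qed.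

Lemma mirror_act1 s : mirror_act 1%g (mirror rG s) = mirror rG s.
Proof. by rewrite /mirror_act repr_mx1 trmx1 mulmx1 /mirror genmx_id. Qed.

Lemma mirror_fix s : mirror rG s *m (rG s)^T = mirror rG s.
Proof.
have : (mirror rG s <= eigenspace (rG s)^T 1)%MS by rewrite /mirror genmxE.
by move=> /eigenspaceP ->; rewrite scale1r.
Qed.

Lemma mirror_conj g s : mirror rG (g * s * g^-1)%g = mirror_act g (mirror rG s).
Proof.
have sub x y : (mirror rG y *m (rG x)^T <= eigenspace (rG (x * y * x^-1)%g)^T 1)%MS.
  apply/eigenspaceP; rewrite scale1r -mulmxA -trmx_mul -repr_mxM ?inE // mulgKV.
  by rewrite repr_mxM ?inE // trmx_mul mulmxA mirror_fix.
apply: eq_genmx; apply/eqmxP; rewrite sub andbT.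
have := sub g^-1%g (g * s * g^-1)%g.
rewrite invgK -!mulgA mulVg mulg1 mulKg -(genmxE (eigenspace _ _)) -/(mirror rG s) => h.
have := submxMr (rG g)^T h; rewrite -mulmxA -trmx_mul -repr_mxM ?inE // mulgV repr_mx1 trmx1 mulmx1.
by rewrite /mirror genmxE mulgA.
Qed.

Lemma pseudo_reflection_conj g s :
  s \in pseudo_reflections rG -> (g * s * g^-1)%g \in pseudo_reflections rG.
Proof.
rewrite !inE => /boolp.asboolP[n0 [P [z [uP z1 zm sE]]]]; apply/boolp.asboolP.
split=> //; exists (rG g *m P), z; split=> //; first by rewrite unitmx_mul repr_mx_unit.
rewrite !repr_mxM ?inE // sE.
have ugP : rG g *m P \in unitmx by rewrite unitmx_mul repr_mx_unit.
have -> : invmx (rG g *m P) = invmx P *m rG g^-1%g.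
  rewrite -[RHS](mulmxK ugP) -!mulmxA (mulmxA (rG _)) -repr_mxM ?inE // mulVg repr_mx1 mul1mx.
  by rewrite mulmxA mulVmx // mul1mx.
by rewrite !mulmxA.
Qed.

Lemma mirrorsP H : reflect (exists2 s, s \in pseudo_reflections rG & H = mirror rG s) (H \in mirrors rG).
Proof.
rewrite mem_undup; apply: (iffP mapP) => -[s sR ->]; exists s => //.
  by rewrite mem_enum in sR.
by rewrite mem_enum.
Qed.

Lemma mirrors_act g H : H \in mirrors rG -> mirror_act g H \in mirrors rG.
Proof.
case/mirrorsP => s sR ->; rewrite -mirror_conj; apply/mirrorsP.
by exists (g * s * g^-1)%g => //; exact: pseudo_reflection_conj.
Qed.

Lemma ramif_act_le g s : (ramif rG (mirror rG s) <= ramif rG (mirror_act g (mirror rG s)))%N.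
Proof.
rewrite [leqLHS]/ramif -(cardJg [set h | mirror rG s *m (rG h)^T == mirror rG s] g^-1%g).
apply: subset_leq_card; apply/subsetP => x /imsetP[h]; rewrite !inE conjgE invgK => /eqP hs ->.
have /submxP[D DE] : (mirror_act g (mirror rG s) <= mirror rG s *m (rG g)^T)%MS by rewrite genmxE.
rewrite DE -!mulmxA -trmx_mul -repr_mxM ?inE // !mulgA mulgKV repr_mxM ?inE // trmx_mul.
by rewrite (mulmxA (mirror rG s)) hs.
Qed.

Lemma ramif_act g s : ramif rG (mirror_act g (mirror rG s)) = ramif rG (mirror rG s).
Proof.
apply/eqP; rewrite eqn_leq ramif_act_le andbT -mirror_conj.
apply: leq_trans (ramif_act_le g^-1%g _) _.
by rewrite mirror_conj mirror_actM mulVg mirror_act1.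
Qed.

Variable L : 'M[K]_n -> 'cV[K]_n.
Hypothesis L_root : mirror_roots rG L.

Lemma mirror_coroot s : s \in pseudo_reflections rG ->
  s != 1%g /\ exists l, rG s = 1%:M + L (mirror rG s) *m l.
Proof.
move=> sR; split.
  move: sR; rewrite inE; apply: contraTneq => ->; apply/negP => /boolp.asboolP[n0 [P [z [uP z1 _ sE]]]].
  case/eqP: z1; move: sE; rewrite repr_mx1 => /(congr1 (fun M => invmx P *m M *m P)).
  rewrite mulmx1 mulVmx // !mulmxA mulVmx // mul1mx mulmxKV //.
  by move=> /matrixP/(_ (Ordinal n0) (Ordinal n0)); rewrite !mxE !eqxx mulr1n => ->.
have /andP[_ /submxP[D DE]] := L_root sR; exists D^T.
by rewrite -[L _]trmxK -trmx_mul -DE trmxK addrC subrK.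
Qed.

Lemma L_neq0 H : H \in mirrors rG -> L H != 0.
Proof.
case/mirrorsP => s sR ->; have [s1 [l sE]] := mirror_coroot sR.
exact: (root_neq0 charK rG_faithful sE s1).
Qed.

(** With a common root line, each of the two reflections lies in the fixer of the other by
    [root_fixer], so each mirror is contained in the other. *)
Lemma L_proportional H H' : H \in mirrors rG -> H' \in mirrors rG ->
  mpdvd (lin_form (L H)) (lin_form (L H')) -> H = H'.
Proof.
move=> hH hH' /(mpdvd_proportional (L_neq0 hH) (L_neq0 hH'))[c c0].
case/mirrorsP: hH => s sR ->; case/mirrorsP: hH' => s' sR' -> e.
have [s1 [l sE]] := mirror_coroot sR; have [s1' [l' sE']] := mirror_coroot sR'.
have e' : L (mirror rG s) = c^-1 *: L (mirror rG s') by rewrite e scalerA mulVf // scale1r.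
have h1 : s' \in fixer rG s.
  apply: (root_fixer charK rG_faithful sE s1); exists (c *: l').
  by rewrite sE' e -scalemxAr -scalemxAl.
have h2 : s \in fixer rG s'.
  apply: (root_fixer charK rG_faithful sE' s1'); exists (c^-1 *: l).
  by rewrite sE e' -scalemxAr -scalemxAl.
have le x y : y \in fixer rG x -> (mirror rG x <= mirror rG y)%MS.
  rewrite inE /(mirror rG y) genmxE => /eqP h; apply/eigenspaceP; by rewrite scale1r.
have : (mirror rG s == mirror rG s')%MS by rewrite !le.
by move=> /genmxP; rewrite /mirror !genmx_id.
Qed.

(** Conjugation by [g] carries the root line of [s] to that of [g s g^-1]; evaluating both rank one
    expressions of the conjugate at [g] of the root gives the scalar. *)
Lemma act_L g H : H \in mirrors rG ->
  exists2 c, c != 0 & act g (lin_form (L H)) = c *: lin_form (L (mirror_act g H)).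
Proof.
move=> hH; have L0 := L_neq0 hH; have L0' := L_neq0 (mirrors_act g hH).
case/mirrorsP: hH L0 L0' => s sR ->; rewrite -mirror_conj => L0 L0'.
have [s1 [l sE]] := mirror_coroot sR.
have [_ [l' sE']] := mirror_coroot (pseudo_reflection_conj g sR).
pose w := rG g *m L (mirror rG s).
have gE : L (mirror rG (g * s * g^-1)%g) *m l' = w *m (l *m rG g^-1%g).
  apply: (addrI 1%:M); rewrite -sE' !repr_mxM ?inE // sE mulmxDr mulmx1 mulmxDl.
  by rewrite -repr_mxM ?inE // mulgV repr_mx1 /w !mulmxA.
have lv := root_pairing_neq0 charK rG_faithful sE s1.
have wE : (l *m L (mirror rG s)) 0 0 *: w =
    (l' *m w) 0 0 *: L (mirror rG (g * s * g^-1)%g).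
  have := congr1 (mulmx^~ w) gE; rewrite -!mulmxA.
  rewrite [l' *m w in LHS]mx11_scalar mul_mx_scalar => ->.
  rewrite /w (mulmxA (rG g^-1%g)) -repr_mxM ?inE // mulVg repr_mx1 mul1mx.
  by rewrite [l *m L _ in RHS]mx11_scalar mul_mx_scalar scalemxAr.
have w0 : w != 0.
  by apply: contraNneq L0 => w0; rewrite -[L _](mulKmx (repr_mx_unit rG (in_setT g))) -/w w0 mulmx0.
exists (((l *m L (mirror rG s)) 0 0)^-1 * (l' *m w) 0 0).
  rewrite mulf_neq0 ?invr_eq0 //; apply: contra_neq w0 => h.
  by move: wE; rewrite h scale0r => /eqP; rewrite scaler_eq0 (negPf lv) => /eqP.
by rewrite act_lin -lin_formZ -scalerA -wE scalerA mulVf // scale1r.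
Qed.

Variable H : 'M[K]_n.
Hypothesis hH : H \in mirrors rG.
Local Notation orb := (mirror_orbit rG H).
Local Notation r := (ramif rG H).

Lemma orbitP H' : reflect (exists g, H' = mirror_act g H) (H' \in orb).
Proof.
rewrite mem_filter; apply: (iffP andP) => [[/existsP[g /eqP ->] _]|[g ->]]; first by exists g.
by split; [apply/existsP; exists g | exact: mirrors_act].
Qed.

Lemma orbit_mirrors H' : H' \in orb -> H' \in mirrors rG.
Proof. by rewrite mem_filter => /andP[]. Qed.

Lemma orbit_uniq : uniq orb.
Proof. by rewrite filter_uniq // undup_uniq. Qed.

Lemma orbit_self : H \in orb.
Proof.
apply/orbitP; exists 1%g; case/mirrorsP: hH => s _ ->.
by rewrite mirror_act1.
Qed.

Lemma orbit_act g H' : H' \in orb -> mirror_act g H' \in orb.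
Proof. by case/orbitP => h ->; apply/orbitP; exists (g * h)%g; rewrite mirror_actM. Qed.

Lemma orbit_ramif H' : H' \in orb -> ramif rG H' = r.
Proof. by case/orbitP => g ->; case/mirrorsP: hH => s _ ->; exact: ramif_act. Qed.

Lemma ramif_gt0 : (0 < r)%N.
Proof. by apply/card_gt0P; exists 1%g; rewrite inE repr_mx1 trmx1 mulmx1. Qed.

Definition orbit_form : S := \prod_(H' <- orb) lin_form (L H').

Lemma orbit_discriminantE : orbit_discriminant rG L H = orbit_form ^+ r.
Proof.
rewrite /orbit_discriminant /orbit_form -prodrXl big_seq [RHS]big_seq.
by apply: eq_bigr => H' /orbit_ramif ->.
Qed.

Lemma orbit_form_neq0 : orbit_form != 0.
Proof.
rewrite /orbit_form prodf_seq_neq0; apply/allP => H' H'o /=.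
by rewrite lin_form_eq0 L_neq0 // orbit_mirrors.
Qed.

Lemma act_orbit_form g : exists2 c, c != 0 & act g orbit_form = c *: orbit_form.
Proof.
have perm : perm_eq [seq mirror_act g H' | H' <- orb] orb.
  apply: uniq_perm.
  - rewrite map_inj_in_uniq ?orbit_uniq // => H1 H2 /orbitP[h1 ->] /orbitP[h2 ->] e.
    have := congr1 (mirror_act g^-1%g) e; rewrite !mirror_actM.
    by rewrite ?mulgA mulVg !mul1g.
  - exact: orbit_uniq.
  move=> H'; apply/mapP/idP => [[H1 h1 ->]|h]; first exact: orbit_act.
  exists (mirror_act g^-1%g H'); first exact: orbit_act.
  by case/orbitP: h => h ->; rewrite !mirror_actM ?mulgA mulgV mul1g.
have /boolp.choice[c cE] H' : exists c, H' \in orb ->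
    c != 0 /\ act g (lin_form (L H')) = c *: lin_form (L (mirror_act g H')).
  case: (boolP (H' \in orb)) => [/orbit_mirrors h|_]; last by exists 0.
  by have [c c0 cE] := act_L g h; exists c.
exists (\prod_(H' <- orb) c H').
  by rewrite prodf_seq_neq0; apply/allP => H' /cE[c0 _] /=; rewrite c0.
rewrite /orbit_form rmorph_prod /= big_seq (eq_bigr (fun H' => c H' *: lin_form (L (mirror_act g H')))).
  rewrite -big_seq scaler_prod; congr (_ *: _).
  by rewrite -[RHS](perm_big _ perm) big_map.
by move=> H' /cE[].
Qed.

Lemma lin_form_orbit_split H0 : H0 \in mirrors rG -> exists m q,
  [/\ orbit_form = lin_form (L H0) ^+ m * q, ~ mpdvd (lin_form (L H0)) q
    & m = (H0 \in orb)].
Proof.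
move=> h0; have L0 := L_neq0 h0.
have ndvd (t : seq 'M[K]_n) : {subset t <= mirrors rG} -> H0 \notin t ->
    ~ mpdvd (lin_form (L H0)) (\prod_(H' <- t) lin_form (L H')).
  move=> tm ht /(lin_form_prime_prod L0)[H' H't] /(L_proportional h0 (tm _ H't)) e.
  by move: ht; rewrite e H't.
case: (boolP (H0 \in orb)) => h.
  exists 1%N, (\prod_(H' <- rem H0 orb) lin_form (L H')); split=> //.
    by rewrite expr1 /orbit_form (big_rem H0).
  apply: ndvd => [H' /mem_rem/orbit_mirrors //|].
  by rewrite (mem_rem_uniq _ orbit_uniq) inE eqxx.
exists 0%N, orbit_form; split=> //; first by rewrite expr0 mul1r.
by apply: ndvd => // H' /orbit_mirrors.
Qed.

Lemma ramif_det s m : s \in pseudo_reflections rG -> (ramif rG (mirror rG s) %| m)%N ->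
  \det (rG s) ^+ m = 1.
Proof.
move=> sR /dvdnP[k ->]; have [s1 [l sE]] := mirror_coroot sR.
have powt j : \det (rG (s ^+ j)%g) = \det (rG s) ^+ j.
  elim: j => [|j ih]; first by rewrite expg0 repr_mx1 det1 expr0.
  by rewrite expgS exprS repr_mxM ?inE // det_mulmx ih.
rewrite -powt mulnC expgM.
have -> : (s ^+ ramif rG (mirror rG s) = 1)%g; last by rewrite expg1n repr_mx1 det1.
pose C := Group (fixer_group charK rG_faithful sE s1).
have sC : s \in C := s_fixer charK rG_faithful sE s1.
by apply/eqP; rewrite -order_dvdn; exact: (order_dvdG sC).
Qed.

(** On a generator [s], the orbit form is scaled by [det s] if its mirror lies in the orbit and is
    fixed otherwise; the [r]-th power of that determinant is 1. *)
Lemma orbit_discriminant_inv : orbit_form ^+ r \in R.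
Proof.
pose D := [set g | act g (orbit_form ^+ r) == orbit_form ^+ r].
have gD : group_set D.
  apply/group_setP; split=> [|g h]; first by rewrite inE Defs.act1.
  by rewrite !inE => /eqP hg /eqP hh; rewrite Defs.actM hh hg.
suff DT : [set: gT] \subset Group gD.
  by apply/invP => g; have := subsetP DT g (in_setT g); rewrite inE => /eqP.
rewrite -G_reflection gen_subG; apply/subsetP => s sR; rewrite inE.
have [s1 [l sE]] := mirror_coroot sR.
have hs : mirror rG s \in mirrors rG by apply/mirrorsP; exists s.
have [c c0 cE] := act_orbit_form s.
have [m [q [qE Lq mE]]] := lin_form_orbit_split hs.
have sC := s_fixer charK rG_faithful sE s1.
have aE : act s (orbit_form ^+ r) = c ^+ r *: orbit_form ^+ r.
  by rewrite rmorphXn /= cE exprZn.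
rewrite aE; have e : orbit_form ^+ r = lin_form (L (mirror rG s)) ^+ (m * r) * q ^+ r.
  by rewrite qE exprMn exprM.
have Lqr : ~ mpdvd (lin_form (L (mirror rG s))) (q ^+ r).
  by move=> /(lin_form_primeX (L_neq0 hs)).
rewrite (semi_invariant_mult charK rG_faithful sE s1 sC aE e Lqr).
rewrite ramif_det ?scale1r // mE; case: (boolP (_ \in orb)) => h; last by rewrite mul0n dvdn0.
by rewrite mul1n (orbit_ramif h).
Qed.

(* The order of vanishing of an invariant along a mirror is a multiple of the
   ramification index. *)
Lemma invariant_dvd p : p \in R -> mpdvd (lin_form (L H)) p -> mpdvd (orbit_form ^+ r) p.
Proof.
move=> pR; have [->|p0] := eqVneq p 0; first by move=> _; exact: mpdvd0.
move=> Lp; have L0 := L_neq0 hH.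
have [m [q [qE Lq]]] := lin_form_mult L0 p0.
have m0 : (0 < m)%N.
  by rewrite lt0n; apply/negP => /eqP m0; apply: Lq; move: Lp; rewrite qE m0 expr0 mul1r.
have Lr : mpdvd (lin_form (L H) ^+ r) p.
  case/mirrorsP: (hH) => s sR HE; have [s1 [l sE]] := mirror_coroot sR.
  rewrite HE in qE Lq *.
  have : (#|fixer rG s| %| m)%N.
    apply: (fixer_order_dvd charK rG_faithful sE s1) => g gC.
    apply/esym/(semi_invariant_mult charK rG_faithful sE s1 gC _ qE Lq).
    by rewrite scale1r; apply/invP.
  move=> /(dvdn_leq m0) rm; rewrite qE -(subnK rm) exprD mulrAC.
  by eexists.
rewrite /orbit_form -prodrXl; apply: lin_form_prod_dvd => [||H1 H2 h1 h2 ne|H'].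
- exact: orbit_uniq.
- by move=> H' /orbit_mirrors/L_neq0.
- by move=> /(L_proportional (orbit_mirrors h1) (orbit_mirrors h2)) e; rewrite e eqxx in ne.
case/orbitP => g ->; have [c c0 cE] := act_L g hH.
have [w wE] := Lr; exists (c ^+ r *: act g w).
rewrite -[p in LHS](invP _ _ pR g) wE.
by rewrite rmorphM rmorphXn /= cE exprZn -scalerAr scalerAl.
Qed.

Lemma mpdvd_inv p q : p \in R -> q \in R -> q != 0 -> mpdvd q p ->
  exists2 t, t \in R & p = t * q.
Proof.
move=> /invP pR /invP qR q0 [t tE]; exists t => //; apply/invP => g.
by apply: (mulIf q0); rewrite -[in LHS](qR g) -rmorphM -tE /= pR.
Qed.

(** By [invariant_dvd], divisibility of an invariant can be tested on the single prime form
    [L H]. *)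
Lemma orbit_discriminant_prime p q : p \in R -> q \in R ->
  mpdvd (orbit_form ^+ r) (p * q) -> mpdvd (orbit_form ^+ r) p \/ mpdvd (orbit_form ^+ r) q.
Proof.
move=> pR qR h; have L0 := L_neq0 hH.
have LD : mpdvd (lin_form (L H)) (orbit_form ^+ r).
  rewrite -(prednK ramif_gt0) exprS; apply: mpdvd_mulr.
  by rewrite /orbit_form (big_rem H) ?orbit_self //=; apply: mpdvd_mulr; exact: mpdvd_refl.
have := lin_form_prime L0 (mpdvd_trans LD h).
by move=> [] /invariant_dvd; [left | right]; auto.
Qed.

Lemma orbit_discriminant_dvd p : mpdvd (orbit_form ^+ r) p -> mpdvd (lin_form (L H)) p.
Proof.
apply: mpdvd_trans; rewrite -(prednK ramif_gt0) exprS; apply: mpdvd_mulr.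
by rewrite /orbit_form (big_rem H) ?orbit_self //=; apply: mpdvd_mulr; exact: mpdvd_refl.
Qed.

(** The invariant [c] is the norm of [J'], the product of its translates. It makes [J'] invertible
    once invariants prime to the discriminant are inverted. *)
Lemma orbit_form_factor J :
    {in orb, forall H', exists q, J = lin_form (L H') ^+ r.-1 * q /\ ~ mpdvd (lin_form (L H')) q} ->
  exists J' c t, [/\ J = orbit_form ^+ r.-1 * J', c \in R, c = t * J' & ~ mpdvd (orbit_form ^+ r) c].
Proof.
move=> hJ.
have [J' JE] : mpdvd (orbit_form ^+ r.-1) J.
  rewrite /orbit_form -prodrXl; apply: lin_form_prod_dvd => [||H1 H2 h1 h2 ne|H'].
  - exact: orbit_uniq.
  - by move=> H' /orbit_mirrors/L_neq0.
  - by move=> /(L_proportional (orbit_mirrors h1) (orbit_mirrors h2)) e; rewrite e eqxx in ne.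
  by move=> /hJ[q [-> _]]; rewrite mulrC; eexists.
have LJ' H' : H' \in orb -> ~ mpdvd (lin_form (L H')) J'.
  move=> h; have [q [qE Lq]] := hJ _ h; move=> [w wE]; apply: Lq.
  have L0 : (lin_form (L H') : S) ^+ r.-1 != 0.
    by rewrite expf_neq0 // lin_form_eq0 L_neq0 // orbit_mirrors.
  exists (w * (\prod_(H1 <- rem H' orb) lin_form (L H1)) ^+ r.-1); apply: (mulfI L0).
  have comm (x y z t : S) : x * y * (z * t) = z * (x * t * y) by ring.
  by rewrite -qE JE wE /orbit_form (big_rem H') //= exprMn comm.
exists J', (\prod_g act g J'), (\prod_(g | g != 1%g) act g J'); split.
- by rewrite mulrC.
- apply/invP => h; rewrite rmorph_prod /= [RHS](reindex_inj (mulgI h)).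
  by apply: eq_bigr => g _; rewrite Defs.actM.
- by rewrite (bigD1 1%g) //= Defs.act1 mulrC.
move=> /orbit_discriminant_dvd; rewrite -big_enum => /(lin_form_prime_prod (L_neq0 hH))[g _ [q qE]].
have [c c0 cE] := act_L g^-1%g hH.
apply: (LJ' (mirror_act g^-1%g H)); first exact/orbit_act/orbit_self.
exists (c *: act g^-1%g q).
have := congr1 (act g^-1%g) qE; rewrite -Defs.actM mulVg Defs.act1 => ->.
by rewrite rmorphM /= cE -scalerAr scalerAl.
Qed.

End MirrorOrbits.

(** * Localization at the discriminant *)

Lemma fraction_div (R : idomainType) (x : {fraction R}) :
  exists n d : R, d != 0 /\
    x = @fraction.FracField.tofrac R n / @fraction.FracField.tofrac R d.
Proof.
elim/quotW: x => y; exists (fraction.frac y).1, (fraction.frac y).2.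
have d0 := fraction.denom_ratioP y; split=> //.
apply: (canRL (mulfK _)); first by rewrite fraction.tofrac_eq0.
unlock fraction.FracField.tofrac; rewrite -[LHS]fraction.FracField.pi_mul.
apply/eqmodP; rewrite /= fraction.FracField.equivfE /fraction.FracField.mulf.
by rewrite !fraction.numden_Ratio ?mulf_neq0 ?oner_eq0 // !mulr1 mulrC.
Qed.

(** * The fraction field of a quotient by a prime element *)

Section ResidueField.
Variables (A : comNzRingType) (D : A).
Hypothesis D_proper : forall b, 1 <> b * D.
Hypothesis D_prime : forall x y, (exists b, x * y = b * D) ->
  (exists b, x = b * D) \/ (exists b, y = b * D).

Definition multiples : {pred A} := fun x => boolp.asbool (exists b, x = b * D).

Lemma multiples_ideal : idealr_closed multiples.
Proof.
split=> [|| a x y]; rewrite ?unfold_in.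
- by apply/boolp.asboolP; exists 0; rewrite mul0r.
- by apply/negP => /boolp.asboolP[b /D_proper].
move=> /boolp.asboolP[b ->] /boolp.asboolP[c ->]; apply/boolp.asboolP.
by exists (a * b + c); rewrite mulrDl mulrA.
Qed.

Lemma multiples_prime : prime_idealr_closed multiples.
Proof.
move=> x y /boolp.asboolP/D_prime[h|h]; apply/orP; [left|right]; exact/boolp.asboolP.
Qed.

HB.instance Definition _ := isIdealr.Build A multiples multiples_ideal.
HB.instance Definition _ := isPrimeIdealrClosed.Build A multiples multiples_prime.

Definition residue_domain : Type := {ideal_quot multiples}.
HB.instance Definition _ := GRing.ComNzRing.on residue_domain.

(** [{fraction _}] expects an integral domain structure, which includes an inverse function; it is
    chosen classically. *)
Definition residue_unit : {pred residue_domain} := fun x => boolp.asbool (exists y, y * x = 1).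
Definition residue_inv (x : residue_domain) : residue_domain :=
  if boolp.pselect (exists y, y * x = 1) is left h then projT1 (boolp.cid h) else x.

Lemma residue_mulV : {in residue_unit, left_inverse 1 residue_inv *%R}.
Proof.
move=> x /boolp.asboolP h; rewrite /residue_inv; case: boolp.pselect => // h'.
by case: (boolp.cid h').
Qed.

Lemma residue_unitP x y : y * x = 1 -> residue_unit x.
Proof. by move=> h; apply/boolp.asboolP; exists y. Qed.

Lemma residue_inv_out : {in [predC residue_unit], residue_inv =1 id}.
Proof.
move=> x; rewrite inE => /negP h; rewrite /residue_inv; case: boolp.pselect => // h'.
by case: h; apply/boolp.asboolP.
Qed.

HB.instance Definition _ := GRing.ComNzRing_hasMulInverse.Build residue_domain
  residue_mulV residue_unitP residue_inv_out.
HB.instance Definition _ := GRing.ComUnitRing_isIntegral.Build residue_domain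
  (@Quotient.rquot_IdomainAxiom A multiples).

Lemma residue_field_exists : exists (k : fieldType) (rho : {rmorphism A -> k}),
  (forall a, rho a = 0 <-> exists b, a = b * D) /\
  (forall x, exists a b, rho b != 0 /\ x = rho a / rho b).
Proof.
pose p : {rmorphism A -> residue_domain} := (\pi_({ideal_quot multiples}))%qT.
pose rho : {rmorphism A -> {fraction residue_domain}} :=
  @fraction.FracField.tofrac residue_domain \o p.
have p0 a : p a = 0 <-> exists b, a = b * D.
  rewrite -(rmorph0 p); split=> [/eqP|h].
    by rewrite -Quotient.idealrBE subr0 => /boolp.asboolP.
  by apply/eqP; rewrite -Quotient.idealrBE subr0; apply/boolp.asboolP.
have rho0 a : rho a = 0 <-> p a = 0.
  rewrite /rho /=; split=> [/eqP|->]; last by rewrite rmorph0.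
  by rewrite fraction.tofrac_eq0 => /eqP.
have psurj y : exists a, p a = y by exists (repr y); exact: reprK.
exists {fraction residue_domain}, rho; split=> [a|x]; first by rewrite rho0.
have [y [z [z0 ->]]] := fraction_div x.
have [a aE] := psurj y; have [b bE] := psurj z; exists a, b; split.
  by apply/eqP => /rho0; rewrite bE => /eqP; rewrite (negPf z0).
by rewrite /rho /= aE bE.
Qed.

End ResidueField.

(** * Linear algebra over the residue field *)

Section ReducedFactorization.
Variables (A : comNzRingType) (S : idomainType) (iv : {rmorphism A -> S}).
Variables (N : nat) (b : 'I_N -> S) (co : S -> 'I_N -> A).
Hypothesis coD : forall p q i, co (p + q) i = co p i + co q i.
Hypothesis coM : forall a p i, co (iv a * p) i = a * co p i.
Hypothesis coE : forall p, p = \sum_i iv (co p i) * b i.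
Hypothesis co_basis : forall i j, co (b i) j = (i == j)%:R.
Variables (k : fieldType) (rho : {rmorphism A -> k}) (D : A).
Hypothesis rho_ker : forall a, rho a = 0 <-> exists c, a = c * D.
Hypothesis rho_frac : forall x, exists a c, rho c != 0 /\ x = rho a / rho c.

(** The class of [p] in S tensored with [k] over [A], a [k]-space with basis the classes of the
    [b_i]. *)
Definition red (p : S) : 'rV[k]_N := \row_i rho (co p i).

Lemma redD p q : red (p + q) = red p + red q.
Proof. by apply/rowP => i; rewrite !mxE coD rmorphD. Qed.

Lemma red0 : red 0 = 0.
Proof. by apply: (addrI (red 0)); rewrite -redD !addr0. Qed.

Lemma red_sum (I : finType) (F : I -> S) : red (\sum_i F i) = \sum_i red (F i).
Proof. exact: (big_morph red redD red0). Qed.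

Lemma redM a p : red (iv a * p) = rho a *: red p.
Proof. by apply/rowP => i; rewrite !mxE coM rmorphM. Qed.

Lemma red_basis i : red (b i) = delta_mx 0 i.
Proof. by apply/rowP => j; rewrite !mxE co_basis rmorph_nat eq_sym eqxx. Qed.

Lemma red_eq0 p : red p = 0 <-> exists q, p = iv D * q.
Proof.
split=> [/rowP h|[q ->]]; last first.
  by rewrite redM (rho_ker D).2 ?scale0r //; exists 1; rewrite mul1r.
have /boolp.choice[c cE] i : exists c, co p i = c * D.
  by apply/rho_ker; have := h i; rewrite !mxE.
exists (\sum_i iv (c i) * b i); rewrite mulr_sumr {1}(coE p).
by apply: eq_bigr => i _; rewrite cE rmorphM /= mulrCA mulrA.
Qed.

Lemma red_lift m (x : 'I_m -> 'rV[k]_N) :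
  exists c (p : 'I_m -> S), rho c != 0 /\ forall i, red (p i) = rho c *: x i.
Proof.
have /boolp.choice[w wE] (ij : 'I_m * 'I_N) : exists w : A * A,
    rho w.2 != 0 /\ x ij.1 0 ij.2 = rho w.1 / rho w.2.
  by have [a [c [c0 e]]] := rho_frac (x ij.1 0 ij.2); exists (a, c).
pose c := \prod_ij (w ij).2.
have c0 : rho c != 0.
  by rewrite rmorph_prod; apply/prodf_neq0 => ij _; have [] := wE ij.
have /boolp.choice[z zE] (ij : 'I_m * 'I_N) : exists z, rho z = rho c * x ij.1 0 ij.2.
  have [w0 ->] := wE ij; exists ((w ij).1 * \prod_(l | l != ij) (w l).2).
  rewrite rmorphM /c [in RHS](bigD1 ij) //= [in RHS]rmorphM.
  by rewrite [RHS]mulrC -mulrA; congr (_ * _); rewrite mulKf.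
exists c, (fun i => \sum_j iv (z (i, j)) * b j); split=> // i.
rewrite red_sum; apply/rowP => j; rewrite summxE (bigD1 j) //= big1 => [|l lj].
  by rewrite redM red_basis !mxE !eqxx mulr1 addr0 zE.
by rewrite redM red_basis !mxE eqxx eq_sym (negPf lj) mulr0.
Qed.

Definition mult_mx (s : S) : 'M[k]_N := \matrix_(i, j) red (s * b i) 0 j.

Lemma red_mult s p : red (s * p) = red p *m mult_mx s.
Proof.
rewrite {1}(coE p) mulr_sumr red_sum; apply/rowP => j; rewrite summxE mxE.
by apply: eq_bigr => i _; rewrite mulrCA redM !mxE.
Qed.

Lemma mult_mx_row i s : row i (mult_mx s) = red (s * b i).
Proof. by apply/rowP => j; rewrite !mxE. Qed.

Lemma mult_mxM s t : mult_mx (s * t) = mult_mx t *m mult_mx s.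
Proof.
apply/row_matrixP => i; rewrite row_mul !mult_mx_row -red_mult mulrA.
by [].
Qed.

Lemma mult_mxD s t : mult_mx (s + t) = mult_mx s + mult_mx t.
Proof. by apply/row_matrixP => i; rewrite linearD /= !mult_mx_row mulrDl redD. Qed.

Lemma mult_mx0 : mult_mx 0 = 0.
Proof. by apply/row_matrixP => i; rewrite mult_mx_row mul0r red0 row0. Qed.

Lemma mult_mx_sum (I : finType) (F : I -> S) : mult_mx (\sum_i F i) = \sum_i mult_mx (F i).
Proof. exact: (big_morph mult_mx mult_mxD mult_mx0). Qed.

Lemma mult_mx_iv a : mult_mx (iv a) = (rho a)%:M.
Proof.
apply/row_matrixP => i; rewrite mult_mx_row redM red_basis.
by rewrite -scalemx1 linearZ /= row1.
Qed.

Lemma mult_mx_unit s t c : iv c = t * s -> rho c != 0 -> mult_mx s \in unitmx.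
Proof.
move=> cE c0; have : mult_mx s *m ((rho c)^-1 *: mult_mx t) = 1%:M.
  by rewrite -scalemxAr -mult_mxM -cE mult_mx_iv scale_scalar_mx mulVf.
by case/mulmx1_unit.
Qed.

Variables (E : S) (r : nat).
Hypothesis DE : iv D = E ^+ r.
Hypothesis r_gt0 : (0 < r)%N.
Hypothesis E0 : E != 0.

(** The kernel of [E] is contained in the image of every [E ^+ i] with [i < r], so each further
    multiplication by [E] loses the full nullity of [E]. *)
Lemma mult_mx_powers i : (i <= r)%N ->
  (\rank (mult_mx (E ^+ i)) + i * (N - \rank (mult_mx E)) = N)%N.
Proof.
(* If [E p] is a multiple of [E ^+ r], cancelling [E] in the domain [S] shows that [p] is a multiple
   of [E ^+ r.-1]. *)
have ker : (kermx (mult_mx E) <= mult_mx (E ^+ r.-1))%MS.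
  apply/rV_subP => x /sub_kermxP xE.
  have [c [p [c0 pE]]] := red_lift (fun _ : 'I_1 => x).
  have : red (E * p ord0) = 0 by rewrite red_mult pE -scalemxAl xE scaler0.
  move=> /red_eq0[q]; rewrite DE -(prednK r_gt0) exprS -mulrA => /(mulfI E0) pq.
  have -> : x = (rho c)^-1 *: red q *m mult_mx (E ^+ r.-1).
    by rewrite -scalemxAl -red_mult -pq pE scalerA mulVf // scale1r.
  exact: submxMl.
elim: i => [_|i ih ir].
  have -> : mult_mx (E ^+ 0) = 1%:M by rewrite expr0 -(rmorph1 iv) mult_mx_iv rmorph1.
  by rewrite mxrank1 addn0.
rewrite -[RHS](ih (ltnW ir)) mulSn addnA; congr (_ + _)%N.
rewrite exprS mult_mxM -mxrank_ker -[RHS](mxrank_mul_ker _ (mult_mx E)); congr (_ + _)%N.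
apply/eqP; rewrite eqn_leq !mxrankS ?capmxSr ?sub_capmx ?submx_refl ?andbT //.
apply: submx_trans ker _; have le : (i <= r.-1)%N by rewrite -ltnS prednK.
by rewrite -(subnKC le) exprD mult_mxM submxMl.
Qed.

Lemma mult_mx_rank : (N = r * (N - \rank (mult_mx E)))%N.
Proof.
have := mult_mx_powers (leqnn r); rewrite -DE mult_mx_iv.
by rewrite (rho_ker D).2 ?raddf0 ?mxrank0 //; exists 1; rewrite mul1r.
Qed.

Variables (J J' t : S) (c0 : A).
Hypothesis JE : J = E ^+ r.-1 * J'.
Hypothesis c0E : iv c0 = t * J'.
Hypothesis c0_neq0 : rho c0 != 0.

Lemma mult_mx_J_rank : (N = r * \rank (mult_mx J))%N.
Proof.
have -> : \rank (mult_mx J) = (N - \rank (mult_mx E))%N; last exact: mult_mx_rank.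
rewrite JE mult_mxM eqmxMfull ?row_full_unit; last exact: mult_mx_unit c0E c0_neq0.
have := mult_mx_powers (leq_pred r); rewrite [in RHS]mult_mx_rank.
rewrite -{3}(prednK r_gt0) mulSn; exact: addIn.
Qed.

Variables (Phi Psi M T : 'M[S]_N) (Q : 'M[k]_N).
Hypothesis Phi_Psi : Phi *m Psi = J%:M.
Hypothesis Psi_Phi : Psi *m Phi = J%:M.
Hypothesis PsiE : Psi = M^T *m Phi^T *m T.
Hypothesis uM : M \in unitmx.
Hypothesis uT : T \in unitmx.
Hypothesis uQ : Q \in unitmx.
Hypothesis Q_sym : forall s, (mult_mx s)^T *m Q = Q *m mult_mx s.

(** The reduction of [X] acting on row vectors; hence the exchanged indices and the reversal of
    products. *)
Definition big_mx (X : 'M[S]_N) : 'M[k]_(\sum_(i < N) N) :=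
  \mxblock_(i < N, p < N) mult_mx (X p i).

Lemma big_mxM X Y : big_mx (X *m Y) = big_mx Y *m big_mx X.
Proof.
rewrite /big_mx mul_mxblock; apply: eq_mxblock => i p.
by rewrite mxE mult_mx_sum; apply: eq_bigr => l _; rewrite mult_mxM.
Qed.

Lemma big_mx_scalar s : big_mx s%:M = \mxdiag_(i < N) mult_mx s.
Proof.
apply: eq_mxblock => i p; rewrite mxE eq_sym.
by case: (i == p); rewrite ?conform_mx_id // mult_mx0.
Qed.

Lemma big_mx1 : big_mx 1%:M = 1%:M.
Proof.
by rewrite big_mx_scalar -(rmorph1 iv) mult_mx_iv rmorph1 mxdiagZ.
Qed.

Lemma big_mx_unit X : X \in unitmx -> big_mx X \in unitmx.
Proof.
move=> uX; have : big_mx X *m big_mx (invmx X) = 1%:M.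
  by rewrite -big_mxM mulVmx // big_mx1.
by case/mulmx1_unit.
Qed.

(** The transpose of [big_mx X] has transposed blocks; conjugation by the block diagonal matrix of
    [Q] turns them back into multiplication matrices. *)
Lemma big_mx_tr X : \rank (big_mx X^T) = \rank (big_mx X).
Proof.
rewrite -[RHS]mxrank_tr tr_mxblock.
have uD : \mxdiag_(i < N) Q \in unitmx.
  rewrite -row_full_unit /row_full rank_mxdiag.
  by apply/eqP/eq_bigr => i _; apply/eqP; rewrite -/(row_full Q) row_full_unit.
have e : \mxblock_(i < N, j < N) (mult_mx (X i j))^T *m \mxdiag_(i < N) Q =
   \mxdiag_(i < N) Q *m big_mx X^T.
  rewrite mul_mxblock_mxdiag mul_mxdiag_mxblock; apply: eq_mxblock => i p.
  by rewrite mxE Q_sym.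
rewrite -[RHS](mxrankMfree _ (B := \mxdiag_(i < N) Q)) ?row_free_unit //.
by rewrite e eqmxMfull // row_full_unit.
Qed.

Lemma big_mx_Psi_rank : \rank (big_mx Psi) = \rank (big_mx Phi).
Proof.
rewrite PsiE !big_mxM.
rewrite eqmxMfull ?row_full_unit ?big_mx_unit //.
rewrite mxrankMfree ?row_free_unit ?big_mx_unit ?unitmx_tr //.
exact: big_mx_tr.
Qed.

Definition blk (Y : 'I_N -> S) : 'rV[k]_(\sum_(i < N) N) := \mxrow_(i < N) red (Y i).

Definition mulv (X : 'M[S]_N) (Y : 'I_N -> S) (p : 'I_N) : S := \sum_i X p i * Y i.

Lemma blk_mulv X Y : blk (mulv X Y) = blk Y *m big_mx X.
Proof.
rewrite /blk /big_mx mul_mxrow_mxblock; apply: eq_mxrow => p.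
by rewrite red_sum; apply: eq_bigr => i _; rewrite red_mult.
Qed.

Lemma blk_eq0 Y : blk Y = 0 <-> exists Z, forall i, Y i = iv D * Z i.
Proof.
split=> [h|[Z ZE]].
  have /boolp.choice[Z ZE] i : exists z, Y i = iv D * z; last by exists Z.
  by apply/red_eq0; have := congr1 (fun x => submxrow x i) h; rewrite mxrowK submxrow0.
apply/mxrowP => i; rewrite mxrowK submxrow0; apply/red_eq0.
by exists (Z i).
Qed.

Lemma submxrowZ c (x : 'rV[k]_(\sum_(i < N) N)) i : submxrow (c *: x) i = c *: submxrow x i.
Proof. by apply/rowP => j; rewrite !mxE. Qed.

Lemma submxrow_blk Y i : submxrow (blk Y) i = red (Y i).
Proof. exact: mxrowK. Qed.

Lemma blkD Y Z : blk (fun i => Y i + Z i) = blk Y + blk Z.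
Proof.
by apply/mxrowP => i; rewrite submxrowD !submxrow_blk redD.
Qed.

Lemma blkM a Y : blk (fun i => iv a * Y i) = rho a *: blk Y.
Proof.
by apply/mxrowP => i; rewrite submxrowZ !submxrow_blk redM.
Qed.

Lemma blk_lift (x : 'rV[k]_(\sum_(i < N) N)) :
  exists c Y, rho c != 0 /\ blk Y = rho c *: x.
Proof.
have [c [Y [h e]]] := red_lift (fun i => submxrow x i).
exists c, Y; split=> //; apply/mxrowP => i.
by rewrite submxrowZ submxrow_blk e.
Qed.

Lemma mulvM X Y Z p : mulv X (mulv Y Z) p = mulv (X *m Y) Z p.
Proof.
rewrite /mulv; under eq_bigr => i _ do rewrite mulr_sumr.
rewrite exchange_big; apply: eq_bigr => l _; rewrite mxE mulr_suml.
by apply: eq_bigr => i _; rewrite mulrA.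
Qed.

Lemma mulvZ X s Z p : mulv X (fun i => s * Z i) p = s * mulv X Z p.
Proof. by rewrite /mulv mulr_sumr; apply: eq_bigr => i _; rewrite mulrCA. Qed.

Lemma mulvD X Y Z p : mulv X (fun i => Y i + Z i) p = mulv X Y p + mulv X Z p.
Proof. by rewrite /mulv -big_split; apply: eq_bigr => i _; rewrite mulrDr. Qed.

Lemma mulv_scalar s Z p : mulv s%:M Z p = s * Z p.
Proof.
rewrite /mulv (bigD1 p) //= big1 => [|i /negPf ip]; last by rewrite mxE eq_sym ip mul0r.
by rewrite mxE eqxx mulr1n addr0.
Qed.

(* [c0 D = t E J] and [J] is a multiple of [Phi]. *)
Lemma mulv_D Z : exists W, forall p, iv c0 * (iv D * Z p) = mulv Phi W p.
Proof.
exists (mulv Psi (fun p => E * t * Z p)) => p.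
rewrite mulvM Phi_Psi mulv_scalar JE c0E DE -(prednK r_gt0) exprS /=.
move: (E ^+ _) => e; ring.
Qed.

(** From [Psi X = D Z] follows [J X = D Phi Z]; cancelling [E ^+ r.-1] leaves [J' X = E Phi Z], and
    [J'] becomes invertible through [c0]. *)
Lemma big_mx_kernel : (kermx (big_mx Psi) <= big_mx Phi)%MS.
Proof.
apply/rV_subP => x /sub_kermxP xP.
have [c [X [hc XE]]] := blk_lift x.
have : blk (mulv Psi X) = 0 by rewrite blk_mulv XE -scalemxAl xP scaler0.
move=> /blk_eq0[Z ZE].
have XW p : iv c0 * X p = mulv Phi (fun p => t * E * Z p) p.
  have : J * X p = iv D * mulv Phi Z p.
    rewrite -mulv_scalar -Phi_Psi -mulvM -mulvZ; apply: eq_bigr => i _.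
    by rewrite ZE.
  rewrite JE DE -{2}(prednK r_gt0) exprSr -!mulrA => /(mulfI (expf_neq0 _ E0)) e.
  by rewrite c0E mulvZ -!mulrA e.
have : blk (fun p => iv c0 * X p) = blk (mulv Phi (fun p => t * E * Z p)).
  by apply: eq_mxrow => p; rewrite XW.
rewrite blkM blk_mulv XE scalerA => e.
have c1 : rho c0 * rho c != 0 by rewrite mulf_neq0.
by rewrite -[x](scalerK c1) e scalemx_sub // submxMl.
Qed.

(** Rank-nullity for [Psi] on the image of [Phi]: the composite is multiplication by [J], and the
    image contains the whole kernel, whose dimension is [N * N] minus the common rank. *)
Lemma rank_big_mx : (2 * \rank (cokermx (big_mx Phi)) = N * (N - \rank (mult_mx J)))%N.
Proof.
have := mxrank_mul_ker (big_mx Phi) (big_mx Psi).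
have -> : \rank (big_mx Phi :&: kermx (big_mx Psi)) = (\sum_(i < N) N - \rank (big_mx Phi))%N.
  rewrite -big_mx_Psi_rank -mxrank_ker; apply/eqP.
  by rewrite eqn_leq !mxrankS ?capmxSr // sub_capmx submx_refl andbT big_mx_kernel.
rewrite -big_mxM Psi_Phi big_mx_scalar rank_mxdiag mxrank_coker.
have := rank_leq_row (big_mx Phi); move: (\rank (big_mx Phi)) => x.
rewrite !sum_nat_const !card_ord; have := rank_leq_row (mult_mx J); nia.
Qed.

(** Only independent columns are kept, so that the map is onto a space of exactly the dimension of
    the cokernel. *)
Definition coker_mx := col_base (cokermx (big_mx Phi)).

Lemma coker_mxP (x : 'rV[k]_(\sum_(i < N) N)) : x *m coker_mx = 0 <-> (x <= big_mx Phi)%MS.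
Proof.
have e : x *m cokermx (big_mx Phi) = x *m coker_mx *m row_base (cokermx (big_mx Phi)).
  by rewrite -mulmxA mulmx_base.
rewrite submxE e; split=> [->|/eqP h]; first by rewrite mul0mx.
by apply: (row_free_inj (row_base_free (cokermx (big_mx Phi)))); rewrite h mul0mx.
Qed.

Lemma coker_mx_surj (y : 'rV[k]_(\rank (cokermx (big_mx Phi)))) : exists x, y = x *m coker_mx.
Proof.
exists (y *m pinvmx coker_mx); rewrite -mulmxA mulVpmx ?mulmx1 //.
exact: col_base_full.
Qed.

(** A relation over [k] lifts up to denominators and a multiple of [D]; the latter is absorbed by
    [mulv_D], since [c0 D] sends everything into the image of [Phi]. *)
Lemma coker_image Y : (exists2 c, rho c != 0 & exists W, forall p, iv c * Y p = mulv Phi W p) <->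
  blk Y *m coker_mx = 0.
Proof.
rewrite coker_mxP; split=> [[c hc [W WE]]|/submxP[x xE]].
  have : blk (fun p => iv c * Y p) = blk (mulv Phi W) by apply: eq_mxrow => p; rewrite WE.
  rewrite blkM blk_mulv => e.
  by rewrite -[blk Y](scalerK hc) e scalemx_sub // submxMl.
have [c [X [hc XE]]] := blk_lift x.
have /blk_eq0[Z ZE] : blk (fun p => iv c * Y p + iv (- 1) * mulv Phi X p) = 0.
  by rewrite blkD !blkM blk_mulv XE xE -scalemxAl rmorphN1 scaleN1r subrr.
exists (c0 * c); first by rewrite rmorphM mulf_neq0.
have [W WE] := mulv_D Z; exists (fun p => iv c0 * X p + W p) => p.
by rewrite mulvD mulvZ -WE -ZE !rmorphM rmorphN1 /=; ring.
Qed.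

End ReducedFactorization.

(** * The localized cokernel and its dimension *)

Section RankAlong.
Variables (K : fieldType) (gT : finGroupType) (n : nat).
Variable rG : mx_representation K [set: gT] n.
Local Notation S := {mpoly K[n]}.
Local Notation act := (Defs.act rG).
Local Notation R := (inv_pred rG).
Local Notation N := #|gT|.
Hypothesis charK : [pchar K] =i pred0.
Variable f : n.-tuple S.
Hypothesis f_basic : basic_invariants rG f.
Local Notation J := (jacobian f).
Variables (b : 'I_N -> S) (co : S -> 'I_N -> S).
Hypothesis coR : forall p i, co p i \in R.
Hypothesis coE : forall p, p = \sum_i co p i * b i.
Hypothesis coU : forall p (r : 'I_N -> S), (forall i, r i \in R) -> p = \sum_i r i * b i ->
  forall i, co p i = r i.
Variable u : 'I_N -> S.
Hypothesis b_dual_u : forall h, \sum_i act h (b i) * u i = J *+ (h == 1%g).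
Hypothesis dual_unit : dual_mx co u \in unitmx.

Local Notation Phi := (phi_mx rG b).
Local Notation A := (invariants rG).
Local Notation iv := (\val : {rmorphism A -> S}).

Definition coA (p : S) (i : 'I_N) : A := Invariant (coR p i).

Lemma coA_D p q i : coA (p + q) i = coA p i + coA q i.
Proof. by apply: val_inj; rewrite rmorphD /= (coD coR coE coU). Qed.

Lemma coA_M (a : A) p i : coA (iv a * p) i = a * coA p i.
Proof. by apply: val_inj; rewrite rmorphM /= (coM coR coE coU) //; exact: valP. Qed.

Lemma coA_E p : p = \sum_i iv (coA p i) * b i.
Proof. exact: coE. Qed.

Lemma coA_basis i j : coA (b i) j = (i == j)%:R.
Proof. by apply: val_inj; rewrite rmorph_nat /= (co_basis coU). Qed.

Lemma coA_sum (a x : 'I_N -> _) j :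
  coA (\sum_i iv (a i) * x i) j = \sum_i a i * coA (x i) j.
Proof.
have c0 : coA 0 j = 0 by apply: (addrI (coA 0 j)); rewrite -coA_D !addr0.
rewrite (big_morph (fun p => coA p j) (fun p q => coA_D p q j) c0).
by apply: eq_bigr => i _; rewrite coA_M.
Qed.

(** Multiplication by [s] on the [u_i] is transposed to that on the [b_i]. Paired with the [h(b_l)],
    the two sides give [s J] and [h(s) J] at [h = 1] and vanish elsewhere, so they agree by
    injectivity of [Phi]. *)
Lemma dual_mult s l : s * u l = \sum_i iv (coA (s * b i) l) * u i.
Proof.
change (s * u l = \sum_i co (s * b i) l * u i).
pose X : 'cV[S]_N := \col_l (s * u l).
pose Y : 'cV[S]_N := \col_l \sum_i co (s * b i) l * u i.
suff : X = Y by move/colP/(_ l); rewrite !mxE.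
apply: (mulmx_det_cancel (det_phi_mx_neq0 charK f_basic b_dual_u)).
apply/colP => p; rewrite !mxE; set h := enum_val p.
transitivity (s * (J *+ (h == 1%g))).
  by rewrite -b_dual_u mulr_sumr; apply: eq_bigr => i _; rewrite !mxE mulrCA.
transitivity (act h s * (J *+ (h == 1%g))).
  by case: eqP => [->|_]; rewrite ?Defs.act1 // !mulr0n !mulr0.
rewrite -b_dual_u mulr_sumr.
under [RHS]eq_bigr => i _ do rewrite !mxE mulr_sumr.
rewrite exchange_big; apply: eq_bigr => i _ /=.
rewrite mulrA -rmorphM /= {1}(coE (s * b i)) rmorph_sum mulr_suml.
apply: eq_bigr => j _; rewrite rmorphM /= (elimT (invP _ _) (coR _ _)).
by rewrite -mulrA mulrCA.
Qed.

Lemma phi_mulv (h : {ffun gT -> S^o}) : (exists t : tensSS rG, h = phi t) <->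
  exists W, forall p, h (enum_val p) = mulv Phi W p.
Proof.
split=> [[t ->]|[W WE]].
  exists (tens_coord co t 0) => p; rewrite (phi_coord coR coE coU).
  by apply: eq_bigr => i _; rewrite mxE mulrC.
exists (\sum_i W i *: tens_basis rG b i); apply/ffunP => g.
rewrite -[g]enum_rankK WE raddf_sum sum_ffunE; apply: eq_bigr => i _.
by rewrite /= linearZ ffunE /= [phi _ _]phiE mul1r mxE mulrC.
Qed.


Section Localization.
Variables (k : fieldType) (rho : {rmorphism A -> k}) (D : A).
Hypothesis rho_ker : forall a, rho a = 0 <-> exists c, a = c * D.
Hypothesis rho_frac : forall x, exists a c, rho c != 0 /\ x = rho a / rho c.
Variables (E : S) (r : nat) (J' t : S) (c0 : A).
Hypothesis DE : iv D = E ^+ r.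
Hypothesis r_gt0 : (0 < r)%N.
Hypothesis E0 : E != 0.
Hypothesis JE : J = E ^+ r.-1 * J'.
Hypothesis c0E : iv c0 = t * J'.
Hypothesis c0_neq0 : rho c0 != 0.

Local Notation C := (coker_mx b coA rho Phi).
Local Notation d := (\rank (cokermx (big_mx b coA rho Phi))).

(** [Q] is the reduction of [dual_mx]. The identity computes the coordinates of [s u_l] twice: by
    expanding [u_l] in the [b_i], and by [dual_mult]. *)
Lemma dual_mx_sym : exists2 Q : 'M[k]_N, Q \in unitmx &
  forall s, (mult_mx b coA rho s)^T *m Q = Q *m mult_mx b coA rho s.
Proof.
pose QA : 'M[A]_N := \matrix_(j, i) coA (u i) j.
have QE : map_mx iv QA = dual_mx co u by apply/matrixP => i j; rewrite !mxE.
exists (map_mx rho QA) => [|s].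
  rewrite unitmxE unitfE det_map_mx.
  have := dual_unit; rewrite -QE unitmxE det_map_mx => u1.
  (* Invertibility is known over [S] only; the inverse of an invariant is again invariant, so it can
     be reduced. *)
  have [w wR /esym we] : exists2 w, w \in R & 1 = w * iv (\det QA).
    apply: mpdvd_inv; [exact: rpred1 | exact: valP | by apply: contraTneq u1 => ->; rewrite unitr0 |].
    by case/unitrP: u1 => v [v1 _]; exists v.
  have : rho (Invariant wR * \det QA) = 1.
    by rewrite -(rmorph1 rho); congr (rho _); apply: val_inj; rewrite rmorphM.
  by apply: contra_eq_neq => z; rewrite rmorphM /= z mulr0 eq_sym oner_eq0.
apply/matrixP => j l; rewrite !mxE.
have e : \sum_i coA (s * b i) j * coA (u l) i = \sum_i coA (u i) j * coA (s * b i) l.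
  transitivity (coA (s * u l) j).
    rewrite {2}(coA_E (u l)) mulr_sumr; under [in RHS]eq_bigr => i _ do rewrite mulrCA.
    by rewrite coA_sum; apply: eq_bigr => i _; rewrite mulrC.
  by rewrite dual_mult coA_sum; apply: eq_bigr => i _; rewrite mulrC.
have /(congr1 rho) := e; rewrite !rmorph_sum /= => e1.
apply: eq_trans (eq_trans _ e1) _; apply: eq_bigr => i _.
  by rewrite !mxE rmorphM.
by rewrite !mxE rmorphM.
Qed.

Lemma localization_dim : exists a, N = (r * a)%N /\ (2 * d = N * (N - a))%N.
Proof.
have [Q uQ Q_sym] := dual_mx_sym.
exists (\rank (mult_mx b coA rho J)); split.
  exact: (mult_mx_J_rank coA_D coA_M coA_E coA_basis rho_ker rho_frac DE r_gt0 E0 JE c0E c0_neq0).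
have uT : det_mx rG \in unitmx.
  have [x x0 xE] := det_det_mx rG; rewrite unitmxE xE.
  by apply/unitrPr; exists (x^-1)%:MP; rewrite -mpolyCM divff.
exact: (rank_big_mx coA_D coA_M coA_E coA_basis rho_ker rho_frac DE r_gt0 E0 JE c0E c0_neq0
  (phi_psi_mx f_basic b_dual_u) (psi_phi_mx charK f_basic b_dual_u)
  (psi_mxE coR coE u) dual_unit uT uQ Q_sym).
Qed.

Variables (M : lmodType S) (P : {ffun gT -> S^o} -> M).
Hypothesis P_lin : linear P.
Hypothesis P_surj : forall w, exists h, P h = w.
Hypothesis P_eq : forall h h', P h = P h' <-> exists t : tensSS rG, h - h' = phi t.

Let PZ s h : s *: P h = P (s *: h).
Proof. by have := P_lin s h 0; rewrite !addr0 (linear_at0 P_lin) addr0 => ->. Qed.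

Let Y (h : {ffun gT -> S^o}) (p : 'I_N) : S := h (enum_val p).

Lemma localization_kernel h : blk coA rho (Y h) *m C = 0 <->
  exists a, rho a != 0 /\ iv a *: P h = 0.
Proof.
rewrite -(coker_image coA_D coA_M coA_E coA_basis rho_ker rho_frac DE r_gt0 JE c0E c0_neq0
  (phi_psi_mx f_basic b_dual_u) (Y h)).
have e (a : A) : iv a *: P h = 0 <-> exists W, forall p, iv a * Y h p = mulv Phi W p.
  rewrite PZ -{1}(linear_at0 P_lin) P_eq subr0 phi_mulv.
  split=> [[W WE]|[W WE]]; exists W => p; rewrite -WE.
    by rewrite ffunE.
  by rewrite ffunE.
split=> [[c hc /e h0]|[c [hc /e h0]]]; first by exists c.
by exists c.
Qed.

(** [iota] reduces a representative modulo the discriminant and projects to the cokernel of the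
    reduced [Phi]; independence of the representative and the description of the kernel both come
    from [localization_kernel]. *)
Lemma localization_exists : exists iota : {additive M -> 'rV[k]_d}, is_localization rho iota.
Proof.
have [rep repE] := boolp.choice P_surj.
pose iota0 m : 'rV[k]_d := blk coA rho (Y (rep m)) *m C.
have YB h h' : blk coA rho (Y (h - h')) = blk coA rho (Y h) - blk coA rho (Y h').
  rewrite -[blk _ _ (Y h')]scale1r -(rmorph1 rho) -scaleNr -rmorphN -(blkM coA_M) -(blkD coA_D).
  by apply: eq_mxrow => p; rewrite /Y !ffunE rmorphN1 mulN1r.
have iota0E h : iota0 (P h) = blk coA rho (Y h) *m C.
  apply/eqP; rewrite -subr_eq0 -mulmxBl -YB; apply/eqP/localization_kernel.
  exists 1; rewrite rmorph1 oner_eq0; split=> //.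
  rewrite rmorph1 scale1r -(linear_at0 P_lin); apply/P_eq; rewrite subr0.
  by apply/P_eq; rewrite repE.
have iota_B : zmod_morphism iota0.
  move=> x y; have [h <-] := P_surj x; have [h' <-] := P_surj y.
  rewrite -(zmod_morphism_linear P_lin) !iota0E.
  by rewrite YB mulmxBl.
exists (HB.pack_for {additive M -> 'rV[k]_d} iota0 (GRing.isZmodMorphism.Build _ _ iota0 iota_B)).
split.
- move=> a m; have [h <-] := P_surj m.
  change (iota0 (inv_val a *: P h) = rho a *: iota0 (P h)).
  rewrite PZ !iota0E scalemxAl -(blkM coA_M); congr (_ *m _); apply: eq_mxrow => p.
  by rewrite /Y ffunE.
- move=> w; have [x ->] := coker_mx_surj w.
  have [c [X [hc XE]]] := blk_lift coA_D coA_M coA_basis rho_frac x.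
  exists c, (P [ffun g => X (enum_rank g) : S^o]); split=> //.
  change (x *m C = (rho c)^-1 *: iota0 (P [ffun g => X (enum_rank g) : S^o])).
  rewrite iota0E; have -> : blk coA rho (Y [ffun g => X (enum_rank g) : S^o]) = blk coA rho X.
    by apply: eq_mxrow => p; rewrite /Y ffunE enum_valK.
  by rewrite XE -scalemxAl scalerA mulVf // scale1r.
move=> m; have [h <-] := P_surj m.
change (iota0 (P h) = 0 <-> exists a, rho a != 0 /\ iv a *: P h = 0).
by rewrite iota0E; exact: localization_kernel.
Qed.

End Localization.
End RankAlong.

Lemma rank_formulas (r a d : nat) : (0 < r)%N -> (2 * d = (r * a) * (r * a - a))%N ->
  d%:R = (r%:R - 1) * (r * a)%:R ^+ 2 / (2 * r%:R) :> rat /\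
  d%:R = 'C(r, 2)%:R * ((r * a)%:R ^+ 2 / r%:R ^+ 2) :> rat.
Proof.
move=> r0 dE; have rn : (r%:R : rat) != 0 by rewrite Num.Theory.pnatr_eq0 -lt0n.
have two : (2%:R : rat) != 0 by rewrite Num.Theory.pnatr_eq0.
have dQ : 2 * d%:R = r%:R * (r%:R - 1) * a%:R ^+ 2 :> rat.
  rewrite -natrM dE -[X in (r * a - X)%N]mul1n -mulnBl !natrM natrB //.
  by ring.
have bQ : 2 * 'C(r, 2)%:R = r%:R * (r%:R - 1) :> rat.
  rewrite -natrM mul2n bin2 even_halfK; first by rewrite natrM -subn1 natrB.
  by case: (r) => // q; rewrite oddM /=; case: odd.
split; apply: (mulfI two); rewrite ?dQ ?mulrA ?bQ natrM.
  by field.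
by field.
Qed.

Section RankMirror.
Variables (K : fieldType) (gT : finGroupType) (n : nat).
Variable rG : mx_representation K [set: gT] n.
Local Notation S := {mpoly K[n]}.
Local Notation act := (Defs.act rG).
Local Notation R := (inv_pred rG).
Local Notation N := #|gT|.
Hypothesis charK : [pchar K] =i pred0.
Hypothesis rG_faithful : mx_faithful rG.
Hypothesis G_reflection : <<pseudo_reflections rG>>%g = [set: gT].
Variable f : n.-tuple S.
Hypothesis f_basic : basic_invariants rG f.
Local Notation J := (jacobian f).
Variables (b : 'I_N -> S) (co : S -> 'I_N -> S).
Hypothesis coR : forall p i, co p i \in R.
Hypothesis coE : forall p, p = \sum_i co p i * b i.
Hypothesis coU : forall p (r : 'I_N -> S), (forall i, r i \in R) -> p = \sum_i r i * b i ->
  forall i, co p i = r i.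
Variable u : 'I_N -> S.
Hypothesis b_dual_u : forall h, \sum_i act h (b i) * u i = J *+ (h == 1%g).
Hypothesis dual_unit : dual_mx co u \in unitmx.
Variable L : 'M[K]_n -> 'cV[K]_n.
Hypothesis L_root : mirror_roots rG L.
Variable H : 'M[K]_n.
Hypothesis hH : H \in mirrors rG.
Local Notation r := (ramif rG H).
Local Notation E := (orbit_form rG L H).

Let D : invariants rG :=
  Invariant (orbit_discriminant_inv charK rG_faithful G_reflection L_root hH).

Lemma discriminant_residue_field : exists (k : fieldType) (rho : {rmorphism invariants rG -> k}),
  is_residue_field D rho.
Proof.
have D0 : inv_val D != 0 by rewrite expf_neq0 // orbit_form_neq0.
have dvdD a : (exists c, a = c * D) <-> mpdvd (inv_val D) (inv_val a).
  split=> [[c ->]|]; first by exists (inv_val c).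
  move=> /(mpdvd_inv (valP a) (valP D) D0)[t tR tE].
  by exists (Invariant tR); apply: val_inj.
apply: residue_field_exists => [c e|x y].
  have : mpdvd (inv_val D) 1 by apply/(dvdD 1); exists c.
  by move/(orbit_discriminant_dvd hH)/(lin_form_not_unit (L_neq0 charK rG_faithful L_root hH)).
rewrite !dvdD; apply: orbit_discriminant_prime => //; exact: valP.
Qed.

Theorem rank_along_orbit : exists (Delta : invariants rG) (d : nat),
  [/\ inv_val Delta = orbit_discriminant rG L H,
      rank_along Delta (skew_quot rG) d,
      d%:R = (r%:R - 1) * N%:R ^+ 2 / (2 * r%:R) :> rat
    & d%:R = 'C(r, 2)%:R * (N%:R ^+ 2 / r%:R ^+ 2) :> rat].
Proof.
have [k [rho rhoP]] := discriminant_residue_field.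
have [rho_ker rho_frac] := rhoP.
have Jmult : {in mirror_orbit rG H, forall H', exists q,
    J = lin_form (L H') ^+ r.-1 * q /\ ~ mpdvd (lin_form (L H')) q}.
  move=> H' oH'; have mH' := orbit_mirrors oH'; rewrite -(orbit_ramif hH oH').
  have /mirrorsP[s sR H'E] := mH'; have [s1 [l sE]] := mirror_coroot L_root sR.
  rewrite H'E.
  exact: (jacobian_mult charK f_basic coR coE b_dual_u dual_unit rG_faithful sE s1).
have [J' [c [t [JE cR cE cD]]]] := orbit_form_factor charK rG_faithful L_root hH Jmult.
pose c0 : invariants rG := Invariant cR.
have c0_neq0 : rho c0 != 0.
  apply/eqP => /rho_ker[a aE]; apply: cD; exists (inv_val a).
  exact: (congr1 (fun x : invariants rG => inv_val x) aE).
have E0 : E != 0 by apply: orbit_form_neq0.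
have r0 := ramif_gt0 rG H.
have [a [Na dE]] := localization_dim charK f_basic coR coE coU b_dual_u dual_unit rho_ker rho_frac
  (erefl : \val D = _) r0 E0 JE (cE : \val c0 = _) c0_neq0.
have [iota iotaP] := localization_exists f_basic coR coE coU b_dual_u rho_ker rho_frac
  (erefl : \val D = _) r0 JE (cE : \val c0 = _) c0_neq0 (skew_pi_linear rG) (skew_pi_surj (rG := rG)) (skew_pi_eq rG charK).
exists D, (\rank (cokermx (big_mx b (coA coR) rho (phi_mx rG b)))).
have [f1 f2] := rank_formulas r0 (etrans dE (congr1 (fun m => m * (m - a))%N Na)).
rewrite -Na in f1 f2; split=> //; first by rewrite orbit_discriminantE.
exists k, rho, 'rV[k]_(\rank (cokermx (big_mx b (coA coR) rho (phi_mx rG b)))), iota; split=> //.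
rewrite dimvf dim_matrix; exact: mul1n.
Qed.

End RankMirror.

(** * Existence of the bases and the determinant formula *)

Section FactorizationData.
Variables (K : fieldType) (gT : finGroupType) (n : nat).
Variable rG : mx_representation K [set: gT] n.
Local Notation S := {mpoly K[n]}.
Local Notation act := (Defs.act rG).
Local Notation R := (inv_pred rG).
Local Notation N := #|gT|.
Hypothesis charK : [pchar K] =i pred0.
Hypothesis G_reflection : <<pseudo_reflections rG>>%g = [set: gT].
Variable f : n.-tuple S.
Hypothesis f_basic : basic_invariants rG f.
Local Notation J := (jacobian f).
Variable psi : {linear {ffun gT -> S^o} -> tensSS rG}.
Hypothesis phi_psi : forall h, phi (psi h) = jacobian f *: h.
Hypothesis psi_phi : forall t : tensSS rG, psi (phi t) = jacobian f *: t.

Definition dual_bases (b u : 'I_N -> S) (co : S -> 'I_N -> S) : Prop :=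
  [/\ forall p i, co p i \in R,
      forall p, p = \sum_i co p i * b i,
      forall p (r : 'I_N -> S), (forall i, r i \in R) -> p = \sum_i r i * b i ->
        forall i, co p i = r i,
      forall h, \sum_i act h (b i) * u i = J *+ (h == 1%g)
    & dual_mx co u \in unitmx].

Lemma dual_bases_exist : exists (e : 'I_N -> 'X_{1..n}) u co,
  dual_bases (fun i => 'X_[e i]) u co /\
  exists2 c, c != 0 & c *: \det (phi_mx rG (fun i => 'X_[e i])) ^+ 2 = J ^+ N.
Proof.
have [f_homog _ _] := f_basic; have [dg f_dg] := boolp.choice f_homog.
have [k [e [b_span b_free]]] := invariants_basis charK G_reflection f_basic f_dg.
have [co [coR coE coU]] := coord_exists b_span b_free.
have kN := basis_size coR coE coU phi_psi psi_phi (jacobian_neq0 charK f_basic).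
subst k; have [u b_dual_u] := dual_family coR coE coU phi_psi.
have e_homog i : ('X_[e i] : S) \is (mdeg (e i)).-homog by rewrite dhomogX.
exists e, u, co; split; last first.
  exact: (det_phi_mx_sqr charK f_basic coR coE coU b_dual_u e_homog f_dg).
split=> //; exact: (dual_mx_unit charK f_basic coR coE coU b_dual_u e_homog f_dg).
Qed.

Lemma homogeneous_bases_exist :
  exists (b : 'I_N -> tensSS rG) (c : 'I_N -> {ffun gT -> S^o}),
    [/\ is_basis b, forall i, tens_homog (b i), is_basis c & forall i, maps_homog (c i)].
Proof.
have [e [u [co [[coR coE coU _ _] _]]]] := dual_bases_exist.
exists (tens_basis rG (fun i => 'X_[e i])), (fun p => mdelta K n (enum_val p)); split.
- exact: (tens_basisP coR coE coU).
- move=> i; exists (mdeg (e i)), [:: (1, 'X_[e i])]; rewrite big_seq1; split=> // p.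
  rewrite inE => /eqP ->; exists 0, (mdeg (e i)); split=> //; first exact: dhomog1.
  by rewrite dhomogX.
- exact: mdelta_basis.
move=> p; exists 0 => g; rewrite ffunE.
by case: (_ == _); rewrite ?dhomog1 ?rpred0.
Qed.

(** [#|gT|] may be odd, so the half power of [J] is given as a square root of [J ^+ N]; the scalar
    in front of the squared determinant is absorbed by a square root in [K]. *)
Lemma det_phi_sqrt (b : 'I_N -> tensSS rG) (c : 'I_N -> {ffun gT -> S^o}) (Phi : 'M[S]_N) :
    (forall x : K, exists y, y ^+ 2 = x) ->
    is_basis b -> is_basis c -> is_matrix b c (phi (rG := rG)) Phi ->
  exists (D : S) (k : K), [/\ D ^+ 2 = J ^+ N, k != 0 & \det Phi = k *: D].
Proof.
move=> sqrtK hb hc hPhi; have [e [u [co [[coR coE coU _ _] [x x0 xE]]]]] := dual_bases_exist.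
have [c0 c0n0 ->] := det_phi coR coE coU hb hc hPhi.
have [y yE] := sqrtK x.
have y0 : y != 0 by apply: contraNneq x0 => y0; rewrite -yE y0 expr0n.
exists (y *: \det (phi_mx rG (fun i => 'X_[e i]))), (c0 / y).
rewrite exprZn yE xE mulf_neq0 ?invr_neq0 //; split=> //.
by rewrite scalerA mulfVK.
Qed.

End FactorizationData.

Theorem proposition3p20 (R : realType) (gT : finGroupType) (n : nat)
    (rG : mx_representation R[i] [set: gT] n) (rG_faithful : mx_faithful rG)
    (G_reflection : <<pseudo_reflections rG>>%g = [set: gT])
    (f : n.-tuple {mpoly R[i][n]}) (f_basic : basic_invariants rG f)
    (psi : {linear {ffun gT -> {mpoly R[i][n]}^o} -> tensSS rG})
    (phi_psi : forall h, phi (psi h) = jacobian f *: h)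
    (psi_phi : forall t : tensSS rG, psi (phi t) = jacobian f *: t) :
  (* S (x)_R S and Maps(G, S) have homogeneous S-bases of size |G| *)
  (exists (b : 'I_#|gT| -> tensSS rG)
          (c : 'I_#|gT| -> {ffun gT -> {mpoly R[i][n]}^o}),
     [/\ is_basis b, forall i, tens_homog (b i),
         is_basis c & forall i, maps_homog (c i)]) /\
  [/\ (* (a) *)
      forall (b : 'I_#|gT| -> tensSS rG)
             (c : 'I_#|gT| -> {ffun gT -> {mpoly R[i][n]}^o})
             (Phi Psi : 'M[{mpoly R[i][n]}]_#|gT|),
        is_basis b -> is_basis c ->
        is_matrix b c (phi (rG := rG)) Phi -> is_matrix c b psi Psi ->
        exists P Q : 'M[{mpoly R[i][n]}]_#|gT|,
          [/\ P \in unitmx, Q \in unitmx & Psi = P *m Phi^T *m Q],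
      (* (b) the syzygy is the kernel of the free cover
         Maps(G, S/(J)) -> A/AeA given by the matrix factorization *)
      exists q : {linear {ffun gT -> quot_principal (jacobian f)} -> skew_quot rG},
        (forall h : {ffun gT -> {mpoly R[i][n]}^o},
           q [ffun g => quot_pi (principal_pred (jacobian f)) (h g)]
           = skew_pi rG h) /\
        lmod_iso (hom_mod (skew_quot rG) (quot_principal (jacobian f)))
                 (kernel q),
      (* (c) D is J^(|G|/2), i.e. a square root of J^|G| *)
      forall (b : 'I_#|gT| -> tensSS rG)
             (c : 'I_#|gT| -> {ffun gT -> {mpoly R[i][n]}^o})
             (Phi : 'M[{mpoly R[i][n]}]_#|gT|),
        is_basis b -> (forall i, tens_homog (b i)) ->
        is_basis c -> (forall i, maps_homog (c i)) ->
        is_matrix b c (phi (rG := rG)) Phi ->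
        exists (D : {mpoly R[i][n]}) (k : R[i]),
          [/\ D ^+ 2 = jacobian f ^+ #|gT|, k != 0 & \det Phi = k *: D]
    & (* (d) *)
      forall (L : 'M[R[i]]_n -> 'cV[R[i]]_n), mirror_roots rG L ->
      forall H, H \in mirrors rG ->
      let r := ramif rG H in
      exists (Delta : invariants rG) (d : nat),
        [/\ inv_val Delta = orbit_discriminant rG L H,
            rank_along Delta (skew_quot rG) d,
            d%:R = (r%:R - 1) * #|gT|%:R ^+ 2 / (2 * r%:R) :> rat
          & d%:R = 'C(r, 2)%:R * (#|gT|%:R ^+ 2 / r%:R ^+ 2) :> rat] ].
Proof.
have charC : [pchar R[i]] =i pred0 by exact: Num.Theory.pchar_num.
have sqrtC (x : R[i]) : exists y, y ^+ 2 = x := ex_intro _ _ (Num.Theory.sqrtCK x).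
split; first exact: (homogeneous_bases_exist charC G_reflection f_basic phi_psi psi_phi).
have [e [u [co [[coR coE coU b_dual_u dual_unit] _]]]] :=
  dual_bases_exist charC G_reflection f_basic phi_psi psi_phi.
split.
- move=> b c Phi Psi.
  exact: (psi_transpose charC f_basic coR coE coU b_dual_u dual_unit phi_psi).
- exact: (hom_syzygy charC f_basic coR coE coU b_dual_u dual_unit phi_psi).
- move=> b c Phi b_basis _ c_basis _.
  exact: (det_phi_sqrt charC G_reflection f_basic phi_psi psi_phi sqrtC b_basis c_basis).
move=> L L_root H hH.
exact: (rank_along_orbit charC rG_faithful G_reflection f_basic coR coE coU b_dual_u
  dual_unit L_root hH).
Qed.
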